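(* Let $\mathcal{B}$ be a unital $C^\ast$-algebra and $\mu\in\Sigma_{\mathcal{B}}$. Then $\mu$ is $\boxplus$-infinitely divisible if and only if the restriction of $\rho_\mu$ to $\mathcal{B}\langle\mathcal{X}\rangle_0$ is positive, i.e. $\rho_\mu(f^\ast f)\ge 0$ for all $f\in\mathcal{B}\langle\mathcal{X}\rangle_0$.
   Context: $\mathcal{B}\langle\mathcal{X}\rangle$ is the $\ast$-algebra freely generated by $\mathcal{B}$ and a selfadjoint symbol $\mathcal{X}$ (not assumed to commute with $\mathcal{B}$); $\mathcal{B}\langle\mathcal{X}\rangle_0$ is its $\ast$-subalgebra of polynomials without a free (constant) term; $\mathcal{B}\langle X_1,\dots,X_N\rangle$ is the $\ast$-algebra freely generated by $\mathcal{B}$ and non-commuting selfadjoint symbols $X_1,\dots,X_N$. $\Sigma_{\mathcal{B}}$ is the set of all positive conditional expectations $\mathcal{B}\langle\mathcal{X}\rangle\to\mathcal{B}$ (unital positive $\mathcal{B}$-bimodule maps). Free cumulants: for $\mu\in\Sigma_{\mathcal{B}}$, the free cumulants are the multilinear maps $\kappa_{n,\mu}:\mathcal{B}^n\to\mathcal{B}$, $n\ge1$, defined recursively by $$\mu(\mathcal{X}b_1\mathcal{X}b_2\cdots\mathcal{X}b_n)=\sum_{p=1}^n\ \sum_{0=j_0<j_1<\dots<j_{p-1}<j_p=n}\kappa_{p,\mu}(Y_1,\dots,Y_p),\qquad Y_s=b_{j_{s-1}+1}\,\mu(\mathcal{X}b_{j_{s-1}+2}\cdots\mathcal{X}b_{j_s}),$$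 where $\mu$ of the empty word is $1$. The map $\rho_\mu:\mathcal{B}\langle\mathcal{X}\rangle\to\mathcal{B}$ is the unital $\mathcal{B}$-bimodule map with $\rho_\mu(\mathcal{X}b_1\mathcal{X}b_2\cdots\mathcal{X}b_n)=\kappa_{n,\mu}(b_1,\dots,b_n)$ for all $n\ge1$ and $b_1,\dots,b_n\in\mathcal{B}$. Free additive convolution: given $\mu_1,\dots,\mu_N\in\Sigma_{\mathcal{B}}$, let $\Phi:\mathcal{B}\langle X_1,\dots,X_N\rangle\to\mathcal{B}$ be the conditional expectation whose restriction to $\mathcal{B}\langle X_j\rangle\cong\mathcal{B}\langle\mathcal{X}\rangle$ is $\mu_j$ and such that $X_1,\dots,X_N$ are free with respect to $\Phi$: $\Phi(A_1\cdots A_m)=0$ whenever $A_k\in\mathcal{B}\langle X_{\epsilon(k)}\rangle$, $\epsilon(k)\neq\epsilon(k+1)$ and $\Phi(A_k)=0$ for all $k$. The free additive convolution is $\boxplus_{j=1}^N\mu_j=\Phi\circ\tau$, where $\tau:\mathcal{B}\langle\mathcal{X}\rangle\to\mathcal{B}\langle X_1,\dots,X_N\rangle$ is the homomorphism fixing $\mathcal{B}$ with $\tau(\mathcal{X})=X_1+\dots+X_N$; it belongs to $\Sigma_{\mathcal{B}}$. $\mu\in\Sigma_{\mathcal{B}}$ is $\boxplus$-infinitely divisible if for every positive integer $N$ there exists $\mu_N\in\Sigma_{\mathcal{B}}$ such that $\mu$ is the free additive convolution of $N$ copies of $\mu_N$. *)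

(* Defs.v *)
From HB Require Import structures.
From mathcomp Require Import all_boot all_algebra.
From mathcomp Require Import complex.
From mathcomp Require Import boolp classical_sets reals.

Set Implicit Arguments.
Unset Strict Implicit.
Unset Printing Implicit Defensive.

Import GRing.Theory Num.Theory.

Local Open Scope ring_scope.
Local Open Scope quotient_scope.

HB.mixin Record isStarAlgebra (K : numClosedFieldType) A
    of GRing.Algebra K A := {
  star : A -> A;
  starD : {morph star : x y / x + y};
  starZ : forall (a : K) x, star (a *: x) = a^* *: star x;
  starM : forall x y, star (x * y) = star y * star x;
  starK : involutive star
}.

#[short(type="starAlgType")]
HB.structure Definition StarAlgebra (K : numClosedFieldType) :=
  {A of isStarAlgebra K A & GRing.Algebra K A}.

(* The join of GRing.Algebra with CompleteNormedModule is rejected by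
   Hierarchy-Builder (NumDomain already joins rings and normed Z-modules), so
   the norm and the completeness axiom are spelled out here. *)
HB.mixin Record isCStarNormed (R : realType) A of StarAlgebra R[i] A := {
  cnorm : A -> R;
  cnorm_eq0 : forall x, cnorm x = 0 -> x = 0;
  cnormD : forall x y, cnorm (x + y) <= cnorm x + cnorm y;
  cnormZ : forall (a : R[i]) x, cnorm (a *: x) = Normc.normc a * cnorm x;
  cnormM : forall x y, cnorm (x * y) <= cnorm x * cnorm y;
  cnorm_starM : forall x, cnorm (star x * x) = cnorm x ^+ 2;
  cnorm_complete : forall u : nat -> A,
    (forall e : R, 0 < e -> exists N : nat, forall m n : nat,
        (N <= m)%N -> (N <= n)%N -> cnorm (u m - u n) < e) ->
    exists l : A, forall e : R, 0 < e -> exists N : nat, forall n : nat,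
        (N <= n)%N -> cnorm (u n - l) < e
}.

(* Unital C*-algebras, with 1 != 0 since the underlying ring is an nzRingType. *)
#[short(type="cstarAlgType")]
HB.structure Definition CStarAlgebra (R : realType) :=
  {A of isCStarNormed R A & StarAlgebra R[i] A}.

Definition cstar_pos (R : realType) (B : cstarAlgType R) (x : B) : Prop :=
  exists y : B, x = star y * y.

Section StarTheory.
Variables (K : numClosedFieldType) (A : starAlgType K).
Implicit Types x y : A.

Lemma star0 : star (0 : A) = 0.
Proof. by apply: (addrI (star (0 : A))); rewrite -starD !addr0. Qed.

Lemma star1 : star (1 : A) = 1.
Proof. by rewrite -[LHS]mulr1 -{2}[1]starK -starM mulr1 starK. Qed.

Lemma starA (a : K) : star (a%:A : A) = a^*%:A.
Proof. by rewrite starZ star1. Qed.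

End StarTheory.

(* The algebra B<X_i, i in I>, presented by generators and relations: formal
   expressions in the elements of B and the symbols X_i, modulo the unital
   K-algebra axioms and the relations making B a unital subalgebra.  A scalar a
   is represented by the element a%:A of B, so K-linearity of the
   multiplication amounts to a%:A commuting with the symbols. *)
Section FreeAlgebra.
Variables (K : numClosedFieldType) (B : starAlgType K) (I : Type).

Inductive ncterm : Type :=
| Cst of B
| Var of I
| Add of ncterm & ncterm
| Mul of ncterm & ncterm.

Inductive nceq : ncterm -> ncterm -> Prop :=
| nceq_refl t : nceq t t
| nceq_sym s t : nceq s t -> nceq t s
| nceq_trans s t u : nceq s t -> nceq t u -> nceq s u
| nceq_add s s' t t' : nceq s s' -> nceq t t' -> nceq (Add s t) (Add s' t')
| nceq_mul s s' t t' : nceq s s' -> nceq t t' -> nceq (Mul s t) (Mul s' t')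
| nceq_addA s t u : nceq (Add s (Add t u)) (Add (Add s t) u)
| nceq_addC s t : nceq (Add s t) (Add t s)
| nceq_add0 t : nceq (Add (Cst 0) t) t
| nceq_mulA s t u : nceq (Mul s (Mul t u)) (Mul (Mul s t) u)
| nceq_mul1l t : nceq (Mul (Cst 1) t) t
| nceq_mul1r t : nceq (Mul t (Cst 1)) t
| nceq_mul0l t : nceq (Mul (Cst 0) t) (Cst 0)
| nceq_mulDl s t u : nceq (Mul (Add s t) u) (Add (Mul s u) (Mul t u))
| nceq_mulDr s t u : nceq (Mul s (Add t u)) (Add (Mul s t) (Mul s u))
| nceq_cstD b c : nceq (Cst (b + c)) (Add (Cst b) (Cst c))
| nceq_cstM b c : nceq (Cst (b * c)) (Mul (Cst b) (Cst c))
| nceq_scal (a : K) i : nceq (Mul (Cst a%:A) (Var i)) (Mul (Var i) (Cst a%:A)).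

HB.instance Definition _ := gen_eqMixin ncterm.
HB.instance Definition _ := gen_choiceMixin ncterm.

Definition nceqb (s t : ncterm) : bool := `[< nceq s t >].

Lemma nceqb_refl : reflexive nceqb.
Proof. by move=> t; apply/asboolP/nceq_refl. Qed.

Lemma nceqb_sym : symmetric nceqb.
Proof. by move=> s t; apply/asboolP/asboolP => /nceq_sym. Qed.

Lemma nceqb_trans : transitive nceqb.
Proof.
by move=> t s u /asboolP st /asboolP tu; apply/asboolP/(nceq_trans st).
Qed.

Canonical nceq_equiv := EquivRel nceqb nceqb_refl nceqb_sym nceqb_trans.

Definition ncpoly : Type := {eq_quot nceq_equiv}.
HB.instance Definition _ := Choice.on ncpoly.
HB.instance Definition _ := EqQuotient.on ncpoly.

Definition ncpi (t : ncterm) : ncpoly := \pi_ncpoly t.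

Lemma ncpiP s t : ncpi s = ncpi t <-> nceq s t.
Proof. by rewrite /ncpi; split=> [/eqmodP/asboolP|st] //; apply/eqmodP/asboolP. Qed.

Lemma ncreprK (f : ncpoly) : ncpi (repr f) = f.
Proof. exact: reprK. Qed.

Lemma nc_ind (P : ncpoly -> Prop) : (forall t, P (ncpi t)) -> forall f, P f.
Proof. by move=> Pt f; rewrite -[f]ncreprK. Qed.

Lemma repr_ncpi t : nceq (repr (ncpi t)) t.
Proof. by apply/ncpiP; rewrite ncreprK. Qed.

Definition ncC (b : B) : ncpoly := ncpi (Cst b).
Definition ncX (i : I) : ncpoly := ncpi (Var i).
Definition ncadd (f g : ncpoly) := ncpi (Add (repr f) (repr g)).
Definition ncmul (f g : ncpoly) := ncpi (Mul (repr f) (repr g)).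
Definition ncopp (f : ncpoly) := ncmul (ncC (- 1)) f.
Definition ncscale (a : K) (f : ncpoly) := ncmul (ncC a%:A) f.

Lemma ncaddE s t : ncadd (ncpi s) (ncpi t) = ncpi (Add s t).
Proof. by apply/ncpiP/nceq_add; apply: repr_ncpi. Qed.

Lemma ncmulE s t : ncmul (ncpi s) (ncpi t) = ncpi (Mul s t).
Proof. by apply/ncpiP/nceq_mul; apply: repr_ncpi. Qed.

Let ncE := (ncaddE, ncmulE).

Lemma ncaddA : associative ncadd.
Proof.
by elim/nc_ind=> s; elim/nc_ind=> t; elim/nc_ind=> u; rewrite !ncE;
  apply/ncpiP/nceq_addA.
Qed.

Lemma ncaddC : commutative ncadd.
Proof.
by elim/nc_ind=> s; elim/nc_ind=> t; rewrite !ncE; apply/ncpiP/nceq_addC.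
Qed.

Lemma ncadd0 : left_id (ncC 0) ncadd.
Proof. by elim/nc_ind=> s; rewrite !ncE; apply/ncpiP/nceq_add0. Qed.

Lemma ncmulA : associative ncmul.
Proof.
by elim/nc_ind=> s; elim/nc_ind=> t; elim/nc_ind=> u; rewrite !ncE;
  apply/ncpiP/nceq_mulA.
Qed.

Lemma ncmul1l : left_id (ncC 1) ncmul.
Proof. by elim/nc_ind=> s; rewrite !ncE; apply/ncpiP/nceq_mul1l. Qed.

Lemma ncmul1r : right_id (ncC 1) ncmul.
Proof. by elim/nc_ind=> s; rewrite !ncE; apply/ncpiP/nceq_mul1r. Qed.

Lemma ncmul0l : left_zero (ncC 0) ncmul.
Proof. by elim/nc_ind=> s; rewrite !ncE; apply/ncpiP/nceq_mul0l. Qed.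

Lemma ncmulDl : left_distributive ncmul ncadd.
Proof.
by elim/nc_ind=> s; elim/nc_ind=> t; elim/nc_ind=> u; rewrite !ncE;
  apply/ncpiP/nceq_mulDl.
Qed.

Lemma ncmulDr : right_distributive ncmul ncadd.
Proof.
by elim/nc_ind=> s; elim/nc_ind=> t; elim/nc_ind=> u; rewrite !ncE;
  apply/ncpiP/nceq_mulDr.
Qed.

Lemma ncCD b c : ncC (b + c) = ncadd (ncC b) (ncC c).
Proof. by rewrite !ncE; apply/ncpiP/nceq_cstD. Qed.

Lemma ncCM b c : ncC (b * c) = ncmul (ncC b) (ncC c).
Proof. by rewrite !ncE; apply/ncpiP/nceq_cstM. Qed.

Lemma ncaddN : left_inverse (ncC 0) ncopp ncadd.
Proof.
move=> f; rewrite /ncopp -{2}[f]ncmul1l -ncmulDl -ncCD addNr.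
exact: ncmul0l.
Qed.

HB.instance Definition _ :=
  GRing.isZmodule.Build ncpoly ncaddA ncaddC ncadd0 ncaddN.

Lemma ncscal_central (a : K) f : ncmul (ncC a%:A) f = ncmul f (ncC a%:A).
Proof.
elim/nc_ind: f; elim=> [b|i|s IHs t IHt|s IHs t IHt].
- by rewrite -!ncCM mulr_algl mulr_algr.
- by rewrite !ncE; apply/ncpiP/nceq_scal.
- by rewrite -ncaddE ncmulDl ncmulDr IHs IHt.
- by rewrite -ncmulE ncmulA IHs -ncmulA IHt ncmulA.
Qed.

End FreeAlgebra.

Section Evaluation.
Variables (K : numClosedFieldType) (B : starAlgType K) (I : Type).
Variables (A : pzRingType) (h : {rmorphism B -> A}) (x : I -> A).

Fixpoint nceval (t : ncterm B I) : A :=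
  match t with
  | Cst b => h b
  | Var i => x i
  | Add s t => nceval s + nceval t
  | Mul s t => nceval s * nceval t
  end.

Hypothesis hx : forall (a : K) i, h a%:A * x i = x i * h a%:A.

Lemma nceval_eq s t : nceq s t -> nceval s = nceval t.
Proof.
elim=> //=.
- by move=> {}s {}t u _ -> _ ->.
- by move=> {}s s' {}t t' _ -> _ ->.
- by move=> {}s s' {}t t' _ -> _ ->.
- by move=> *; rewrite addrA.
- by move=> *; rewrite addrC.
- by move=> *; rewrite rmorph0 add0r.
- by move=> *; rewrite mulrA.
- by move=> *; rewrite rmorph1 mul1r.
- by move=> *; rewrite rmorph1 mulr1.
- by move=> *; rewrite rmorph0 mul0r.
- by move=> *; rewrite mulrDl.
- by move=> *; rewrite mulrDr.
- by move=> *; rewrite rmorphD.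
- by move=> *; rewrite rmorphM.
Qed.

End Evaluation.

Section FreeAlgebraTheory.
Variables (K : numClosedFieldType) (B : starAlgType K) (I : Type).
Local Notation P := (ncpoly B I).

Lemma ncone_neq0 : ncC I (1 : B) != 0 :> P.
Proof.
apply/eqP => /ncpiP/(nceval_eq (h := idfun) (x := fun=> 0)) /=.
by move=> /(_ (fun _ _ => etrans (mulr0 _) (esym (mul0r _))))/eqP;
  rewrite oner_eq0.
Qed.

HB.instance Definition _ :=
  GRing.Zmodule_isNzRing.Build P (@ncmulA K B I) (@ncmul1l K B I)
    (@ncmul1r K B I) (@ncmulDl K B I) (@ncmulDr K B I) ncone_neq0.

Lemma ncC_zmod : zmod_morphism (ncC I : B -> P).
Proof.
by move=> b c; rewrite -mulN1r ncCD ncCM.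
Qed.

Lemma ncC_monoid : monoid_morphism (ncC I : B -> P).
Proof. by split=> // b c; rewrite ncCM. Qed.

HB.instance Definition _ := GRing.isZmodMorphism.Build B P (ncC I) ncC_zmod.
HB.instance Definition _ := GRing.isMonoidMorphism.Build B P (ncC I) ncC_monoid.

Lemma ncscaleA a b (f : P) : ncscale a (ncscale b f) = ncscale (a * b) f.
Proof.
by rewrite /ncscale ncmulA -ncCM mulr_algl scalerA.
Qed.

Lemma ncscale1 : left_id 1 (@ncscale K B I).
Proof. by move=> f; rewrite /ncscale scale1r ncmul1l. Qed.

Lemma ncscaleDr : right_distributive (@ncscale K B I) +%R.
Proof. by move=> a f g; rewrite /ncscale ncmulDr. Qed.

Lemma ncscaleDl (f : P) : {morph (@ncscale K B I)^~ f : a b / a + b}.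
Proof. by move=> a b; rewrite /ncscale scalerDl ncCD ncmulDl. Qed.

HB.instance Definition _ := GRing.Zmodule_isLmodule.Build K P
  ncscaleA ncscale1 ncscaleDr ncscaleDl.

Lemma ncscaleAl (a : K) (f g : P) : a *: (f * g) = a *: f * g.
Proof. exact: ncmulA. Qed.

HB.instance Definition _ := GRing.Lmodule_isLalgebra.Build K P ncscaleAl.

Lemma ncscaleAr (a : K) (f g : P) : a *: (f * g) = f * (a *: g).
Proof.
rewrite -[LHS]/(ncmul (ncC I a%:A) (ncmul f g)) ncmulA ncscal_central.
by rewrite -ncmulA.
Qed.

HB.instance Definition _ := GRing.Lalgebra_isAlgebra.Build K P ncscaleAr.

Lemma ncscaleE (a : K) (f : P) : a *: f = ncC I a%:A * f.
Proof. by []. Qed.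

Lemma ncCA (a : K) : ncC I (a%:A : B) = a%:A.
Proof. by rewrite ncscaleE mulr1. Qed.

Lemma ncpiD s t : ncpi (Add s t) = ncpi s + ncpi t :> P.
Proof. by rewrite -ncaddE. Qed.

Lemma ncpiM s t : ncpi (Mul s t) = ncpi s * ncpi t :> P.
Proof. by rewrite -ncmulE. Qed.

(* The involution is the one of B on constants and fixes the symbols. *)
Fixpoint tstar (t : ncterm B I) : ncterm B I :=
  match t with
  | Cst b => Cst I (star b)
  | Var i => Var B i
  | Add s t => Add (tstar s) (tstar t)
  | Mul s t => Mul (tstar t) (tstar s)
  end.

Definition ncstar (f : P) : P := ncpi (tstar (repr f)).

Lemma tstar_eq s t : nceq s t -> ncpi (tstar s) = ncpi (tstar t) :> P.
Proof.
elim=> //=; try by move=> *; apply/ncpiP; constructor.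
- by move=> {}s {}t u _ -> _ ->.
- by move=> {}s s' {}t t' _ IHs _ IHt; rewrite !ncpiD IHs IHt.
- by move=> {}s s' {}t t' _ IHs _ IHt; rewrite !ncpiM IHs IHt.
- by move=> u; rewrite ncpiD star0 add0r.
- by move=> *; rewrite !ncpiM mulrA.
- by move=> u; rewrite ncpiM star1 mulr1.
- by move=> u; rewrite ncpiM star1 mul1r.
- by move=> u; rewrite ncpiM star0 mulr0.
- by move=> *; rewrite starD; apply/ncpiP/nceq_cstD.
- by move=> *; rewrite starM; apply/ncpiP/nceq_cstM.
- by move=> *; rewrite starA; apply/ncpiP/nceq_sym/nceq_scal.
Qed.

Lemma ncstarE t : ncstar (ncpi t) = ncpi (tstar t).
Proof. exact/tstar_eq/repr_ncpi. Qed.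

Lemma ncstarD : {morph ncstar : f g / f + g}.
Proof.
by elim/nc_ind=> s; elim/nc_ind=> t; rewrite -ncpiD !ncstarE /= ncpiD.
Qed.

Lemma ncstarM f g : ncstar (f * g) = ncstar g * ncstar f.
Proof.
by elim/nc_ind: f => s; elim/nc_ind: g => t; rewrite -ncpiM !ncstarE /= ncpiM.
Qed.

Lemma ncstarC b : ncstar (ncC I b) = ncC I (star b).
Proof. exact: ncstarE. Qed.

Lemma ncstarX i : ncstar (ncX B i) = ncX B i.
Proof. exact: ncstarE. Qed.

Lemma ncstarZ (a : K) f : ncstar (a *: f) = a^* *: ncstar f.
Proof.
by rewrite ncscaleE ncstarM ncstarC starA ncCA mulr_algr.
Qed.

Lemma ncstarK : involutive ncstar.
Proof.
elim/nc_ind; elim=> [b|i|s IHs t IHt|s IHs t IHt].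
- by rewrite !ncstarC starK.
- by rewrite !ncstarX.
- by rewrite ncpiD !ncstarD IHs IHt.
- by rewrite ncpiM !ncstarM IHs IHt.
Qed.

HB.instance Definition _ :=
  isStarAlgebra.Build K P ncstarD ncstarZ ncstarM ncstarK.

End FreeAlgebraTheory.

(* The homomorphism fixing B and sending X_i to p i. *)
Section Substitution.
Variables (K : numClosedFieldType) (B : starAlgType K) (I J : Type).
Variable p : I -> ncpoly B J.

Definition ncsubst (f : ncpoly B I) : ncpoly B J :=
  nceval (ncC J : {rmorphism B -> ncpoly B J}) p (repr f).

Lemma ncsubstE t :
  ncsubst (ncpi t) = nceval (ncC J : {rmorphism B -> ncpoly B J}) p t.
Proof.
apply: nceval_eq; last exact: repr_ncpi.
by move=> a i /=; rewrite !ncCA mulr_algl mulr_algr.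
Qed.

Lemma ncsubstC b : ncsubst (ncC I b) = ncC J b.
Proof. exact: ncsubstE. Qed.

Lemma ncsubstX i : ncsubst (ncX B i) = p i.
Proof. exact: ncsubstE. Qed.

Lemma ncsubstD : {morph ncsubst : f g / f + g}.
Proof. by elim/nc_ind=> s; elim/nc_ind=> t; rewrite -ncpiD !ncsubstE. Qed.

Lemma ncsubst_zmod : zmod_morphism ncsubst.
Proof. by move=> f g; apply: (addIr (ncsubst g)); rewrite -ncsubstD !subrK. Qed.

Lemma ncsubst_monoid : monoid_morphism ncsubst.
Proof.
split; first by rewrite -(rmorph1 (ncC I)) /= ncsubstC rmorph1.
by elim/nc_ind=> s; elim/nc_ind=> t; rewrite -ncpiM !ncsubstE.
Qed.

HB.instance Definition _ :=
  GRing.isZmodMorphism.Build (ncpoly B I) (ncpoly B J) ncsubst ncsubst_zmod.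
HB.instance Definition _ :=
  GRing.isMonoidMorphism.Build (ncpoly B I) (ncpoly B J) ncsubst ncsubst_monoid.

End Substitution.

Section ConditionalExpectations.
Variables (R : realType) (B : cstarAlgType R).
Implicit Types (mu rho nu : ncpoly B unit -> B) (b : nat -> B).

(* K-linearity is implied, as scalars act through B. *)
Definition unital_bimod_map (I : Type) (phi : ncpoly B I -> B) : Prop :=
  [/\ phi 1 = 1,
      {morph phi : f g / f + g}
    & forall (b c : B) f, phi (ncC I b * f * ncC I c) = b * phi f * c].

Definition Sigma : set (ncpoly B unit -> B) :=
  [set mu | unital_bimod_map mu /\ forall f, cstar_pos (mu (star f * f))].

Definition ncX1 : ncpoly B unit := ncX B tt.

(* X b_m X b_(m+1) ... X b_(n-1) *)
Definition xprod b (m n : nat) : ncpoly B unit :=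
  \prod_(m <= k < n) (ncX1 * ncC unit (b k)).

Definition no_free_term : set (ncpoly B unit) :=
  [set f | exists2 ms : seq (B * seq B),
     all (fun m => m.2 != [::]) ms
   & f = \sum_(m <- ms) ncC unit m.1 * \prod_(c <- m.2) (ncX1 * ncC unit c)].

(* 0 = j_0 < j_1 < ... < j_(p-1) < j_p = n *)
Definition cut_points n p (j : p.+1.-tuple 'I_n.+1) : bool :=
  [&& sorted ltn (map val j), head 0 (map val j) == 0 & last 0 (map val j) == n]%N.

(* The list Y_1, ..., Y_p attached to j_0, ..., j_p and b_1, b_2, ... *)
Definition cumulant_args mu b p (j : seq nat) : seq B :=
  [seq b (nth 0 j s.-1).+1 * mu (xprod b (nth 0 j s.-1).+2 (nth 0 j s).+1)
     | s <- iota 1 p].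

(* kappa_n is the restriction of kappa to the lists of length n, n >= 1. *)
Definition free_cumulants mu (kappa : seq B -> B) : Prop :=
  forall n b, (0 < n)%N ->
    mu (xprod b 1 n.+1) =
      \sum_(1 <= p < n.+1) \sum_(j : p.+1.-tuple 'I_n.+1 | cut_points j)
        kappa (cumulant_args mu b p (map val j)).

Definition is_cumulant_map mu rho : Prop :=
  unital_bimod_map rho /\
  exists2 kappa : seq B -> B, free_cumulants mu kappa &
    forall n b, (0 < n)%N ->
      rho (xprod b 1 n.+1) = kappa [seq b k | k <- iota 1 n].

(* rho_mu exists and is unique: see cumulant_mapP and cumulant_map_uniq below. *)
Definition cumulant_map mu : ncpoly B unit -> B :=
  xget (fun=> 0) [set rho | is_cumulant_map mu rho].

End ConditionalExpectations.

Section FreeConvolution.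
Variables (R : realType) (B : cstarAlgType R) (N : nat).

(* The isomorphism of B<X> with the subalgebra B<X_i> of B<X_1, ..., X_N>. *)
Definition ncincl (i : 'I_N) : ncpoly B unit -> ncpoly B 'I_N :=
  ncsubst (fun=> ncX B i).

Definition vars_free (Phi : ncpoly B 'I_N -> B) : Prop :=
  forall (m : nat) (eps : nat -> 'I_N) (A : nat -> ncpoly B 'I_N),
    (0 < m)%N ->
    (forall k, (k < m)%N -> range (ncincl (eps k)) (A k)) ->
    (forall k, (k.+1 < m)%N -> eps k != eps k.+1) ->
    (forall k, (k < m)%N -> Phi (A k) = 0) ->
    Phi (\prod_(0 <= k < m) A k) = 0.

Definition is_free_convolution (mus : 'I_N -> ncpoly B unit -> B)
    (nu : ncpoly B unit -> B) : Prop :=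
  exists Phi : ncpoly B 'I_N -> B,
    [/\ unital_bimod_map Phi,
        forall i f, Phi (ncincl i f) = mus i f,
        vars_free Phi
      & forall f, nu f = Phi (ncsubst (fun=> \sum_(i < N) ncX B i) f)].

End FreeConvolution.

Definition freely_infinitely_divisible (R : realType) (B : cstarAlgType R)
    (mu : ncpoly B unit -> B) : Prop :=
  forall N : nat, (0 < N)%N -> exists2 muN, Sigma muN &
    is_free_convolution (fun _ : 'I_N => muN) mu.

Section CumulantMap.
Variables (R : realType) (B : cstarAlgType R).
Implicit Types (mu rho : ncpoly B unit -> B) (b : nat -> B).
Local Notation C := (ncC unit).

Section BimodTheory.
Variables (I : Type) (phi : ncpoly B I -> B).
Hypothesis phiP : unital_bimod_map phi.

Lemma bimod1 : phi 1 = 1. Proof. by case: phiP. Qed.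
Lemma bimodD : {morph phi : f g / f + g}. Proof. by case: phiP. Qed.
Lemma bimodl (b : B) f : phi (ncC I b * f) = b * phi f.
Proof.
by case: phiP => _ _ /(_ b 1 f); rewrite rmorph1 !mulr1.
Qed.
Lemma bimodr (b : B) f : phi (f * ncC I b) = phi f * b.
Proof.
by case: phiP => _ _ /(_ 1 b f); rewrite rmorph1 !mul1r.
Qed.
Lemma bimodZ (a : R[i]) f : phi (a *: f) = a *: phi f.
Proof. by rewrite ncscaleE bimodl mulr_algl. Qed.
Lemma bimod0 : phi 0 = 0.
Proof. by apply: (addrI (phi 0)); rewrite -bimodD !addr0. Qed.
Lemma bimod_sum (T : Type) (r : seq T) (Q : pred T) F :
  phi (\sum_(k <- r | Q k) F k) = \sum_(k <- r | Q k) phi (F k).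
Proof. by rewrite (big_morph phi bimodD bimod0). Qed.

End BimodTheory.

Lemma xprod_recl b m n : (m < n)%N -> xprod b m n = ncX1 B * C (b m) * xprod b m.+1 n.
Proof. by move=> mn; rewrite /xprod big_ltn. Qed.

Lemma xprod_nil b m n : (n <= m)%N -> xprod b m n = 1.
Proof. by move=> nm; rewrite /xprod big_geq. Qed.

Lemma xprod_cat b m k n : (m <= k <= n)%N -> xprod b m n = xprod b m k * xprod b k n.
Proof. by case/andP=> mk kn; rewrite /xprod (big_cat_nat mk kn). Qed.

Lemma eq_xprod b b' m n : (forall k, m <= k < n -> b k = b' k)%N ->
  xprod b m n = xprod b' m n.
Proof. by move=> bb'; apply: eq_big_nat => k /bb' ->. Qed.

Lemma xprod_lin (a : R[i]) b x y m i n : (m <= i < n)%N ->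
  (forall k, k != i -> x k = b k)%N -> (forall k, k != i -> y k = b k)%N ->
  b i = a *: x i + y i ->
  xprod b m n = a *: xprod x m n + xprod y m n.
Proof.
case/andP=> mi lt_in xb yb bi; have le_in := ltnW lt_in.
have cat z : xprod z m n = xprod z m i * (ncX1 B * C (z i) * xprod z i.+1 n).
  by rewrite (@xprod_cat _ m i) ?mi // (@xprod_recl _ i).
have eqs z : (forall k, k != i -> z k = b k)%N ->
    xprod z m i = xprod b m i /\ xprod z i.+1 n = xprod b i.+1 n.
  by move=> zb; split; apply: eq_xprod => k /andP[mk ki]; apply: zb;
     rewrite neq_ltn ?ki ?orbT // mk orbT.
rewrite !cat; case: (eqs x xb) => -> ->; case: (eqs y yb) => -> ->.
rewrite bi rmorphD /= -mulr_algl rmorphM /= ncCA mulr_algl.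
by rewrite mulrDr mulrDl mulrDr -scalerAr -scalerAl -scalerAr.
Qed.

Lemma xprodr b x (c : B) m n : (m <= n)%N ->
  (forall k, k != n -> x k = b k)%N -> b n = x n * c ->
  xprod b m n.+1 = xprod x m n.+1 * C c.
Proof.
move=> mn xb bn; rewrite /xprod !big_nat_recr //= bn rmorphM /=.
rewrite -/(xprod b m n) -/(xprod x m n) (@eq_xprod x b) ?mulrA // => k.
by case/andP=> _ kn; apply: xb; rewrite neq_ltn kn.
Qed.

Section Cuts.
Variables (n p : nat) (j : p.+1.-tuple 'I_n.+1).
Hypothesis cj : cut_points j.
Local Notation J := (nth 0%N (map val j)).

Lemma cut0 : J 0 = 0%N.
Proof. by case/and3P: cj => _ /eqP h _; rewrite nth0. Qed.

Lemma cutp : J p = n.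
Proof.
case/and3P: cj => _ _ /eqP h; rewrite -[RHS]h.
by rewrite -nth_last size_map size_tuple.
Qed.

Lemma cut_ltn s t : (s < t <= p)%N -> (J s < J t)%N.
Proof.
case/andP=> st tp; case/and3P: cj => srt _ _.
apply: (sorted_ltn_nth ltn_trans) => //; rewrite inE size_map size_tuple ltnS //.
exact: leq_trans (ltnW st) tp.
Qed.

Lemma cut_leq s t : (s <= t <= p)%N -> (J s <= J t)%N.
Proof.
case/andP; rewrite leq_eqVlt => /orP[/eqP-> //|st] tp.
by rewrite ltnW // cut_ltn ?st.
Qed.

Lemma cut_block i : (0 < i <= n)%N ->
  exists s0, [/\ (0 < s0 <= p)%N, (J s0.-1 < i <= J s0)%N,
    forall s, (s < s0)%N -> (J s < i)%N &
    forall s, (s0 <= s <= p)%N -> (i <= J s)%N].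
Proof.
case/andP=> i0 lein.
have ex : exists s, (i <= J s)%N by exists p; rewrite cutp.
case: (ex_minnP ex) => s0 is0 min.
have s0p : (s0 <= p)%N by apply: min; rewrite cutp.
have lt s : (s < s0)%N -> (J s < i)%N.
  by move=> ss0; rewrite ltnNge; apply: contraTN ss0 => /min; rewrite -leqNgt.
have s00 : (0 < s0)%N.
  by case: (s0) is0 => // ; rewrite cut0 leqNgt i0.
exists s0; split=> //; first by rewrite s00.
  by rewrite is0 andbT lt // prednK.
by move=> s /andP[s0s sp]; rewrite (leq_trans is0) // cut_leq ?s0s.
Qed.

End Cuts.

Lemma cut_top n (j : n.+1.-tuple 'I_n.+1) : cut_points j -> map val j = iota 0 n.+1.
Proof.
move=> cj; have [srt _ _] := and3P cj.
have uj := sorted_uniq ltn_trans ltnn srt.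
apply: (irr_sorted_eq ltn_trans ltnn) => //; first exact: iota_ltn_sorted.
have sub : {subset map val j <= iota 0 n.+1}.
  by move=> _ /mapP[x _ ->]; rewrite mem_iota /= add0n ltn_ord.
have le : (size (iota 0 n.+1) <= size (map val j))%N.
  by rewrite size_iota size_map size_tuple.
by have [_ eqj] := uniq_min_size uj sub le; exact: eqj.
Qed.

Section WithMu.
Variable mu : ncpoly B unit -> B.
Hypothesis muP : unital_bimod_map mu.

Lemma eq_cumulant_args n p (j : p.+1.-tuple 'I_n.+1) b b' : cut_points j ->
  (forall k, 0 < k <= n -> b k = b' k)%N ->
  cumulant_args mu b p (map val j) = cumulant_args mu b' p (map val j).
Proof.
move=> cj bb'; apply/eq_in_map => s; rewrite mem_iota add1n ltnS => /andP[s0 sp].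
have lt : (nth 0 (map val j) s.-1 < nth 0 (map val j) s)%N.
  by apply: cut_ltn cj _ _ _; rewrite sp prednK ?leqnn.
have le : (nth 0 (map val j) s <= n)%N.
  by rewrite -[X in (_ <= X)%N](cutp cj) (cut_leq cj) // sp leqnn.
congr (_ * mu _); first by apply: bb'; rewrite /= (leq_trans lt).
apply: eq_xprod => k /andP[lek ltk]; apply: bb'.
by rewrite (leq_trans _ lek) //= (leq_trans _ le).
Qed.

Lemma cumulant_args_iota n b :
  cumulant_args mu b n (iota 0 n.+1) = [seq b k | k <- iota 1 n].
Proof.
apply/eq_in_map => s; rewrite mem_iota add1n ltnS => /andP[s0 sn].
rewrite !nth_iota ?ltnS // ?(leq_trans (leq_pred _)) // !add0n prednK //.
by rewrite xprod_nil // (bimod1 muP) mulr1.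
Qed.

Lemma cumulant_args_block n p (j : p.+1.-tuple 'I_n.+1) i :
  cut_points j -> (0 < i <= n)%N ->
  exists s0, (0 < s0 <= p)%N /\
    (nth 0 (map val j) s0.-1 < i <= nth 0 (map val j) s0)%N /\
    forall b, exists L M, (i = n -> M = [::]) /\
    forall b', (forall k, k != i -> b' k = b k)%N ->
     cumulant_args mu b' p (map val j) =
     L ++ (b' (nth 0 (map val j) s0.-1).+1 *
           mu (xprod b' (nth 0 (map val j) s0.-1).+2 (nth 0 (map val j) s0).+1))
       :: M.
Proof.
move=> cj lin; have [s0 [s0p blk lo hi]] := cut_block cj lin.
have [s00 les0p] := andP s0p.
exists s0; do 2!split=> //.
move=> b; set J := nth 0 (map val j).
pose Y c s := c (J s.-1).+1 * mu (xprod c (J s.-1).+2 (J s).+1).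
exists (map (Y b) (iota 1 s0.-1)), (map (Y b) (iota s0.+1 (p - s0))); split.
  move=> ein; suff -> : s0 = p by rewrite subnn.
  apply/eqP; rewrite eqn_leq les0p leqNgt; apply/negP => lt.
  have : (J s0 < J p)%N by apply: cut_ltn cj _ _ _; rewrite lt leqnn.
  have le : (n <= J s0)%N by rewrite -[X in (X <= _)%N]ein; case/andP: blk.
  by rewrite /J (cutp cj) ltnNge le.
move=> b' bb'; rewrite /cumulant_args.
have -> : iota 1 p = iota 1 s0.-1 ++ s0 :: iota s0.+1 (p - s0).
  rewrite -{1}(subnKC les0p) -{1}(prednK s00) addSnnS iotaD add1n prednK //.
rewrite map_cat /=; congr (_ ++ _ :: _); apply/eq_in_map => s; rewrite mem_iota.
  rewrite add1n prednK // => /andP[sp ss0]; rewrite -/(Y b' s) /Y.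
  have Js := lo _ ss0.
  have Js1 : (J s.-1 < J s)%N.
    by apply: cut_ltn cj _ _ _; rewrite prednK // leqnn (leq_trans (ltnW ss0)).
  rewrite bb' ?neq_ltn ?(leq_ltn_trans Js1) //; congr (_ * mu _).
  by apply: eq_xprod => k /andP[_ kJ]; apply: bb'; rewrite neq_ltn (leq_ltn_trans _ Js).
rewrite addSn subnKC // ltnS => /andP[ss0 sp]; rewrite -/(Y b' s) /Y.
have sgt0 : (0 < s)%N by apply: leq_ltn_trans ss0.
have Js : (i <= J s.-1)%N.
  by apply: hi; rewrite -ltnS prednK // ss0 (leq_trans (leq_pred _)).
rewrite bb' ?neq_ltn ?ltnS ?Js ?orbT //; congr (_ * mu _).
apply: eq_xprod => k /andP[kJ _]; apply: bb'.
by rewrite neq_ltn orbC (leq_ltn_trans Js) // ltnW.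
Qed.

Definition cut_sum (kappa : seq B -> B) n b p : B :=
  \sum_(j : p.+1.-tuple 'I_n.+1 | cut_points j)
    kappa (cumulant_args mu b p (map val j)).

Lemma cut_sum_top kappa n b : cut_sum kappa n b n = kappa [seq b k | k <- iota 1 n].
Proof.
have cj0 : cut_points (ord_tuple n.+1).
  have e : map val (ord_tuple n.+1) = iota 0 n.+1.
    by rewrite -val_enum_ord; congr (map _ _); apply: val_ord_tuple.
  rewrite /cut_points e iota_ltn_sorted eqxx -nth_last size_iota.
  by rewrite nth_iota /= ?eqxx.
rewrite /cut_sum (big_pred1 (ord_tuple n.+1)) => [|j].
  by rewrite (cut_top cj0) cumulant_args_iota.
rewrite /=; apply/idP/eqP => [cj|-> //].
by apply/val_inj/(inj_map val_inj); rewrite /= (cut_top cj) -(cut_top cj0).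
Qed.

Lemma free_cumulants_uniq kappa kappa' :
  free_cumulants mu kappa -> free_cumulants mu kappa' ->
  forall bs, bs != [::] -> kappa bs = kappa' bs.
Proof.
move=> kP kP' bs; have [n] := ubnP (size bs).
elim: n bs => // n IHn bs; rewrite ltnS => len bs0.
have sz : (0 < size bs)%N by rewrite lt0n size_eq0.
pose b k := nth 0 bs k.-1.
have bsE : bs = [seq b k | k <- iota 1 (size bs)].
  by rewrite -[1%N]/(1 + 0)%N iotaDl -map_comp (map_nth_iota0 0 (leqnn _)) take_size.
have := etrans (esym (kP (size bs) b sz)) (kP' (size bs) b sz).
rewrite big_nat_recr // [in RHS]big_nat_recr //= -!/(cut_sum _ _ _ _).
rewrite !cut_sum_top -bsE; under eq_big_nat => p pn.
  have pargs (j : p.+1.-tuple 'I_(size bs).+1) : cut_points j ->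
    kappa (cumulant_args mu b p (map val j)) = kappa' (cumulant_args mu b p (map val j)).
    case/andP: pn => p0 pn _; apply: IHn; rewrite -?size_eq0 size_map size_iota.
      exact: leq_trans pn len.
    by rewrite -lt0n.
  rewrite (eq_bigr _ pargs); over.
exact: addrI.
Qed.

Definition kterm (kappa : seq B -> B) n b : B :=
  mu (xprod b 1 n.+1) - \sum_(1 <= p < n) cut_sum kappa n b p.

Fixpoint kap (k : nat) (bs : seq B) : B :=
  if k is k'.+1 then kterm (kap k') (size bs) (nth 0 (0 :: bs)) else 1.

Definition kappa_of (bs : seq B) := kap (size bs) bs.

Lemma eq_kterm kappa kappa' n b b' :
  (forall bs, (size bs < n)%N -> kappa bs = kappa' bs) ->
  (forall k, 0 < k <= n -> b k = b' k)%N ->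
  kterm kappa n b = kterm kappa' n b'.
Proof.
move=> kk bb; rewrite /kterm (@eq_xprod b b') => [|k]; last first.
  by rewrite ltnS; apply: bb.
congr (_ - _); apply: eq_big_nat => p /andP[p0 pn]; apply: eq_bigr => j cj.
by rewrite (eq_cumulant_args cj bb) kk // size_map size_iota.
Qed.

Lemma kap_fuel k k' bs : (size bs <= k)%N -> (size bs <= k')%N ->
  kap k bs = kap k' bs.
Proof.
have kap0 m : kap m [::] = 1.
  by case: m => //= m; rewrite /kterm big_geq // subr0 xprod_nil // (bimod1 muP).
elim: k k' bs => [|k IHk] [|k'] bs; rewrite ?leqn0 ?size_eq0.
- by [].
- by move/eqP->; rewrite !kap0.
- by move=> _ /eqP->; rewrite !kap0.
move=> sk sk'; rewrite /=; apply: eq_kterm => // cs scs.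
by apply: IHk; rewrite -ltnS (leq_trans scs).
Qed.

Lemma kappa_ofE bs : bs != [::] ->
  kappa_of bs = kterm kappa_of (size bs) (nth 0 (0 :: bs)).
Proof.
case: bs => // c bs _; rewrite /kappa_of [size _]/= [kap _.+1 _]/=.
by apply: eq_kterm => // cs scs; apply: kap_fuel.
Qed.

Lemma kappa_ofP : free_cumulants mu kappa_of.
Proof.
move=> n b n0; rewrite big_nat_recr //= -!/(cut_sum _ _ _ _) cut_sum_top.
rewrite kappa_ofE; last by rewrite -size_eq0 size_map size_iota -lt0n.
rewrite size_map size_iota (@eq_kterm _ kappa_of n _ b) //.
  by rewrite /kterm addrC subrK.
case=> // k kn; rewrite /= (nth_map 0%N) ?size_iota //.
by rewrite nth_iota.
Qed.

Definition multilin (psi : seq B -> B) : Prop :=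
  forall l r (a : R[i]) x y,
    psi (l ++ (a *: x + y) :: r) = a *: psi (l ++ x :: r) + psi (l ++ y :: r).

Definition rmodular (psi : seq B -> B) : Prop :=
  forall l x c, psi (rcons l (x * c)) = psi (rcons l x) * c.

Lemma nth_agree (l r : seq B) x y (k : nat) : (k != size l)%N ->
  nth 0 (l ++ x :: r) k = nth 0 (l ++ y :: r) k.
Proof.
elim: l k => [|c l IHl] [|k] //= kl.
exact: IHl.
Qed.

Lemma nth_mid (l r : seq B) x : nth 0 (l ++ x :: r) (size l) = x.
Proof. by rewrite nth_cat ltnn subnn. Qed.

Lemma kap_lin k l r (a : R[i]) x y : (size l + size r < k)%N ->
  kap k (l ++ (a *: x + y) :: r) = a *: kap k (l ++ x :: r) + kap k (l ++ y :: r).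
Proof.
elim: k l r x y => // k IHk l r x y; rewrite ltnS => szk /=.
rewrite !size_cat /= !addnS; set n := (size l + size r).+1.
set b := nth 0 (0 :: l ++ (a *: x + y) :: r).
set bx := nth 0 (0 :: l ++ x :: r).
set by_ := nth 0 (0 :: l ++ y :: r).
pose i := (size l).+1.
have xb m : (m != i)%N -> bx m = b m by apply: (@nth_agree (0 :: l)).
have yb m : (m != i)%N -> by_ m = b m by apply: (@nth_agree (0 :: l)).
have bi : b i = a *: bx i + by_ i by rewrite /b /bx /by_ /= !nth_mid.
have lin : (0 < i <= n)%N by rewrite /= /i /n ltnS leq_addr.
rewrite /kterm (xprod_lin (i := i) _ xb yb bi) ?ltnS //.
rewrite (bimodD muP) (bimodZ muP) scalerBr addrACA -opprD; congr (_ - _).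
rewrite scaler_sumr -big_split /=; apply: eq_big_nat => p /andP[p0 pn].
rewrite /cut_sum scaler_sumr -big_split /=; apply: eq_bigr => j cj.
have [s0 [s0p [blk /(_ b)[L [M [_ argsE]]]]]] := cumulant_args_block cj lin.
have szLM : (size L + size M < k)%N.
  have /(congr1 size) := argsE b (fun _ _ => erefl).
  rewrite size_map size_iota size_cat /= addnS => <-.
  by rewrite -ltnS (leq_trans pn).
move: blk (argsE b (fun _ _ => erefl)) (argsE bx xb) (argsE by_ yb).
move: (nth _ _ s0.-1) (nth _ _ s0) => u v /andP[ui iv] -> -> ->.
suff -> : b u.+1 * mu (xprod b u.+2 v.+1) =
    a *: (bx u.+1 * mu (xprod bx u.+2 v.+1)) + by_ u.+1 * mu (xprod by_ u.+2 v.+1).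
  exact: IHk.
have [ue|une] := eqVneq u.+1 i.
  have eqX z : (forall m, (m != i)%N -> z m = b m) ->
      xprod z u.+2 v.+1 = xprod b u.+2 v.+1.
    by move=> zb; apply: eq_xprod => m /andP[um _]; apply: zb; rewrite neq_ltn -ue um orbT.
  by rewrite (eqX bx xb) (eqX by_ yb) ue bi mulrDl scalerAl.
rewrite !xb ?yb // (xprod_lin (i := i) _ xb yb bi) ?ltnS ?iv ?andbT.
  by rewrite (bimodD muP) (bimodZ muP) mulrDr scalerAr.
by rewrite ltn_neqAle une.
Qed.

Lemma kap_right k l x c : (size l < k)%N ->
  kap k (rcons l (x * c)) = kap k (rcons l x) * c.
Proof.
elim: k l x => // k IHk l x; rewrite ltnS => szk /=.
rewrite !size_rcons; set n := (size l).+1.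
set b := nth 0 (0 :: rcons l (x * c)).
set bx := nth 0 (0 :: rcons l x).
have xb m : (m != n)%N -> bx m = b m.
  by rewrite /b /bx -!cats1; apply: (@nth_agree (0 :: l)).
have bn : b n = bx n * c by rewrite /b /bx /= -!cats1 !nth_mid.
have lin : (0 < n <= n)%N by rewrite leqnn.
rewrite /kterm (xprodr _ xb bn) // (bimodr muP) mulrBl; congr (_ - _).
rewrite mulr_suml; apply: eq_big_nat => p /andP[p0 pn].
rewrite /cut_sum mulr_suml; apply: eq_bigr => j cj.
have [s0 [s0p [blk /(_ b)[L [M [M0 argsE]]]]]] := cumulant_args_block cj lin.
move: M0 argsE => -> // argsE.
have szL : (size L < k)%N.
  have /(congr1 size) := argsE b (fun _ _ => erefl).
  rewrite size_map size_iota size_cat /= addn1 => <-.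
  by rewrite -ltnS (leq_trans pn).
move: blk (argsE b (fun _ _ => erefl)) (argsE bx xb).
have vn : (nth 0 (map val j) s0 <= n)%N.
  by rewrite -[X in (_ <= X)%N](cutp cj) (cut_leq cj) // leqnn; case/andP: s0p => _ ->.
move: (nth _ _ s0.-1) (nth _ _ s0) vn => u v vn /andP[un nv] -> ->.
have {vn nv} -> : v = n by apply/eqP; rewrite eqn_leq vn.
suff -> : b u.+1 * mu (xprod b u.+2 n.+1) = (bx u.+1 * mu (xprod bx u.+2 n.+1)) * c.
  by rewrite !cats1; apply: IHk.
have [ue|une] := eqVneq u.+1 n.
  by rewrite ue !xprod_nil // (bimod1 muP) !mulr1.
rewrite !xb // (xprodr _ xb bn) ?(bimodr muP) ?mulrA //.
by rewrite ltn_neqAle une.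
Qed.

Lemma kappa_of_lin : multilin kappa_of.
Proof.
move=> l r a x y; rewrite /kappa_of !size_cat /= !addnS.
by apply: kap_lin.
Qed.

Lemma kappa_of_right : rmodular kappa_of.
Proof. by move=> l x c; rewrite /kappa_of !size_rcons; apply: kap_right. Qed.

End WithMu.

(* psi is read as a function of b_0 X b_1 ... X b_n, and act t psi as the
   function m |-> psi (t m). *)
Fixpoint act (t : ncterm B unit) (psi : seq B -> B) : seq B -> B :=
  match t with
  | Cst b => fun bs => if bs is c :: r then psi (b * c :: r) else 0
  | Var _ => fun bs => if bs is [::] then 0 else psi (1 :: bs)
  | Add s t => fun bs => act s psi bs + act t psi bs
  | Mul s t => act t (act s psi)
  end.

Definition multilin0 (psi : seq B -> B) : Prop := psi [::] = 0 /\ multilin psi.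

Lemma act_multilin t psi : multilin0 psi -> multilin0 (act t psi).
Proof.
elim: t psi => [b|i|s IHs t IHt|s IHs t IHt] psi psiP /=.
- case: psiP => p0 plin; split=> // -[|c l] r a x y /=.
    by rewrite mulrDr -scalerAr (plin [::]).
  exact: (plin (b * c :: l)).
- case: psiP => p0 plin; split=> // -[|c l] r a x y /=.
    exact: (plin [:: 1]).
  exact: (plin [:: 1, c & l]).
- have [s0 slin] := IHs _ psiP; have [t0 tlin] := IHt _ psiP.
  split=> [|l r a x y]; first by rewrite s0 t0 addr0.
  by rewrite slin tlin scalerDr addrACA.
- exact/IHt/IHs.
Qed.

Lemma act_add t psi psi' :
  act t (fun bs => psi bs + psi' bs) = fun bs => act t psi bs + act t psi' bs.
Proof.
elim: t psi psi' => [b|i|s IHs t IHt|s IHs t IHt] psi psi' /=.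
- by apply/funext => -[|c r] //; rewrite addr0.
- by apply/funext => -[|c r] //; rewrite addr0.
- by apply/funext => bs; rewrite IHs IHt addrACA.
- by rewrite IHs IHt.
Qed.

Lemma act_mull t (b : B) psi :
  act t (fun bs => b * psi bs) = fun bs => b * act t psi bs.
Proof.
elim: t psi => [c|i|s IHs t IHt|s IHs t IHt] psi /=.
- by apply/funext => -[|d r] //; rewrite mulr0.
- by apply/funext => -[|c r] //; rewrite mulr0.
- by apply/funext => bs; rewrite IHs IHt mulrDr.
- by rewrite IHs IHt.
Qed.

Lemma act0 t : act t (fun=> 0) = fun=> 0.
Proof.
elim: t => [c|i|s IHs t IHt|s IHs t IHt] /=.
- by apply/funext => -[|d r].
- by apply/funext => -[|c r].
- by apply/funext => bs; rewrite IHs IHt addr0.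
- by rewrite IHs IHt.
Qed.

Lemma act_cst0 psi : multilin0 psi -> act (Cst unit 0) psi = fun=> 0.
Proof.
case=> _ plin; apply/funext => -[|c r] //=; rewrite mul0r.
have := plin [::] r 0 0 0; rewrite scaler0 addr0 scale0r add0r /=.
have := plin [::] r 1 0 0; rewrite scaler0 addr0 scale1r /= => h _.
by apply: (addrI (psi (0 :: r))); rewrite addr0.
Qed.

Lemma act_eq s t : nceq s t -> forall psi, multilin0 psi -> act s psi = act t psi.
Proof.
elim=> {s t} /=.
- by [].
- by move=> s t _ IH psi psiP; rewrite IH.
- by move=> s t u _ IH _ IH' psi psiP; rewrite IH // IH'.
- by move=> s s' t t' _ IH _ IH' psi psiP; rewrite IH // IH'.
- move=> s s' t t' _ IH _ IH' psi psiP; rewrite IH // IH' //.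
  exact: act_multilin.
- by move=> s t u psi psiP; apply/funext => bs; rewrite addrA.
- by move=> s t psi psiP; apply/funext => bs; rewrite addrC.
- move=> t psi psiP; apply/funext => bs.
  by rewrite -[X in X + _]/(act (Cst unit 0) psi bs) act_cst0 // add0r.
- by [].
- move=> t psi [p0 plin]; congr act; apply/funext => -[|c r]; first by rewrite p0.
  by rewrite mul1r.
- move=> t psi psiP; apply/funext => -[|c r]; last by rewrite mul1r.
  by case: (act_multilin t psiP).
- by move=> t psi psiP; rewrite -/(act (Cst unit 0) psi) act_cst0 // act0.
- by move=> s t u psi psiP; rewrite act_add.
- by [].
- move=> b c psi [p0 plin]; apply/funext => -[|d r]; first by rewrite addr0.
  have := plin [::] r 1 (b * d) (c * d); rewrite !scale1r /= => <-.
  by rewrite mulrDl.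
- by move=> b c psi psiP; apply/funext => -[|d r] //; rewrite mulrA.
- move=> a i psi [p0 plin]; apply/funext => -[|c r] //=.
  have z l r' : psi (l ++ 0 :: r') = 0.
    have := plin l r' 1 0 0; rewrite scaler0 addr0 scale1r => h.
    by apply: (addrI (psi (l ++ 0 :: r'))); rewrite addr0.
  have := plin [::] (c :: r) a 1 0; rewrite /= (z [::]) !addr0 mulr1 => ->.
  by have := plin [:: 1] r a c 0; rewrite /= (z [:: 1]) !addr0 mulr_algl => ->.
Qed.

Definition actq (f : ncpoly B unit) := act (repr f).

Lemma actqE t psi : multilin0 psi -> actq (ncpi t) psi = act t psi.
Proof. by apply: act_eq; apply: repr_ncpi. Qed.

Lemma actqM f g psi : multilin0 psi -> actq (f * g) psi = actq g (actq f psi).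
Proof.
elim/nc_ind: f => s; elim/nc_ind: g => t psiP.
by rewrite -ncpiM !actqE //; apply: act_multilin.
Qed.

Lemma actq_multilin f psi : multilin0 psi -> multilin0 (actq f psi).
Proof. exact: act_multilin. Qed.

Lemma actq_xprod b m k psi r : multilin0 psi ->
  actq (xprod b m (m + k)) psi (1 :: r) =
    psi (1 :: [seq b i | i <- iota m k] ++ r).
Proof.
move=> psiP; elim: k r => [|k IHk] r.
  by rewrite addn0 xprod_nil // -(rmorph1 C) actqE //= mulr1.
have -> : iota m k.+1 = iota m k ++ [:: (m + k)%N] by rewrite -addn1 iotaD.
rewrite addnS /xprod big_nat_recr ?leq_addr //= -/(xprod b m (m + k)).
have aP := actq_multilin (xprod b m (m + k)) psiP.
rewrite actqM // -ncpiM actqE //= mulr1 IHk.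
by rewrite map_cat /= -catA.
Qed.

Lemma act_rmodular t psi : rmodular psi -> rmodular (act t psi).
Proof.
elim: t psi => [b|i|s IHs t IHt|s IHs t IHt] psi psiP /=.
- move=> [|d l] x c /=; first by rewrite mulrA (psiP [::]).
  exact: (psiP (b * d :: l)).
- move=> [|d l] x c /=; first exact: (psiP [:: 1]).
  exact: (psiP [:: 1, d & l]).
- by move=> l x c; rewrite IHs // IHt // mulrDl.
- exact/IHt/IHs.
Qed.

Lemma cumulant_map_exists mu : unital_bimod_map mu ->
  exists rho, is_cumulant_map mu rho.
Proof.
move=> muP; pose psi bs := if bs is c :: r then c * kappa_of mu r else 0.
have psiP : multilin0 psi.
  split=> // -[|c l] r a x y /=; first by rewrite mulrDl scalerAl.
  by rewrite (kappa_of_lin muP) mulrDr scalerAr.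
have psiR : rmodular psi.
  move=> [|d l] x c /=; last by rewrite (kappa_of_right muP) mulrA.
  by rewrite /kappa_of /= !mulr1.
exists (fun f => actq f psi [:: 1]); split; last first.
  exists (kappa_of mu); first exact: kappa_ofP.
  move=> n b n0; rewrite -[n.+1]add1n actq_xprod //= cats0 mul1r //.
split.
- by rewrite -(rmorph1 C) actqE //= /kappa_of /= !mulr1.
- by elim/nc_ind=> s; elim/nc_ind=> t; rewrite -ncpiD !actqE.
move=> b c; elim/nc_ind=> t.
have E : act (Cst unit b) psi = fun bs => b * psi bs.
  by apply/funext => -[|d r] /=; rewrite ?mulr0 ?mulrA.
rewrite -(ncpiM (Cst unit b)) -(ncpiM _ (Cst unit c)) actqE //.
rewrite -[LHS]/(act t (act (Cst unit b) psi) [:: c * 1]).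
rewrite E act_mull actqE // -mulrA mulr1; congr (_ * _).
by rewrite -[c in LHS]mul1r; apply: (act_rmodular t psiR [::]).
Qed.

Lemma ncspan (f : ncpoly B unit) : exists ms : seq (B * seq B),
  f = \sum_(m <- ms) C m.1 * \prod_(c <- m.2) (ncX1 B * C c).
Proof.
pose S (g : ncpoly B unit) := exists ms : seq (B * seq B),
  g = \sum_(m <- ms) C m.1 * \prod_(c <- m.2) (ncX1 B * C c).
have SD g h : S g -> S h -> S (g + h).
  by move=> [ms ->] [ns ->]; exists (ms ++ ns); rewrite big_cat.
have S0 : S 0 by exists [::]; rewrite big_nil.
have Smon (b : B) bs : S (C b * \prod_(c <- bs) (ncX1 B * C c)).
  by exists [:: (b, bs)]; rewrite big_seq1.
have SM t g : S g -> S (g * ncpi t).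
  elim: t g => [b|[]|s IHs t IHt|s IHs t IHt] g Sg.
  - have [ms ->] := Sg; rewrite mulr_suml; elim/big_ind: _ => // -[c bs] _ /=.
    case/lastP: bs => [|bs d].
      by rewrite big_nil mulr1 -/(C b) -rmorphM; have := Smon (c * b) [::];
         rewrite big_nil mulr1.
    have := Smon c (rcons bs (d * b)).
    by rewrite -!cats1 !big_cat !big_seq1 /= rmorphM !mulrA.
  - have [ms ->] := Sg; rewrite mulr_suml; elim/big_ind: _ => // -[c bs] _ /=.
    have := Smon c (rcons bs 1).
    by rewrite -!cats1 !big_cat !big_seq1 /= rmorph1 mulr1 !mulrA.
  - by rewrite ncpiD mulrDr; apply: SD; [apply: IHs|apply: IHt].
  - by rewrite ncpiM mulrA; apply/IHt/IHs.
elim/nc_ind: f => t; rewrite -[ncpi t]mul1r; apply: SM.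
by have := Smon 1 [::]; rewrite big_nil mulr1 rmorph1.
Qed.

Lemma cumulant_map_uniq mu rho rho' : unital_bimod_map mu ->
  is_cumulant_map mu rho -> is_cumulant_map mu rho' -> rho = rho'.
Proof.
move=> muP [rhoP [ka kaP rE]] [rhoP' [ka' kaP' rE']].
apply/funext => f; have [ms ->] := ncspan f.
rewrite (bimod_sum rhoP) (bimod_sum rhoP'); apply: eq_bigr => -[b bs] _ /=.
rewrite (bimodl rhoP) (bimodl rhoP'); congr (_ * _).
have [->|bs0] := eqVneq bs [::].
  by rewrite big_nil (bimod1 rhoP) (bimod1 rhoP').
have sz : (0 < size bs)%N by rewrite lt0n size_eq0.
have -> : \prod_(c <- bs) (ncX1 B * C c) = xprod (nth 0 (0 :: bs)) 1 (size bs).+1.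
  by rewrite (big_nth 0) /xprod big_add1.
rewrite rE // rE' //; apply: (free_cumulants_uniq muP kaP kaP').
by rewrite -size_eq0 size_map size_iota -lt0n.
Qed.

Lemma cumulant_mapP mu : unital_bimod_map mu ->
  is_cumulant_map mu (cumulant_map mu).
Proof.
by move=> muP; have [rho rhoP] := cumulant_map_exists muP; apply: xgetPex; exists rho.
Qed.

End CumulantMap.

(* Main.v *)
Require Import Defs.
From mathcomp Require Import all_boot all_order all_algebra.
From mathcomp Require Import complex.
From mathcomp Require Import boolp classical_sets reals.
From mathcomp Require Import lra ring zify.

(* Write rho for the functional rho_mu.  Moments are vacuum expectations on the
   full Fock space over rho: the operator X is the sum of a creation operator
   (a block opens), an annihilation operator (it closes), a gauge operator (a
   letter joins the top block) and the scalar rho(X).  With one such space whose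
   tensor factors are coloured by the indices i = 1..N, all colours using rho / N,
   the variables X_i are free by inspection, and X_1 + ... + X_N has cumulant
   functional rho.  If rho is positive on polynomials without constant term, the
   Fock space pairing is positive: a Schur complement argument turns positivity
   of rho into complete positivity.  So the X_i have a positive distribution,
   whose N-fold convolution is mu.

   Conversely freeness determines Phi from its restrictions, so the cumulants of
   mu_N are those of mu divided by N; the moments of mu_N are then polynomial in
   1/N and N mu_N(f) tends to rho(f) for f without constant term.  A limit of
   positive elements is positive. *)

Set Implicit Arguments.
Unset Strict Implicit.
Unset Printing Implicit Defensive.

Import Order.TTheory GRing.Theory Num.Theory.
Local Open Scope ring_scope.

(** * Equalities in abelian groups *)

(** The Fock space is never completed, nor divided by its null vectors. States are formal lists and
    only pairings of lists matter: the relations of the free algebra fail on lists but hold after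
    pairing, because left and right actions are adjoint. This layer is purely algebraic and asks
    only for a unital bimodule map. Hence it also serves the converse: the model over the cumulants
    of mu_N, about whose positivity nothing is known, is identified with the given free product, and
    the cumulants are read off from it.

    Positivity requires an order on B, which is extracted from the norm axioms alone. Its hard
    point, that every [star y * y] is positive, is proved without spectra; commutants replace
    functional calculus. Complete positivity is obtained by elimination rather than from a square
    root of a matrix over B, so that only roots and inverses in B itself occur and no norm on
    matrices is needed.

    Two gaps remain to be bridged: rho / N is not unital, so only its part without constant term is
    scaled; and positivity of rho does not reach rho(X), whose self-adjointness has to come from
    mu. *)

Inductive zexp := ZVar of nat | Z0 | ZAdd of zexp & zexp | ZOpp of zexp.

Fixpoint zcoef (e : zexp) (i : nat) : int :=
  match e with
  | ZVar j => (i == j)%:Z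
  | Z0 => 0
  | ZAdd e f => zcoef e i + zcoef f i
  | ZOpp e => - zcoef e i
  end.

Fixpoint zeval (V : zmodType) (env : seq V) (e : zexp) : V :=
  match e with
  | ZVar j => env`_j
  | Z0 => 0
  | ZAdd e f => zeval env e + zeval env f
  | ZOpp e => - zeval env e
  end.

Lemma zevalE (V : zmodType) (env : seq V) e :
  zeval env e = \sum_(i < size env) env`_i *~ zcoef e i.
Proof.
elim: e => [j||e IHe f IHf|e IHe] /=.
- have [js|sj] := ltnP j (size env); last first.
    rewrite nth_default // big1 // => i _; rewrite ltn_eqF //.
    exact: leq_trans (ltn_ord i) sj.
  rewrite (bigD1 (Ordinal js)) //= eqxx big1 ?addr0 // => i.
  by rewrite -val_eqE /= => /negPf->.
- by rewrite big1.
- by rewrite IHe IHf -big_split; apply: eq_bigr => i _; rewrite mulrzDr.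
- by rewrite IHe -sumrN; apply: eq_bigr => i _; rewrite mulrNz.
Qed.

(** An expression in an abelian group is determined by its integer coefficients. On a concrete list
    of atoms these are compared by computation, which is how [zmod] closes a goal. *)
Lemma zevalP (V : zmodType) (env : seq V) e f :
  all (fun i => zcoef e i == zcoef f i) (iota 0 (size env)) ->
  zeval env e = zeval env f.
Proof.
move/allP=> ef; rewrite !zevalE; apply: eq_bigr => i _.
by rewrite (eqP (ef i _)) // mem_iota ltn_ord.
Qed.

Ltac zmem x l :=
  match l with
  | ?y :: ?l' => let _ := match goal with _ => unify x y end in constr:(true)
  | _ :: ?l' => zmem x l'
  | _ => constr:(false)
  end.
Ltac zatoms t l :=
  match t with
  | (?a + ?b)%R => let l' := zatoms a l in zatoms b l'
  | (- ?a)%R => zatoms a l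
  | (0)%R => constr:(l)
  | _ => match zmem t l with true => constr:(l) | false => constr:(t :: l) end
  end.
Ltac zindex x l :=
  match l with
  | ?y :: ?l' => let _ := match goal with _ => unify x y end in constr:(0%N)
  | _ :: ?l' => let n := zindex x l' in constr:(n.+1)
  end.
Ltac zquote t l :=
  match t with
  | (?a + ?b)%R => let a' := zquote a l in let b' := zquote b l in constr:(ZAdd a' b')
  | (- ?a)%R => let a' := zquote a l in constr:(ZOpp a')
  | (0)%R => constr:(Z0)
  | _ => let n := zindex t l in constr:(ZVar n)
  end.
Ltac zmod :=
  match goal with
  | |- @eq ?T ?a ?b =>
    let l0 := constr:(@nil T) in
    let l1 := zatoms a l0 in let l := zatoms b l1 in
    let ea := zquote a l in let eb := zquote b l in
    exact: (@zevalP _ l ea eb erefl)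
  end.

Ltac ncring := rewrite ?(mulrDl, mulrDr, mulNr, mulrN, mul1r, mulr1, mulrA); zmod.

(** * Norm and limits in a C*-algebra *)

Section CStarPositivity.
Variables (R : realType) (B : cstarAlgType R).
Implicit Types (x y z a h : B) (t e : R).
Local Notation "t %:S" := (t%:C%C : R[i]) (at level 2, format "t %:S").

Lemma cnorm0 : cnorm (0 : B) = 0.
Proof. by rewrite -(scale0r (0 : B)) cnormZ Normc.normc0 mul0r. Qed.

Lemma cnormN x : cnorm (- x) = cnorm x.
Proof. by rewrite -scaleN1r cnormZ normcN Normc.normc1 mul1r. Qed.

Lemma cnorm_ge0 x : 0 <= cnorm x.
Proof.
have := cnormD x (- x); rewrite subrr cnorm0 cnormN; lra.
Qed.

Lemma cnormB x y : cnorm (x - y) <= cnorm x + cnorm y.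
Proof. by rewrite (le_trans (cnormD _ _)) // cnormN. Qed.

Lemma cnormBC x y : cnorm (x - y) = cnorm (y - x).
Proof. by rewrite -cnormN opprB. Qed.

Lemma normc_real t : Normc.normc t%:S = `|t|.
Proof. by rewrite /Normc.normc /= expr0n addr0 sqrtr_sqr. Qed.

Lemma cnormZr t x : 0 <= t -> cnorm (t%:S *: x) = t * cnorm x.
Proof. by move=> t0; rewrite cnormZ normc_real ger0_norm. Qed.

Lemma starN x : star (- x) = - star x.
Proof. by apply: (addrI (star x)); rewrite -starD !subrr star0. Qed.

Lemma starB x y : star (x - y) = star x - star y.
Proof. by rewrite starD starN. Qed.

Lemma starZr t x : star (t%:S *: x) = t%:S *: star x.
Proof. by rewrite starZ conj_Creal //; apply/complex_realP; exists t. Qed.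

Lemma starAr t : star (t%:S%:A : B) = t%:S%:A.
Proof. by rewrite starZr star1. Qed.

Lemma cnorm_star x : cnorm (star x) = cnorm x.
Proof.
suff le y : cnorm y <= cnorm (star y).
  by apply/eqP; rewrite eq_le le andbT -{2}[x]starK le.
have [->|/eqP y0] := eqVneq (cnorm y) 0; first exact: cnorm_ge0.
have y1 : 0 < cnorm y by rewrite lt_def cnorm_ge0 andbT; apply/eqP.
by rewrite -(ler_pM2r y1) -expr2 -cnorm_starM cnormM.
Qed.

Lemma cnorm1 : cnorm (1 : B) = 1.
Proof.
have := cnorm_starM (1 : B); rewrite star1 mulr1 expr2.
have n1 : cnorm (1 : B) != 0.
  by apply/eqP => /(@cnorm_eq0 R B)/eqP; rewrite oner_eq0.
by rewrite -{1}[cnorm 1]mulr1 => /(mulfI n1).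
Qed.

Lemma cnorm_scal t : 0 <= t -> cnorm (t%:S%:A : B) = t.
Proof. by move=> t0; rewrite cnormZr // cnorm1 mulr1. Qed.

Lemma cnorm_sa h : star h = h -> cnorm (h * h) = cnorm h ^+ 2.
Proof. by move=> hs; rewrite -cnorm_starM hs. Qed.

Definition clim (u : nat -> B) (l : B) : Prop :=
  forall e, 0 < e -> exists N, forall n, (N <= n)%N -> cnorm (u n - l) < e.

Lemma clim_cst x : clim (fun=> x) x.
Proof. by move=> e e0; exists 0%N => n _; rewrite subrr cnorm0. Qed.

Lemma clim_bound u l (v : nat -> B) m (c : R) : clim u l -> 0 <= c ->
  (exists N, forall n, (N <= n)%N -> cnorm (v n - m) <= c * cnorm (u n - l)) ->
  clim v m.
Proof.
move=> ul c0 [N vu] e e0.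
have c1 : 0 < c + 1 by lra.
have [M uM] := ul (e / (c + 1)) (divr_gt0 e0 c1).
exists (maxn N M) => n; rewrite geq_max => /andP[Nn Mn].
have := vu n Nn; have := uM n Mn; have := cnorm_ge0 (u n - l).
rewrite ltr_pdivlMr //; nra.
Qed.

Lemma climD u l v m : clim u l -> clim v m -> clim (fun n => u n + v n) (l + m).
Proof.
move=> ul vm e e0; have e2 : 0 < e / 2 by lra.
have [N uN] := ul _ e2; have [M vM] := vm _ e2.
exists (maxn N M) => n; rewrite geq_max => /andP[Nn Mn].
have := uN n Nn; have := vM n Mn; have := cnormD (u n - l) (v n - m).
by rewrite addrACA -opprD; lra.
Qed.

Lemma clim_mull u l x : clim u l -> clim (fun n => x * u n) (x * l).
Proof.
move=> ul; apply: (clim_bound ul (cnorm_ge0 x)); exists 0%N => n _.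
by rewrite -mulrBr cnormM.
Qed.

Lemma clim_mulr u l x : clim u l -> clim (fun n => u n * x) (l * x).
Proof.
move=> ul; apply: (clim_bound ul (cnorm_ge0 x)); exists 0%N => n _.
by rewrite -mulrBl mulrC cnormM.
Qed.

Lemma climN u l : clim u l -> clim (fun n => - u n) (- l).
Proof.
by move=> /(clim_mull (-1)) h e /h [N hN]; exists N => n /hN; rewrite !mulN1r.
Qed.

Lemma clim_star u l : clim u l -> clim (fun n => star (u n)) (star l).
Proof.
move=> ul; apply: (clim_bound ul ler01); exists 0%N => n _.
by rewrite -starB cnorm_star mul1r.
Qed.

Lemma climS u l : clim u l -> clim (fun n => u n.+1) l.
Proof. by move=> ul e /ul [N uN]; exists N => n Nn; apply/uN/ltnW. Qed.

Lemma clim_norm u l t : clim u l ->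
  (exists N, forall n, (N <= n)%N -> cnorm (u n) <= t) -> cnorm l <= t.
Proof.
move=> ul [M ut]; apply/ler_addgt0Pr => e e0; have [N uN] := ul e e0.
have := cnormB (u (maxn N M)) (u (maxn N M) - l); rewrite subKr.
have := uN (maxn N M) (leq_maxl _ _); have := ut (maxn N M) (leq_maxr _ _); lra.
Qed.

Lemma clim_uniq u l m : clim u l -> clim u m -> l = m.
Proof.
move=> ul um; apply/eqP; rewrite -subr_eq0; apply/eqP/cnorm_eq0.
apply/eqP; rewrite eq_le cnorm_ge0 andbT.
apply: (clim_norm (climD ul (climN um))); exists 0%N => n _.
by rewrite subrr cnorm0.
Qed.

Lemma clim_mul u l : clim u l -> (forall n, cnorm (u n) <= 1) ->
  clim (fun n => u n * u n) (l * l).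
Proof.
move=> ul u1; have l1 : cnorm l <= 1 by apply: (clim_norm ul); exists 0%N.
apply: (clim_bound ul (ler0n R 2)); exists 0%N => n _.
have -> : u n * u n - l * l = (u n - l) * u n + l * (u n - l).
  by rewrite mulrBl mulrBr addrA subrK.
have := cnormD ((u n - l) * u n) (l * (u n - l)).
have := cnormM (u n - l) (u n); have := cnormM l (u n - l).
have := u1 n; have := cnorm_ge0 (u n - l); nra.
Qed.

(** The hypothesis forces [s] to be nondecreasing, so boundedness alone makes it Cauchy. No rate is
    asked for: the square root iteration at norm 1 has no geometric one. *)
Lemma clim_majorised (u : nat -> B) (s : nat -> R) (M : R) :
  (forall n, cnorm (u n.+1 - u n) <= s n.+1 - s n) ->
  (forall n, s n <= M) -> exists l, clim u l.
Proof.
move=> us sM.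
have le m k : cnorm (u (m + k)%N - u m) <= s (m + k)%N - s m.
  elim: k => [|k IHk]; first by rewrite addn0 !subrr cnorm0.
  have := cnormD (u (m + k).+1 - u (m + k)%N) (u (m + k)%N - u m).
  rewrite addnS addrA subrK; have := us (m + k)%N; lra.
have mono m n : (m <= n)%N -> cnorm (u n - u m) <= s n - s m.
  by move=> mn; have := le m (n - m)%N; rewrite subnKC.
apply: cnorm_complete => e e0.
have sup_s : has_sup (range s) by split; [exists (s 0%N), 0%N | exists M => _ [n _ <-]].
have [_ [N _ <-] sN] := sup_adherent e0 sup_s.
have sS n : s n <= sup (range s) by apply: sup_upper_bound => //; exists n.
exists N; have wl m n : (m <= n)%N -> (N <= m)%N -> (N <= n)%N -> cnorm (u n - u m) < e.
  move=> mn Nm Nn; have := mono m n mn; have := mono N m Nm; have := mono N n Nn.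
  have := sS n; have := cnorm_ge0 (u m - u N); lra.
move=> m n Nm Nn; case/orP: (leq_total m n) => mn; last exact: wl.
by rewrite cnormBC; apply: wl.
Qed.

(** A fixed point [y = (h + y * y) / 2] satisfies [(1 - y) * (1 - y) = 1 - h]: the limit is one
    minus a square root of [1 - h]. *)
Fixpoint sqrt_iter h n : B :=
  if n is n'.+1 then (2^-1)%:S *: (h + sqrt_iter h n' * sqrt_iter h n') else 0.

Fixpoint sqrt_major n : R :=
  if n is n'.+1 then 2^-1 * (1 + sqrt_major n' ^+ 2) else 0.

Lemma sqrt_major_bound n : 0 <= sqrt_major n <= 1.
Proof. by elim: n => /= [|n]; [rewrite lexx ler01 | nra]. Qed.

(** Membership of [x] in the bicommutant of [a]. It makes successive roots commute with each other,
    as functional calculus would. *)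
Definition comm_with a x := forall z, z * a = a * z -> z * x = x * z.

(* The iterates y of [y <- (h + y^2) / 2] and their increments are polynomials
   in [h] with nonnegative coefficients, hence dominated by their values at 1. *)
Lemma sqrt_one_sub h : star h = h -> cnorm h <= 1 ->
  exists y, [/\ star y = y, cnorm y <= 1, (1 - y) * (1 - y) = 1 - h &
    comm_with h y].
Proof.
move=> hs h1; pose u := sqrt_iter h; pose s := sqrt_major.
have half0 : 0 <= 2^-1 :> R by rewrite invr_ge0 ler0n.
have uS n : u n.+1 = (2^-1)%:S *: (h + u n * u n) by [].
have sS n : s n.+1 = 2^-1 * (1 + s n ^+ 2) by [].
have s01 := sqrt_major_bound; rewrite -/s in s01.
have un n : cnorm (u n) <= s n.
  elim: n => [|n IHn]; first by rewrite cnorm0.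
  rewrite uS sS cnormZr //; have := cnormD h (u n * u n).
  have := cnormM (u n) (u n); have := s01 n; have := cnorm_ge0 (u n); nra.
have du n : cnorm (u n.+1 - u n) <= s n.+1 - s n.
  elim: n => [|n IHn]; first by rewrite subr0 [s 0]/= subr0; exact: un.
  have -> : s n.+2 - s n.+1 = 2^-1 * (s n.+1 ^+ 2 - s n ^+ 2).
    by rewrite [s n.+2]sS {2}[s n.+1]sS; ring.
  have -> : u n.+2 - u n.+1 = (2^-1)%:S *: (h + u n.+1 * u n.+1 - (h + u n * u n)).
    by rewrite scalerBr -!uS.
  rewrite cnormZr //.
  have -> : h + u n.+1 * u n.+1 - (h + u n * u n) =
     (u n.+1 - u n) * u n.+1 + u n * (u n.+1 - u n).
    by rewrite opprD addrACA subrr add0r mulrBl mulrBr addrA subrK.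
  have := cnormD ((u n.+1 - u n) * u n.+1) (u n * (u n.+1 - u n)).
  have := cnormM (u n.+1 - u n) (u n.+1); have := cnormM (u n) (u n.+1 - u n).
  have := un n; have := un n.+1; have := cnorm_ge0 (u n); have := cnorm_ge0 (u n.+1).
  have := cnorm_ge0 (u n.+1 - u n); have := s01 n; have := s01 n.+1.
  set d := u n.+1 - u n in IHn *.
  move: (s n.+1) (s n) IHn (cnorm (d * u n.+1 + u n * d)) (cnorm (d * u n.+1)) (cnorm (u n * d)) => s' s0 IHn A C D.
  move: (cnorm (u n.+1)) (cnorm (u n)) (cnorm d) IHn => p q r rs.
  move=> /andP[s'0 _] /andP[s00 _] r0 p0 q0 ps qs DC CD AC.
  have k1 : r * p <= r * s' by exact: ler_wpM2l.
  have k2 : q * r <= s0 * r by exact: ler_wpM2r.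
  have k3 : r * (s' + s0) <= (s' - s0) * (s' + s0) by apply: ler_wpM2r => //; lra.
  lra.
have [l ul] : exists l, clim u l.
  by apply: (clim_majorised (s := s) du (M := 1)) => n; case/andP: (s01 n).
have u1 n : cnorm (u n) <= 1 by have := un n; have := s01 n; lra.
have lE : l = (2^-1)%:S *: (h + l * l).
  apply: (clim_uniq (climS ul)); rewrite -mulr_algl.
  under [X in clim X _]eq_fun do rewrite uS -mulr_algl.
  by apply/clim_mull/(climD (clim_cst h))/clim_mul.
exists l; split.
- apply: (clim_uniq (clim_star ul)).
  have us n : star (u n) = u n.
    by elim: n => [|n IHn]; rewrite ?star0 // uS starZr starD starM hs IHn.
  by under [X in clim X _]eq_fun do rewrite us.
- by apply: (clim_norm ul); exists 0%N.
- have {}lE : l + l = h + l * l.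
    rewrite {1 2}lE -scalerDl -rmorphD /= -{1 2}[2^-1]mul1r -splitr.
    by rewrite rmorph1 scale1r.
  rewrite mulrBl mul1r mulrBr mulr1 opprB addrCA -addrA -opprD lE opprD.
  by rewrite addrCA [l * l + _]addrCA subrr addr0.
- move=> z zh; apply: (clim_uniq (clim_mull z ul)).
  have zu n : z * u n = u n * z.
    elim: n => [|n IHn]; first by rewrite mulr0 mul0r.
    by rewrite uS -scalerAr -scalerAl mulrDr mulrDl zh mulrA IHn -!mulrA IHn.
  by under [X in clim X _]eq_fun do rewrite zu; apply: clim_mulr.
Qed.

(** Neumann series: its partial sums follow [u <- 1 + h * u] and are dominated by the geometric
    series of [cnorm h]. Their limit commutes with [h], so it inverts on both sides. *)
Lemma one_sub_inv h : cnorm h < 1 -> exists l, l * (1 - h) = 1 /\ (1 - h) * l = 1.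
Proof.
move=> h1; have h0 := cnorm_ge0 h.
pose u := fix u n := if n is n'.+1 then 1 + h * u n' else 0 : B.
pose s := fix s n := if n is n'.+1 then 1 + cnorm h * s n' else 0 : R.
have sM n : 0 <= s n <= (1 - cnorm h)^-1.
  have i0 : 0 < (1 - cnorm h)^-1 by rewrite invr_gt0 subr_gt0.
  have iE : (1 - cnorm h)^-1 = 1 + cnorm h * (1 - cnorm h)^-1.
    apply/eqP; rewrite -subr_eq; apply/eqP; field; apply/eqP; lra.
  elim: n => [|n IHn]; first by rewrite lexx ltW.
  by rewrite [s _]/= iE; move: ((1 - _)^-1) iE i0 IHn; move=> i iE i0 /andP[s0 si]; nra.
have du n : cnorm (u n.+1 - u n) <= s n.+1 - s n.
  elim: n => [|n IHn]; first by rewrite /= !mulr0 !subr0 !addr0 cnorm1.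
  rewrite [u n.+2]/= {2}/u [s n.+2]/= {2}/s -/u -/s.
  rewrite opprD addrACA subrr add0r -mulrBr (le_trans (cnormM _ _)) //.
  rewrite [in leRHS]opprD addrACA subrr add0r -mulrBr; exact: ler_wpM2l.
have [l ul] : exists l, clim u l.
  by apply: (clim_majorised du) => n; case/andP: (sM n) => _; apply.
have lE : l = 1 + h * l.
  apply: (clim_uniq (climS ul)).
  exact/(climD (clim_cst 1))/clim_mull.
have lh : h * l = l * h.
  apply: (clim_uniq (clim_mull h ul)).
  have hu n : h * u n = u n * h.
    by elim: n => [|n IHn] /=; rewrite ?mulr0 ?mul0r // mulrDr mulrDl mulr1 mul1r {1}IHn mulrA.
  by under [X in clim X _]eq_fun do rewrite hu; apply: clim_mulr.
exists l; split; first by rewrite mulrBr mulr1 -lh {1}lE addrK.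
by rewrite mulrBl mul1r {1}lE addrK.
Qed.

End CStarPositivity.

(** * The positive cone *)

Section PositiveCone.
Variables (R : realType) (B : cstarAlgType R).
Implicit Types (x y z a h : B) (t e : R).
Local Notation "t %:S" := (t%:C%C : R[i]) (at level 2, format "t %:S").

(* Norm description of the positive cone: it makes sums and limits immediate;
   [cposP] identifies it with [cstar_pos]. *)
Definition cpos a := star a = a /\ exists2 t, 0 <= t & cnorm (t%:S%:A - a) <= t.

Lemma cpos_sa a : cpos a -> star a = a. Proof. by case. Qed.

Lemma cpos0 : cpos 0.
Proof. by split; [rewrite star0 | exists 0; rewrite // scale0r subr0 cnorm0]. Qed.

Lemma cposD a b : cpos a -> cpos b -> cpos (a + b).
Proof.
move=> [sa [t t0 ta]] [sb [u u0 ub]]; split; first by rewrite starD sa sb.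
exists (t + u); first exact: addr_ge0.
rewrite rmorphD scalerDl opprD addrACA.
by rewrite (le_trans (cnormD _ _)) // lerD.
Qed.

Lemma cposZ t a : 0 <= t -> cpos a -> cpos (t%:S *: a).
Proof.
move=> t0 [sa [u u0 ua]]; split; first by rewrite starZr sa.
exists (t * u); first exact: mulr_ge0.
by rewrite rmorphM -scalerA -scalerBr cnormZr // ler_wpM2l.
Qed.

Lemma cpos_scal t : 0 <= t -> cpos t%:S%:A.
Proof. by move=> t0; split; [rewrite starAr | exists t; rewrite // subrr cnorm0]. Qed.

(* [u = h + ik] satisfies [u^* u = c], which bounds [h = (u + u^* ) / 2]. *)
Lemma cnorm_sum_sq h k t : star h = h -> star k = k -> h * k = k * h -> 0 <= t ->
  h * h + k * k = t%:S%:A -> cnorm h ^+ 2 <= t.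
Proof.
move=> hs ks hk t0 hkt; pose u := h + 'i *: k; pose v := h - 'i *: k.
have us : star u = v by rewrite starD starZ hs ks conjCi scaleNr.
have vu : v * u = t%:S%:A.
  rewrite mulrBl !mulrDr -!scalerAr -!scalerAl scalerA hk -(expr2 'i) sqrCi scaleN1r -hkt.
  zmod.
have nu : cnorm u ^+ 2 = t by rewrite -cnorm_starM us vu cnorm_scal.
have nv : cnorm v = cnorm u by rewrite -us cnorm_star.
have huv : h = (2^-1)%:S *: (u + v).
  rewrite addrACA subrr addr0 scalerDr -scalerDl -rmorphD /=.
  by rewrite -[2^-1]mul1r -splitr rmorph1 scale1r.
have := cnormD u v; rewrite {1}huv cnormZr ?invr_ge0 // nv.
have := cnorm_ge0 (u + v); rewrite -nu; nra.
Qed.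

(** Rescaling by [t] reduces to the root of [1 - h / t]. The last clause is the witness [Num.sqrt t]
    for the positivity of [k]. *)
Lemma sqrt_scal_sub h t : star h = h -> 0 <= t -> cnorm h <= t ->
  exists k, [/\ star k = k, k * k = t%:S%:A - h, comm_with h k &
    cnorm ((Num.sqrt t)%:S%:A - k) <= Num.sqrt t].
Proof.
move=> hs; rewrite le_eqVlt => /predU1P[<-|t0] ht.
  have -> : h = 0 by apply/cnorm_eq0/eqP; rewrite eq_le ht cnorm_ge0.
  exists 0; rewrite star0 mulr0 scale0r subrr; split=> //; last by rewrite subr0 sqrtr0 cnorm_scal.
have ti0 : 0 <= t^-1 by rewrite invr_ge0 ltW.
have t10 : t != 0 by rewrite gt_eqF.
have [||y [ys y1 yy yc]] := @sqrt_one_sub _ _ (t^-1%:S *: h).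
- by rewrite starZr hs.
- by rewrite cnormZr // mulrC ler_pdivrMr // mul1r.
exists ((Num.sqrt t)%:S *: (1 - y)); split.
- by rewrite starZr starB star1 ys.
- rewrite -scalerAl -scalerAr scalerA yy -rmorphM -expr2 sqr_sqrtr ?ltW //.
  by rewrite scalerBr scalerA -rmorphM divff // rmorph1 scale1r.
- move=> z zh; rewrite -scalerAr -scalerAl mulrBr mulrBl mulr1 mul1r yc //.
  by rewrite -scalerAr -scalerAl zh.
- rewrite -scalerBr subKr cnormZr ?sqrtr_ge0 // -[leRHS]mulr1.
  by rewrite ler_wpM2l // sqrtr_ge0.
Qed.

Lemma cpos_sqrt a : cpos a ->
  exists s, [/\ cpos s, s * s = a & comm_with a s].
Proof.
move=> [sa [t t0 ta]].
have [|s [ss s2 sc sn]] := @sqrt_scal_sub (t%:S%:A - a) t _ t0 ta.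
  by rewrite starB starAr sa.
exists s; split; last by move=> z za; apply: sc; rewrite mulrBr mulrBl za mulr_algr mulr_algl.
- by split=> //; exists (Num.sqrt t); rewrite ?sqrtr_ge0.
- by rewrite s2 subKr.
Qed.

(** The cosine-sine pair: [h] is completed by a commuting self-adjoint [k] to [h^2 + k^2 = t], and
    [cnorm_sum_sq] then bounds [k] as well. *)
Lemma cnorm_sq_le h t : star h = h -> cnorm h ^+ 2 <= t ->
  exists k, [/\ star k = k, h * h + k * k = t%:S%:A, comm_with h k & cnorm k ^+ 2 <= t].
Proof.
move=> hs ht; have t0 : 0 <= t by rewrite (le_trans _ ht) // sqr_ge0.
have [||k [ks kk kc _]] := @sqrt_scal_sub (h * h) t _ t0.
- by rewrite starM hs.
- by rewrite cnorm_sa.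
have kc' : comm_with h k by move=> z zh; apply: kc; rewrite mulrA zh -mulrA zh mulrA.
have hk : h * k = k * h by apply: kc'.
exists k; split=> //; first by rewrite kk addrC subrK.
by apply: (@cnorm_sum_sq k h) => //; rewrite kk subrK.
Qed.

Lemma cnorm_scal_sub_sq h t : star h = h -> cnorm h ^+ 2 <= t ->
  cnorm (t%:S%:A - h * h) <= t.
Proof.
move=> hs ht; have [k [ks hk _ kt]] := cnorm_sq_le hs ht.
by rewrite -hk addrC addKr cnorm_sa.
Qed.

Lemma cpos_sq h : star h = h -> cpos (h * h).
Proof.
move=> hs; split; first by rewrite starM hs.
by exists (cnorm h ^+ 2); [exact: sqr_ge0 | exact: cnorm_scal_sub_sq].
Qed.

(** Any bound on the norm is a valid witness of positivity, not only the one stored in [cpos]. A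
    single witness thus serves a whole convergent sequence, which makes the cone closed. *)
Lemma cpos_norm a t : cpos a -> cnorm a <= t -> cnorm (t%:S%:A - a) <= t.
Proof.
move=> /cpos_sqrt[s [sp <- _]] st; apply: cnorm_scal_sub_sq; first exact: cpos_sa.
by rewrite -cnorm_sa // cpos_sa.
Qed.

(** If [u] witnesses positivity of [a], then [1 - (a + t) / (u + t) = (u - a) / (u + t)] has norm at
    most [u / (u + t) < 1], and the Neumann series applies. *)
Lemma cpos_addr_inv a t : cpos a -> 0 < t ->
  exists q, [/\ star q = q, q * (a + t%:S%:A) = 1 & (a + t%:S%:A) * q = 1].
Proof.
move=> [sa [u u0 ua]] t0; have ut : 0 < u + t by lra.
have ut0 : u + t != 0 by rewrite gt_eqF.
pose h := 1 - (u + t)^-1%:S *: (a + t%:S%:A).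
have hE : h = (u + t)^-1%:S *: (u%:S%:A - a).
  have e1 : 1 = (u + t)^-1%:S *: ((u + t)%:S%:A : B).
    by rewrite scalerA -rmorphM mulVf // rmorph1 scale1r.
  by rewrite /h {1}e1 -scalerBr rmorphD scalerDl; congr (_ *: _); zmod.
have [l [l1 l2]] : exists l, l * (1 - h) = 1 /\ (1 - h) * l = 1.
  apply: one_sub_inv; rewrite hE cnormZr ?invr_ge0 1?ltW //.
  by rewrite mulrC ltr_pdivrMr // mul1r; lra.
rewrite /h subKr in l1 l2; pose q := (u + t)^-1%:S *: l.
have q1 : q * (a + t%:S%:A) = 1 by rewrite -scalerAl scalerAr.
have q2 : (a + t%:S%:A) * q = 1 by rewrite -scalerAr scalerAl.
exists q; split=> //; rewrite -[LHS]mul1r -q1 -mulrA.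
have as_ : star (a + t%:S%:A) = a + t%:S%:A by rewrite starD starAr sa.
by rewrite -{1}as_ -starM q1 star1 mulr1.
Qed.

(** Write [z = p + i q] with self-adjoint parts; the cross terms cancel. Hence if [star z * z] is
    negative, [z * star z] must be positive. *)
Lemma star_decomp z : exists p q, [/\ star p = p, star q = q &
  z * star z + star z * z = (p * p + q * q) + (p * p + q * q)].
Proof.
have h2 : 2^-1%:S + 2^-1%:S = 1 :> R[i].
  by rewrite -rmorphD /= -[2^-1]mul1r -splitr rmorph1.
pose p := 2^-1%:S *: (z + star z); pose q := (2^-1%:S * 'i) *: (star z - z).
exists p, q; split.
- by rewrite starZr starD starK addrC.
  rewrite starZ starB starK rmorphM /= conjCi conj_Creal; last by apply/complex_realP; exists 2^-1.
  by rewrite mulrN scaleNr -scalerN opprB.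
have -> : q * q = - (2^-1%:S * 2^-1%:S) *: ((star z - z) * (star z - z)).
  by rewrite -scalerAl -scalerAr scalerA mulrACA -(expr2 'i) sqrCi mulrN1.
have -> : p * p = (2^-1%:S * 2^-1%:S) *: ((z + star z) * (z + star z)).
  by rewrite -scalerAl -scalerAr scalerA.
rewrite scaleNr -scalerBr -scalerDl -mulrDl h2 mul1r.
set s := star z.
have -> : (z + s) * (z + s) - (s - z) * (s - z) = (z * s + s * z) + (z * s + s * z).
  by ncring.
by rewrite scalerDr -scalerDl h2 scale1r.
Qed.


(** A stand-in for the fact that [star z * z] and [z * star z] have the same nonzero spectrum. As
    [z * star z] is positive, [z * star z + m] is invertible for [m = cnorm w ^+ 2]; therefore so is
    [star z * z + m = m - w^2]. But [m] is the norm of [w^2], which would have to be attained in the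
    spectrum. *)
Lemma starM_neg z w : star w = w -> star z * z = - (w * w) -> w = 0.
Proof.
move=> ws zw; apply: contrapT => /eqP w0.
have m0 : 0 < cnorm w by rewrite lt_def cnorm_ge0 andbT; apply: contra_neq w0; exact: cnorm_eq0.
set m := cnorm w ^+ 2; have mm : 0 < m by rewrite exprn_gt0.
have mi : m != 0 by rewrite gt_eqF.
have zp : cpos (z * star z).
  have [p [q [ps qs pq]]] := star_decomp z.
  have -> : z * star z = (p * p + q * q + (p * p + q * q)) + w * w.
    by rewrite -pq zw; zmod.
  by do !apply: cposD; apply: cpos_sq.
have [q [qs q1 q2]] := cpos_addr_inv zp mm.
have [k [ks wk kw km]] := cnorm_sq_le ws (lexx m).
have kkE : k * k = m%:S%:A + star z * z by rewrite zw -wk; zmod.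
(* The usual transfer of an inverse from [m + z * star z] to [m + star z * z]. *)
pose g := m^-1%:S *: (1 - star z * q * z).
have gs : star g = g by rewrite starZr starB star1 !starM starK qs mulrA.
have g1 : k * k * g = 1.
  rewrite /g -scalerAr; have -> : k * k * (1 - star z * q * z) = m%:S%:A :> B.
    rewrite kkE mulrBr mulr1.
    have -> : (m%:S%:A + star z * z) * (star z * q * z) =
        star z * ((z * star z + m%:S%:A) * q) * z.
      by rewrite !(mulrDl, mulrDr) !mulrA !mulr_algl mulr_algr -!scalerAl addrC.
    by rewrite q2 mulr1 addrK.
  by rewrite scalerA -rmorphM mulVf // rmorph1 scale1r.
have g2 : g * (k * k) = 1 by rewrite -[LHS]starK starM (starM k) gs ks g1 star1.
have gcomm x : x * (k * k) = k * k * x -> x * g = g * x.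
  move=> xk; rewrite -[x * g]mul1r -g2 -mulrA [k * k * _]mulrA -xk.
  by rewrite -mulrA g1 mulr1.
have gk : k * g = g * k by apply: gcomm; rewrite mulrA.
have wk' : w * k = k * w by apply: kw.
have gw : w * g = g * w by apply: gcomm; rewrite mulrA kw // -!mulrA kw.
pose p := k * g; have ps : star p = p by rewrite starM gs ks.
have pp : p * p = g by rewrite /p {1}gk -mulrA [k * (k * g)]mulrA g1 mulr1.
pose G := cnorm g; have G0 : 0 <= G := cnorm_ge0 g.
have pG : cnorm p ^+ 2 <= G by rewrite -cnorm_sa // pp.
have [l [ls pl lc _]] := cnorm_sq_le ps pG.
have kl : k * l = l * k by apply: lc; rewrite /p -(mulrA k g) gk.
have wl : w * l = l * w by apply: lc; rewrite /p mulrA wk' -!mulrA gw.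
have Gm : 1 <= G * m.
  rewrite -(cnorm1 B) -g2 (le_trans (cnormM _ _)) // ler_wpM2l //.
  by rewrite cnorm_sa.
have sG : Num.sqrt G * Num.sqrt G = G by rewrite -expr2 sqr_sqrtr.
have vv : (k * l) * (k * l) = G%:S *: (k * k) - 1.
  have ll : l * l = G%:S%:A - g by rewrite -pl pp; zmod.
  rewrite {2}kl mulrA -(mulrA k l l) ll mulrBr mulrBl mulr_algr -scalerAl.
  by rewrite gk -mulrA g2.
(* With [g] the inverse of [k^2] and [l^2 = G - g], one has [G w^2 + (k l)^2 = G m - 1]. So [G m],
   the squared norm of [sqrt G * w], would be at most [G m - 1]. *)
have : cnorm ((Num.sqrt G)%:S *: w) ^+ 2 <= G * m - 1.
  apply: (@cnorm_sum_sq _ (k * l)).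
  - by rewrite starZr ws.
  - by rewrite starM ls ks kl.
  - by rewrite -scalerAl -scalerAr mulrA wk' -!mulrA wl.
  - by rewrite subr_ge0.
  - rewrite -scalerAl -scalerAr scalerA -rmorphM sG vv addrA -scalerDr wk scalerA -rmorphM.
    by rewrite rmorphB scalerBl rmorph1 scale1r.
by rewrite cnormZr ?sqrtr_ge0 // exprMn -/m expr2 sG; lra.
Qed.

(** With [b] the absolute value of [a = star y * y], [c = b - a] is twice the negative part of [a].
    Then [y * c] has [star (y * c) * (y * c) = - c^2 b], the negative of the square of [c * r] with
    [r^2 = b]; [starM_neg] kills it, and [c = 0] follows. *)
Lemma cpos_starM y : cpos (star y * y).
Proof.
set a := star y * y; have as_ : star a = a by rewrite starM starK.
have [b [bp bb bc]] := cpos_sqrt (cpos_sq as_).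
have ab : a * b = b * a by apply: bc; rewrite mulrA.
have [r [rp rr rc]] := cpos_sqrt bp.
have ar : a * r = r * a by apply: rc.
have br : b * r = r * b by apply: rc.
pose c := b - a; have cs : star c = c by rewrite starB as_ (cpos_sa bp).
have cr : c * r = r * c by rewrite mulrBl mulrBr ar br.
have ac : a * c = - (c * b) by rewrite mulrBr mulrBl -bb opprB ab.
have w0 : c * r = 0.
  apply: (@starM_neg (y * c)); first by rewrite starM cs (cpos_sa rp) cr.
  rewrite starM cs mulrA -(mulrA c) -/a -(mulrA c) ac -rr mulrN.
  by rewrite !mulrA -(mulrA c r c) -cr mulrA.
have cb : c * b = 0 by rewrite -rr mulrA w0 mul0r.
have ca : c * a = 0 by rewrite mulrBl -ab -mulrBr -/c ac cb oppr0.
have c0 : c = 0.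
  apply/cnorm_eq0/eqP; rewrite -sqrf_eq0 -cnorm_sa // {2}/c mulrBr cb ca.
  by rewrite subrr cnorm0.
by have -> : a = b by apply/esym/eqP; rewrite -subr_eq0 -/c c0.
Qed.

Lemma cposP x : cstar_pos x <-> cpos x.
Proof.
split=> [[y ->]|/cpos_sqrt[s [sp <- _]]]; first exact: cpos_starM.
by exists s; rewrite (cpos_sa sp).
Qed.

Lemma cpos_starMr x : cpos (x * star x).
Proof. by have := cpos_starM (star x); rewrite starK. Qed.

Lemma cpos_conj x a : cpos a -> cpos (x * a * star x).
Proof.
move=> /cpos_sqrt[s [sp <- _]]; rewrite mulrA -mulrA.
by rewrite -{2}(cpos_sa sp) -starM; apply: cpos_starMr.
Qed.

Lemma cpos_lim u l : clim u l -> (forall n, cpos (u n)) -> cpos l.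
Proof.
move=> ul up; split.
  apply: (clim_uniq (clim_star ul)).
  by under [X in clim X _]eq_fun do rewrite (cpos_sa (up _)).
have l0 := cnorm_ge0 l; exists (cnorm l + 1); first lra.
have tl : clim (fun n => (cnorm l + 1)%:S%:A - u n) ((cnorm l + 1)%:S%:A - l).
  exact/(climD (clim_cst _))/climN.
apply: (clim_norm tl); have [N uN] := ul 1 ltr01; exists N => n Nn.
apply: cpos_norm => //; have := uN n Nn; have := cnormD (u n - l) l.
by rewrite subrK; lra.
Qed.

Lemma cpos_add_eps x y : (forall e, 0 < e -> cpos (x + e%:S *: y)) -> cpos x.
Proof.
move=> xy; apply: (@cpos_lim (fun n => x + n.+1%:R^-1%:S *: y)); last first.
  by move=> n; apply: xy; rewrite invr_gt0.
move=> e e0; have [N Ne] : exists N : nat, cnorm y / e < N%:R.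
  exists (Num.bound (cnorm y / e)); apply: archi_boundP.
  by rewrite divr_ge0 ?cnorm_ge0 // ltW.
exists N => n Nn; rewrite addrC addKr cnormZr ?invr_ge0 //.
rewrite mulrC ltr_pdivrMr ?ltr0n // mulrC -ltr_pdivrMr //.
by rewrite (lt_le_trans Ne) // ler_nat ltnW.
Qed.

Lemma cpos_sum (T : Type) (r : seq T) (P : pred T) (F : T -> B) :
  (forall i, P i -> cpos (F i)) -> cpos (\sum_(i <- r | P i) F i).
Proof. by move=> FP; elim/big_ind: _ => //; [exact: cpos0 | exact: cposD]. Qed.

End PositiveCone.

(** * Complete positivity *)

Section NoConstantTerm.
Variables (K : numClosedFieldType) (B : starAlgType K) (I : Type).
Implicit Types f g : ncpoly B I.

Lemma ncsubst_star (J : Type) (p : I -> ncpoly B J) f :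
  (forall i, star (p i) = p i) -> ncsubst p (star f) = star (ncsubst p f).
Proof.
move=> ps; elim/nc_ind: f; elim=> [b|i|s IHs t IHt|s IHs t IHt].
- by rewrite [star (ncpi _)]ncstarC !ncsubstC [RHS]ncstarC.
- by rewrite [star (ncpi _)]ncstarX !ncsubstX ps.
- by rewrite ncpiD starD !ncsubstD IHs IHt starD.
- by rewrite ncpiM starM !rmorphM /= IHs IHt starM.
Qed.

(** The kernel of evaluation at zero: being a two-sided ideal stable under [star] is immediate,
    unlike for the explicit sums of words in [no_free_term]. *)
Definition const_free f : Prop := ncsubst (fun=> 0 : ncpoly B I) f = 0.

Lemma const_free0 : const_free 0. Proof. exact: rmorph0. Qed.

Lemma const_freeX i : const_free (ncX B i). Proof. exact: ncsubstX. Qed.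

Lemma const_freeD f g : const_free f -> const_free g -> const_free (f + g).
Proof. by rewrite /const_free ncsubstD => -> ->; rewrite addr0. Qed.

Lemma const_freeMl f g : const_free g -> const_free (f * g).
Proof. by rewrite /const_free rmorphM /= => ->; rewrite mulr0. Qed.

Lemma const_freeMr f g : const_free f -> const_free (f * g).
Proof. by rewrite /const_free rmorphM /= => ->; rewrite mul0r. Qed.

Lemma const_free_sum (T : Type) (r : seq T) (P : pred T) (F : T -> ncpoly B I) :
  (forall i, P i -> const_free (F i)) -> const_free (\sum_(i <- r | P i) F i).
Proof. by move=> FP; elim/big_ind: _ => //; [exact: const_free0 | exact: const_freeD]. Qed.

Lemma const_free_star f : const_free f -> const_free (star f).
Proof. by move=> f0; rewrite /const_free ncsubst_star => [|_]; rewrite ?f0 star0. Qed.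

End NoConstantTerm.

Lemma no_free_termP (R : realType) (B : cstarAlgType R) (f : ncpoly B unit) :
  no_free_term f <-> const_free f.
Proof.
have cf (m : B * seq B) : m.2 != [::] ->
    const_free (ncC unit m.1 * \prod_(c <- m.2) (ncX1 B * ncC unit c)).
  case: m => b [|c s] //= _; rewrite big_cons.
  by apply/const_freeMl/const_freeMr/const_freeMr/const_freeX.
split=> [[ms /allP msP ->]|].
  by rewrite big_seq_cond; apply: const_free_sum => m /andP[/msP/cf].
have [ms ->] := ncspan f => f0.
have sE : \sum_(m <- ms) ncC unit m.1 * \prod_(c <- m.2) (ncX1 B * ncC unit c) =
    ncC unit (\sum_(m <- ms | m.2 == [::]) m.1) +
    \sum_(m <- ms | m.2 != [::]) ncC unit m.1 * \prod_(c <- m.2) (ncX1 B * ncC unit c).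
  rewrite (bigID (fun m : B * seq B => m.2 == [::])) /= rmorph_sum; congr (_ + _).
  by apply: eq_bigr => -[b [|? ?]] //= _; rewrite big_nil mulr1.
exists [seq m <- ms | m.2 != [::]]; first exact: filter_all.
move: f0; rewrite sE big_filter /const_free ncsubstD ncsubstC => f0.
have c0 : ncC unit (\sum_(m <- ms | m.2 == [::]) m.1) = 0.
  rewrite -[RHS]f0 [X in _ + X](_ : _ = 0) ?addr0 //.
  by apply: const_free_sum => m /cf.
by rewrite c0 add0r.
Qed.

Section CompletePositivity.
Variables (R : realType) (B : cstarAlgType R) (rho : ncpoly B unit -> B).
Hypothesis rhoP : unital_bimod_map rho.
Hypothesis rho_pos : forall f, const_free f -> cpos (rho (f * star f)).
Local Notation C := (ncC unit).

Lemma rhoB f g : rho (f - g) = rho f - rho g.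
Proof. by apply: (addIr (rho g)); rewrite -(bimodD rhoP) !subrK. Qed.

Implicit Types (a : nat -> nat -> B) (c : nat -> B) (g : nat -> ncpoly B unit).

Lemma double_sumS (V : zmodType) (F : nat -> nat -> V) n :
  \sum_(k < n.+1) \sum_(l < n.+1) F k l =
  \sum_(k < n) \sum_(l < n) F k l + \sum_(k < n) F k n + \sum_(l < n) F n l + F n n.
Proof.
rewrite big_ord_recr big_ord_recr /= addrA; congr (_ + _ + _).
by rewrite -big_split; apply: eq_bigr => k _; rewrite big_ord_recr.
Qed.

(** A positive [n] by [n] matrix over B, tested on row vectors. Hermitian symmetry is demanded at
    all indices, which avoids bounds when rows are removed. *)
Definition pos_kernel n a : Prop :=
  (forall k l, star (a k l) = a l k) /\
  forall c, cpos (\sum_(k < n) \sum_(l < n) c k * a k l * star (c l)).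

Lemma pos_kernel_diag n a k : pos_kernel n a -> (k < n)%N -> cpos (a k k).
Proof.
move=> [_ /(_ (fun l => (l == k)%:R))] + kn.
rewrite (bigD1 (Ordinal kn)) //= [X in _ + X]big1 ?addr0 => [|i].
  rewrite (bigD1 (Ordinal kn)) //= [X in _ + X]big1 ?addr0 => [|i].
    by rewrite eqxx star1 mulr1 mul1r.
  by rewrite -val_eqE /= => /negPf->; rewrite star0 mulr0.
rewrite -val_eqE /= => /negPf->; rewrite big1 // => l _.
by rewrite !mul0r.
Qed.

Lemma star_sum (K : numClosedFieldType) (A : starAlgType K) (T : Type) (r : seq T)
  (P : pred T) (F : T -> A) :
  star (\sum_(i <- r | P i) F i) = \sum_(i <- r | P i) star (F i).
Proof. by rewrite (big_morph star (@starD _ _) (star0 _)). Qed.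

(* Schur complement with respect to the last, slightly perturbed, diagonal entry. *)
Lemma pos_kernel_schur n a e q : pos_kernel n.+1 a -> 0 <= e -> star q = q ->
  q * (a n n + (e%:C%C)%:A) = 1 ->
  pos_kernel n (fun k l => a k l - a k n * q * a n l).
Proof.
move=> [ah ap] e0 qs q1; split=> [k l|c].
  by rewrite starB !starM !ah qs mulrA.
pose S := \sum_(k < n) c k * a k n.
have SE : star S = \sum_(l < n) a n l * star (c l).
  by rewrite star_sum; apply: eq_bigr => l _; rewrite starM ah.
have Sx x : S * x = \sum_(k < n) c k * a k n * x by rewrite mulr_suml.
(* The last coordinate [- (S * q)] completes the square. As [q] inverts the perturbed entry rather
   than [a n n], the form falls short of the Schur complement by [e] times [S * q * star (S * q)],
   which is positive. *)
pose d k := if (k < n)%N then c k else - (S * q).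
have dn : d n = - (S * q) by rewrite /d ltnn.
have dk (k : 'I_n) : d k = c k by rewrite /d ltn_ord.
have := ap d; rewrite (double_sumS (fun k l => d k * a k l * star (d l))).
have -> : \sum_(k < n) \sum_(l < n) d k * a k l * star (d l) =
    \sum_(k < n) \sum_(l < n) c k * a k l * star (c l).
  by apply: eq_bigr => k _; apply: eq_bigr => l _; rewrite !dk.
have -> : \sum_(k < n) d k * a k n * star (d n) = - (S * q * star S).
  rewrite -mulrA -mulrN Sx; apply: eq_bigr => k _.
  by rewrite dk dn starN starM qs.
have -> : \sum_(l < n) d n * a n l * star (d l) = - (S * q * star S).
  rewrite -mulNr SE mulr_sumr; apply: eq_bigr => l _.
  by rewrite dk dn mulrA.
set T := (X in cpos X) => Tp.
rewrite [X in cpos X](_ : _ = T + (e%:C%C : R[i]) *: (S * q * star (S * q))).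
  by apply/(cposD Tp)/cposZ => //; exact: cpos_starMr.
have -> : \sum_(k < n) \sum_(l < n) c k * (a k l - a k n * q * a n l) * star (c l) =
    \sum_(k < n) \sum_(l < n) c k * a k l * star (c l) - S * q * star S.
  rewrite -mulrA Sx -sumrB; apply: eq_bigr => k _.
  rewrite SE !mulr_sumr -sumrB; apply: eq_bigr => l _.
  by rewrite mulrBr mulrBl !mulrA.
have q2 : S * q * a n n * (q * star S) = S * q * star S - (e%:C%C : R[i]) *: (S * q * (q * star S)).
  have qa : q * a n n = 1 - (e%:C%C : R[i]) *: q.
    by rewrite -q1 mulrDr mulr_algr addrK.
  by rewrite -(mulrA S) qa mulrBr mulr1 -scalerAr mulrBl -scalerAl mulrA.
rewrite /T dn starN starM qs mulrN mulNr mulNr opprK q2.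
zmod.
Qed.

(** One step of Gaussian elimination: with [Z = g n * C d + Y], the last row and column amount to
    [rho (Z * C q * star Z)], and the Schur complement is left. Since [q = s * s], that value is
    [rho] at [Z * C s] times its adjoint, and [Z * C s] stays in the ideal where [rho] is
    positive. *)
Lemma cp_of_pos n a g : pos_kernel n a -> (forall k, const_free (g k)) ->
  cpos (\sum_(k < n) \sum_(l < n) rho (g k * C (a k l) * star (g l))).
Proof.
move=> aP g0; elim: n a aP => [|n IHn] a aP; first by rewrite big_ord0; exact: cpos0.
(* Replacing the pivot [a n n] by the invertible [a n n + e] costs exactly [e] times this value, and
   [e] then tends to zero. *)
apply: (@cpos_add_eps _ _ _ (rho (g n * star (g n)))) => e e0.
have [ah ap] := aP; have dp := pos_kernel_diag aP (ltnSn n).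
have [q [qs q1 q2]] := cpos_addr_inv dp e0.
set d := a n n + _ in q1 q2.
have ds : star d = d by rewrite starD starAr ah.
have qp : cpos q.
  have -> : q = q * d * star q by rewrite q1 mul1r qs.
  by apply/cpos_conj/cposD => //; exact/cpos_scal/ltW.
have [s [sp ss _]] := cpos_sqrt qp.
pose Y := \sum_(k < n) g k * C (a k n); pose Z := g n * C d + Y.
have YE : star Y = \sum_(l < n) C (a n l) * star (g l).
  by rewrite star_sum; apply: eq_bigr => l _; rewrite starM [star (C _)]ncstarC ah.
have Z0 : const_free Z.
  apply: const_freeD; first exact: const_freeMr.
  by apply: const_free_sum => k _; apply: const_freeMr.
have -> : \sum_(k < n.+1) \sum_(l < n.+1) rho (g k * C (a k l) * star (g l)) +
    (e%:C%C : R[i]) *: rho (g n * star (g n)) =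
    \sum_(k < n) \sum_(l < n) rho (g k * C (a k l - a k n * q * a n l) * star (g l))
    + rho (Z * C s * star (Z * C s)).
  rewrite (double_sumS (fun k l => rho (g k * C (a k l) * star (g l)))).
  have -> : \sum_(k < n) rho (g k * C (a k n) * star (g n)) = rho (Y * star (g n)).
    by rewrite mulr_suml (bimod_sum rhoP).
  have -> : \sum_(l < n) rho (g n * C (a n l) * star (g l)) = rho (g n * star Y).
    by rewrite YE mulr_sumr (bimod_sum rhoP); apply: eq_bigr => l _; rewrite mulrA.
  have -> : \sum_(k < n) \sum_(l < n) rho (g k * C (a k l - a k n * q * a n l) * star (g l)) =
      \sum_(k < n) \sum_(l < n) rho (g k * C (a k l) * star (g l)) - rho (Y * C q * star Y).
    rewrite -mulrA mulr_suml (bimod_sum rhoP) -sumrB; apply: eq_bigr => k _.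
    rewrite YE !mulr_sumr (bimod_sum rhoP) -sumrB; apply: eq_bigr => l _.
    rewrite -rhoB; congr rho; rewrite rmorphB !rmorphM /= mulrBr mulrBl !mulrA.
    by [].
  have -> : Z * C s * star (Z * C s) = Z * C q * star Z.
    by rewrite starM [star (C s)]ncstarC (cpos_sa sp) -ss rmorphM !mulrA.
  have -> : Z * C q * star Z = g n * C d * star (g n) + g n * star Y + Y * star (g n)
      + Y * C q * star Y.
    have dq : C d * C q = 1 by rewrite -rmorphM q2 rmorph1.
    have qd : C q * C d = 1 by rewrite -rmorphM q1 rmorph1.
    rewrite starD starM [star (C d)]ncstarC ds mulrDr !mulrDl.
    rewrite -(mulrA (g n) (C d) (C q)) dq mulr1 !mulrA.
    by rewrite -(mulrA Y (C q) (C d)) qd mulr1; zmod.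
  have -> : g n * C d * star (g n) = g n * C (a n n) * star (g n) + (e%:C%C : R[i]) *: (g n * star (g n)).
    by rewrite /d rmorphD /= ncCA mulrDr mulrDl mulr_algr -scalerAl.
  rewrite !(bimodD rhoP) (bimodZ rhoP); zmod.
apply: cposD; last exact/rho_pos/const_freeMr.
exact: (IHn _ (pos_kernel_schur aP (ltW e0) qs q1)).
Qed.

End CompletePositivity.

(** * The coloured Fock space *)

Section Fock.
Variables (R : realType) (B : cstarAlgType R) (I : finType).
Variable rho : ncpoly B unit -> B.
Hypothesis rhoP : unital_bimod_map rho.
Local Notation C := (ncC unit).
Local Notation X := (ncX1 B).

(* [(b, [:: (i_k, f_k); ...; (i_1, f_1)])] stands for the elementary tensor
   [b f_1 (x) ... (x) f_k] of the full Fock space (right multiplication acts on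
   the head of the list), where [f_r] is a polynomial in the variable [X_{i_r}].
   For the left action the list is read in the opposite order,
   [g_1 (x) ... (x) g_k b]. *)
Definition fstate := (B * seq (I * ncpoly B unit))%type.
Implicit Types (e x y : fstate) (b c : B) (s t : ncterm B I).

Definition rmul e c : fstate :=
  if e.2 is (i, f) :: r then (e.1, (i, f * C c) :: r) else (e.1 * c, [::]).
(** The two outcomes for a block holding [f]: left open, or closed at once with value [rho f]. At
    [f = X] this is creation plus the scalar [rho X]; after [rpop] it is gauge plus annihilation. *)
Definition rpush e i f : seq fstate := [:: (e.1, (i, f) :: e.2); rmul e (rho f)].
Definition rpop i e : seq fstate :=
  if e.2 is (j, f) :: r then
    if i == j then rpush (e.1, r) i (f * X) else [::]
  else [::].
Definition rvar i e := rpush e i X ++ rpop i e.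

Definition lmul c e : fstate :=
  if e.2 is (i, f) :: r then (e.1, (i, C c * f) :: r) else (c * e.1, [::]).
Definition lpush e i f : seq fstate := [:: (e.1, (i, f) :: e.2); lmul (rho f) e].
Definition lpop i e : seq fstate :=
  if e.2 is (j, f) :: r then
    if i == j then lpush (e.1, r) i (X * f) else [::]
  else [::].
Definition lvar i e := lpush e i X ++ lpop i e.

Fixpoint ract t e : seq fstate :=
  match t with
  | Cst c => [:: rmul e c]
  | Var i => rvar i e
  | Add s t => ract s e ++ ract t e
  | Mul s t => flatten [seq ract t x | x <- ract s e]
  end.

Fixpoint lact t e : seq fstate :=
  match t with
  | Cst c => [:: lmul c e]
  | Var i => lvar i e
  | Add s t => lact s e ++ lact t e
  | Mul s t => flatten [seq lact s x | x <- lact t e]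
  end.

(** The B-valued inner product of tensors, evaluated from the top blocks down: [a] is the value
    reached so far, sandwiched by the next pair of factors. Different colours are orthogonal. *)
Fixpoint fpair_rec (r r' : seq (I * ncpoly B unit)) (b b' a : B) : B :=
  match r, r' with
  | [::], [::] => b * a * b'
  | (i, f) :: r, (j, g) :: r' =>
      if i == j then fpair_rec r r' b b' (rho (f * C a * g)) else 0
  | _, _ => 0
  end.

Definition fpair e e' a := fpair_rec e.2 e'.2 e.1 e'.1 a.

Lemma fpairD e e' a b : fpair e e' (a + b) = fpair e e' a + fpair e e' b.
Proof.
rewrite /fpair; move: e.1 e'.1 => d d'.
elim: e.2 e'.2 a b => [|[i f] r IHr] [|[j g] r'] a b //=; rewrite ?addr0 //.
  by rewrite mulrDr mulrDl.
case: eqP => _; last by rewrite addr0.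
by rewrite rmorphD mulrDr mulrDl (bimodD rhoP) IHr.
Qed.

Lemma fpair0 e e' : fpair e e' 0 = 0.
Proof. by apply: (addrI (fpair e e' 0)); rewrite -fpairD !addr0. Qed.

Lemma fpair_rmul e e' c a : fpair (rmul e c) e' a = fpair e e' (c * a).
Proof.
case: e e' => [b [|[i f] r]] [b' [|[j g] r']]; rewrite /fpair /rmul //= ?mulrA //.
by case: eqP => // _; rewrite rmorphM !mulrA.
Qed.

Lemma fpair_lmul e e' c a : fpair e (lmul c e') a = fpair e e' (a * c).
Proof.
case: e e' => [b [|[i f] r]] [b' [|[j g] r']]; rewrite /fpair /lmul //= ?mulrA //.
by case: eqP => // _; rewrite rmorphM !mulrA.
Qed.

(** Self-adjointness of [X_i]: creation on one side matches annihilation on the other, while the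
    scalar term and the gauge term [rho (f * X * g)] are symmetric. *)
Lemma fpair_var i e e' :
  \sum_(x <- rvar i e) fpair x e' 1 = \sum_(y <- lvar i e') fpair e y 1.
Proof.
rewrite /rvar /lvar !big_cat /rpush /lpush /= !big_cons !big_nil !addr0 fpair_rmul fpair_lmul mulr1 mul1r.
have -> : \sum_(x <- rpop i e) fpair x e' 1 =
    fpair e (e'.1, (i, X) :: e'.2) 1 +
    (if e.2 is (j, f) :: r then if e'.2 is (k, g) :: r' then
       if (i == j) && (i == k) then fpair (e.1, r) (e'.1, r') (rho (f * X * g)) else 0 else 0 else 0).
  case: e => b [|[j f] r]; rewrite /rpop /fpair /= ?big_nil ?add0r //.
  rewrite [j == i]eq_sym; case: eqP => [_|_]; rewrite ?big_nil; last first.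
    by case: e' => b' [|[k g] r'] /=; rewrite addr0.
  rewrite /rpush /lpush !big_cons big_nil addr0 -/(fpair (rmul (b, r) _) e' 1) fpair_rmul mulr1 rmorph1 mulr1 addrC.
  congr (_ + _); case: e' => b' [|[k g] r'] //=; case: eqP => // _.
  by rewrite rmorph1 mulr1.
have -> : \sum_(y <- lpop i e') fpair e y 1 =
    fpair (e.1, (i, X) :: e.2) e' 1 +
    (if e.2 is (j, f) :: r then if e'.2 is (k, g) :: r' then
       if (i == j) && (i == k) then fpair (e.1, r) (e'.1, r') (rho (f * X * g)) else 0 else 0 else 0).
  case: e' => b [|[j f] r]; rewrite /lpop /fpair /= ?big_nil ?add0r //.
    by case: e => b' [|[k g] r'].
  case: eqP => [_|_]; rewrite ?big_nil; last first.
    by case: e => b' [|[k g] r'] /=; rewrite ?andbF addr0.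
  rewrite /rpush /lpush !big_cons big_nil addr0 -/(fpair e (lmul _ (b, r)) 1) fpair_lmul mul1r rmorph1 mulr1 addrC.
  congr (_ + _); case: e => b' [|[k g] r'] //=; rewrite eq_sym andbT; case: eqP => // _.
  by rewrite rmorph1 mulr1 mulrA.
zmod.
Qed.

Definition fval t e e' := \sum_(x <- ract t e) fpair x e' 1.

Lemma fval_mul s t e e' : fval (Mul s t) e e' = \sum_(x <- ract s e) fval t x e'.
Proof. by rewrite /fval /= big_flatten big_map. Qed.

Lemma fval_adj t e e' : fval t e e' = \sum_(y <- lact t e') fpair e y 1.
Proof.
elim: t e e' => [c|i|s IHs t IHt|s IHs t IHt] e e'.
- by rewrite /fval !big_seq1 fpair_rmul fpair_lmul mulr1 mul1r.
- exact: fpair_var.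
- by rewrite /fval /= !big_cat -IHs -IHt.
- rewrite fval_mul /= big_flatten big_map.
  under eq_bigr do rewrite IHt; rewrite exchange_big /=.
  by apply: eq_bigr => y _; rewrite -IHs.
Qed.

Lemma fval_mulr s t e e' : fval (Mul s t) e e' = \sum_(y <- lact t e') fval s e y.
Proof.
rewrite fval_adj /= big_flatten big_map.
by apply: eq_bigr => y _; rewrite -fval_adj.
Qed.

Lemma fvalC c e e' : fval (Cst I c) e e' = fpair e e' c.
Proof. by rewrite /fval big_seq1 fpair_rmul mulr1. Qed.

Lemma fvalD s t e e' : fval (Add s t) e e' = fval s e e' + fval t e e'.
Proof. by rewrite /fval /= big_cat. Qed.

Lemma fval_Cst_mul c t e e' : fval (Mul (Cst I c) t) e e' = fval t (rmul e c) e'.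
Proof. by rewrite fval_mul big_seq1. Qed.

Lemma fval_mul_Cst c t e e' : fval (Mul t (Cst I c)) e e' = fval t e (lmul c e').
Proof. by rewrite fval_mulr big_seq1. Qed.

Lemma rmul1 e : rmul e 1 = e.
Proof. by case: e => b [|[i f] r]; rewrite /rmul /= ?rmorph1 mulr1. Qed.

Lemma lmul1 e : lmul 1 e = e.
Proof. by case: e => b [|[i f] r]; rewrite /lmul /= ?rmorph1 mul1r. Qed.

(** Associativity of products and congruence in the left factor cannot be seen on lists; the right
    factor is first moved to the other vector by adjunction. *)
Lemma nceq_fval s t : nceq s t -> forall e e', fval s e e' = fval t e e'.
Proof.
elim=> {s t} //=.
- by move=> s t u _ st _ tu e e'; rewrite st tu.
- by move=> s s' t t' _ IHs _ IHt e e'; rewrite !fvalD IHs IHt.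
- move=> s s' t t' _ IHs _ IHt e e'; rewrite fval_mul.
  under eq_bigr do rewrite IHt; rewrite -fval_mul !fval_mulr.
  by apply: eq_bigr => y _.
- by move=> s t u e e'; rewrite !fvalD addrA.
- by move=> s t e e'; rewrite !fvalD addrC.
- by move=> t e e'; rewrite fvalD fvalC fpair0 add0r.
- move=> s t u e e'; rewrite fval_mul fval_mulr.
  under eq_bigr do rewrite fval_mulr; rewrite exchange_big /=.
  by apply: eq_bigr => y _; rewrite fval_mul.
- by move=> t e e'; rewrite fval_Cst_mul rmul1.
- by move=> t e e'; rewrite fval_mul_Cst lmul1.
- move=> t e e'; rewrite fval_mulr fvalC fpair0 big1 // => y _.
  by rewrite fvalC fpair0.
- move=> s t u e e'; rewrite fvalD !fval_mulr -big_split.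
  by apply: eq_bigr => y _; rewrite fvalD.
- move=> s t u e e'; rewrite fvalD !fval_mul -big_split.
  by apply: eq_bigr => y _; rewrite fvalD.
- by move=> b c e e'; rewrite fvalD !fvalC fpairD.
- by move=> b c e e'; rewrite fval_Cst_mul !fvalC fpair_rmul.
- move=> a i e e'; rewrite fval_Cst_mul fval_mul_Cst /fval /rvar !big_cat /rpush /=.
  rewrite /rpush !big_cons !big_nil !addr0 !fpair_lmul !fpair_rmul mul1r !mulr1.
  have aX (f : ncpoly B unit) : C a%:A * f = f * C a%:A by rewrite ncCA mulr_algl mulr_algr.
  have -> : rho X * a%:A = a%:A * rho X by rewrite mulr_algl mulr_algr.
  congr (_ + _ + _).
    rewrite /fpair /=; case: (e'.2) => // -[k g] r'; case: eqP => // _.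
    rewrite -/(fpair (rmul e a%:A) (e'.1, r') _) -/(fpair e (e'.1, r') _) fpair_rmul.
    by rewrite -(bimodl rhoP) rmorph1 mulr1 mulrA aX.
  case: e => b [|[j f] r]; rewrite /rpop ?big_nil //=; case: eqP => // _; rewrite ?big_nil //.
  rewrite /rpush !big_cons !big_nil !addr0 !fpair_lmul !fpair_rmul mul1r !mulr1.
  rewrite -!mulrA aX !mulrA (bimodr rhoP); congr (_ + _).
  by rewrite -[LHS]/(fpair (rmul (b, (i, f * X) :: r) a%:A) e' 1) fpair_rmul mulr1.
Qed.

End Fock.

(** * Vacuum moments and positivity *)

Lemma In_cat (T : Type) (x : T) (u v : seq T) :
  List.In x (u ++ v) -> List.In x u \/ List.In x v.
Proof.
elim: u => [|y u IHu] /=; first by right.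
by case=> [->|/IHu[]]; [left; left | left; right | right].
Qed.

Section FockState.
Variables (R : realType) (B : cstarAlgType R) (I : finType).
Variable rho : ncpoly B unit -> B.
Hypothesis rhoP : unital_bimod_map rho.
Local Notation C := (ncC unit).
Local Notation X := (ncX1 B).
Local Notation fstate := (fstate B I).
Implicit Types (e x y : fstate) (b c : B) (s t : ncterm B I).

Definition fvac : fstate := (1, [::]).

Definition fock_map (f : ncpoly B I) : B := fval rho (repr f) fvac fvac.

Lemma fock_mapE t : fock_map (ncpi t) = fval rho t fvac fvac.
Proof. exact/(nceq_fval rhoP)/repr_ncpi. Qed.

Definition vac_coef e : B := if e.2 is [::] then e.1 else 0.

Lemma fpair_vac e a : fpair rho e fvac a = vac_coef e * a.
Proof.
by case: e => b [|[i f] r]; rewrite /fpair /vac_coef /= ?mulr1 ?mul0r.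
Qed.

Definition fscale b e : fstate := (b * e.1, e.2).

Lemma ract_scale b t e :
  ract rho t (fscale b e) = [seq fscale b x | x <- ract rho t e].
Proof.
have rmulS c x : rmul (fscale b x) c = fscale b (rmul x c).
  by case: x => d [|[i f] r]; rewrite /rmul /fscale //= mulrA.
have rpushS i f x : rpush rho (fscale b x) i f = [seq fscale b y | y <- rpush rho x i f].
  by rewrite /rpush /= rmulS.
elim: t e => [c|i|s IHs t IHt|s IHs t IHt] e.
- by rewrite /= rmulS.
- rewrite /ract /rvar map_cat rpushS; congr (_ ++ _).
  case: e => d [|[j f] r] //; rewrite /rpop /fscale /=; case: eqP => // _.
  exact: (rpushS _ _ (d, r)).
- by rewrite /= IHs IHt map_cat.
- rewrite /= IHs map_flatten -!map_comp; congr flatten; apply: eq_map => x /=.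
  exact: IHt.
Qed.

Lemma fpair_scale b e e' a : fpair rho (fscale b e) e' a = b * fpair rho e e' a.
Proof.
rewrite /fpair /=; move: e.1 e'.1 => d d'.
elim: e.2 e'.2 a => [|[i f] r IHr] [|[j g] r'] a /=; rewrite ?mulr0 ?mulrA //.
by case: eqP => _; rewrite ?mulr0.
Qed.

Lemma fval_scale b t e e' : fval rho t (fscale b e) e' = b * fval rho t e e'.
Proof.
rewrite /fval ract_scale big_map mulr_sumr; apply: eq_bigr => x _.
exact: fpair_scale.
Qed.

Lemma fock_bimod : unital_bimod_map fock_map.
Proof.
split.
- by rewrite -(rmorph1 (ncC I)) fock_mapE fvalC fpair_vac /vac_coef /= mulr1.
- by elim/nc_ind=> s; elim/nc_ind=> t; rewrite -ncpiD !fock_mapE fvalD.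
- move=> b c; elim/nc_ind=> t; rewrite -(ncpiM (Cst I b)) -(ncpiM _ (Cst I c)) !fock_mapE.
  rewrite fval_mul_Cst fval_Cst_mul.
  have -> : rmul fvac b = fscale b fvac by rewrite /rmul /fscale /= mul1r mulr1.
  rewrite fval_scale -mulrA; congr (_ * _); rewrite /fval mulr_suml.
  by apply: eq_bigr => x _; rewrite fpair_lmul mul1r !fpair_vac mulr1.
Qed.

Section Positivity.
Hypothesis rhoH : forall f, rho (star f) = star (rho f).
Hypothesis rho_pos : forall f, const_free f -> cpos (rho (f * star f)).

Definition fstar e : fstate := (star e.1, [seq (p.1, star p.2) | p <- e.2]).

(** The involution exchanges the two actions; [rho] must be hermitian for the scalars of closed
    blocks to correspond. *)
Lemma lact_star t e : lact rho (tstar t) (fstar e) = [seq fstar x | x <- ract rho t e].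
Proof.
have mulS c x : lmul (star c) (fstar x) = fstar (rmul x c).
  case: x => d [|[i f] r]; rewrite /lmul /rmul /fstar /= starM //.
  by rewrite [star (C c)]ncstarC.
have pushS i f x : lpush rho (fstar x) i (star f) = [seq fstar y | y <- rpush rho x i f].
  by rewrite /rpush /lpush /= -mulS rhoH.
have sX : star X = X by exact: ncstarX.
elim: t e => [c|i|s IHs t IHt|s IHs t IHt] e.
- by rewrite /= mulS.
- rewrite /tstar /lact /ract /rvar /lvar map_cat -pushS sX; congr (_ ++ _).
  case: e => d [|[j f] r] //; rewrite /rpop /lpop /fstar /=; case: eqP => // _.
  by rewrite -{1}sX -starM; exact: (pushS _ _ (d, r)).
- by rewrite /= IHs IHt map_cat.
- rewrite /= IHs map_flatten -!map_comp; congr flatten; apply: eq_map => x /=.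
  exact: IHt.
Qed.

(** Open blocks always contain a letter, so they remain in the ideal on which [rho] is assumed
    positive. *)
Definition fconst_free e := forall p, List.In p e.2 -> const_free p.2.

Lemma ract_const_free t e x : fconst_free e -> List.In x (ract rho t e) -> fconst_free x.
Proof.
have mulS c y : fconst_free y -> fconst_free (rmul y c).
  case: y => d [|[i f] r] y0 p //=; case=> [<-|pr]; last by apply: y0; right.
  by apply/const_freeMr/(y0 (i, f)); left.
have pushS i f y z : const_free f -> fconst_free y -> List.In z (rpush rho y i f) ->
    fconst_free z.
  move=> f0 y0; case=> [<- p /= [<- //|]|[<-|//]]; first exact: y0.
  exact: mulS.
elim: t e x => [c|i|s IHs t IHt|s IHs t IHt] e x e0.
- by case=> // <-; apply: mulS.
- have X0 : const_free X by exact: const_freeX.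
  move=> xe; have {xe} [|] := In_cat xe; first exact: (pushS i X e x X0 e0).
  case: e e0 => d [|[j f] r] // e0; rewrite /rpop /=; case: eqP => // _.
  apply: (pushS i (f * X) (d, r)); first exact: const_freeMl.
  by move=> p pr; apply: e0; right.
- by move=> xe; have [/IHs|/IHt] := In_cat xe; apply.
- rewrite /=; elim: (ract rho s e) (IHs e ^~ e0) => //= y v IHv v0 xv.
  have [xy|xv'] := In_cat xv.
    by apply: IHt xy; apply: v0; left.
  by apply: IHv => // z zv; apply: v0; right.
Qed.

(** Induction on the number of blocks. Pairing off the top blocks turns the kernel [a] into [a'],
    positive by [cp_of_pos]; orthogonality of colours makes [a'] a sum of one such kernel per
    colour. *)
Lemma fpair_pos d n (e : nat -> fstate) (a : nat -> nat -> B) :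
  pos_kernel n a -> (forall k, fconst_free (e k)) ->
  (forall k, (size (e k).2 <= d)%N) ->
  cpos (\sum_(k < n) \sum_(l < n) fpair rho (e k) (fstar (e l)) (a k l)).
Proof.
elim: d e a => [|d IHd] e a aP e0 ed.
  rewrite (_ : (\sum_(k < n) _) =
      \sum_(k < n) \sum_(l < n) (e k).1 * a k l * star (e l).1); first exact: (aP.2 (fun k => (e k).1)).
  apply: eq_bigr => k _; apply: eq_bigr => l _; rewrite /fpair /=.
  by move: (ed k) (ed l); case: (e k).2 (e l).2 => [|? ?] [|? ?].
(* [h] carries the states without blocks. For these [g] defaults to 0, so their rows of [a'] vanish
   and they are not counted again in the remainder. *)
pose h k := vac_coef (e k).
pose g i k := if (e k).2 is (j, f) :: _ then if j == i then f else 0 else 0.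
have g0 i k : const_free (g i k).
  have := e0 k; rewrite /g; case: (e k) => b [|[j f] r] /= ek; first exact: const_free0.
  by case: eqP => _; [apply/(ek (j, f))/or_introl | exact: const_free0].
pose a' k l := \sum_(i : I) rho (g i k * C (a k l) * star (g i l)).
pose e' k : fstate := ((e k).1, behead (e k).2).
have a'P : pos_kernel n a'.
  split=> [k l|c].
    rewrite star_sum; apply: eq_bigr => i _.
    by rewrite -rhoH !starM starK [star (C _)]ncstarC aP.1 mulrA.
  rewrite (_ : (\sum_(k < n) _) = \sum_(i : I) \sum_(k < n) \sum_(l < n)
      rho (C (c k) * g i k * C (a k l) * star (C (c l) * g i l))); last first.
    rewrite [RHS]exchange_big; apply: eq_bigr => k _; rewrite [RHS]exchange_big; apply: eq_bigr => l _.
    rewrite mulr_sumr mulr_suml; apply: eq_bigr => i _.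
    rewrite starM [star (C _)]ncstarC.
    by rewrite mulrA (bimodr rhoP) -!mulrA (bimodl rhoP) !mulrA.
  apply: cpos_sum => i _; apply: (cp_of_pos rhoP rho_pos aP (g := fun k => C (c k) * g i k)) => k.
  exact: const_freeMl.
have E k l : fpair rho (e k) (fstar (e l)) (a k l) =
    h k * a k l * star (h l) + fpair rho (e' k) (fstar (e' l)) (a' k l).
  have zz f : rho (0 * f) = 0 by rewrite mul0r (bimod0 rhoP).
  have zr f : rho (f * star 0) = 0 by rewrite star0 mulr0 (bimod0 rhoP).
  rewrite /h /e' /a' /g /vac_coef /fstar; case: (e k) (e l) => b [|[i f] r] [b' [|[j f'] r']] /=.
  - by rewrite big1 ?(fpair0 rhoP) ?addr0 // => i _; rewrite -mulrA zz.
  - by rewrite big1 ?(fpair0 rhoP) ?star0 ?mulr0 ?addr0 // => i _; rewrite -mulrA zz.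
  - by rewrite big1 ?(fpair0 rhoP) ?mul0r ?addr0 // => i' _; rewrite zr.
  - rewrite !mul0r add0r (bigD1 i) //= eqxx big1 ?addr0 => [|i' /negPf ii']; last first.
      by rewrite eq_sym ii' -mulrA zz.
    rewrite {1}/fpair /= eq_sym; case: eqP => // _.
    by rewrite zr (fpair0 rhoP).
under eq_bigr => k _ do under eq_bigr => l _ do rewrite E.
under eq_bigr do rewrite big_split; rewrite big_split; apply: cposD; first exact: aP.2.
apply: IHd => // k; last by rewrite size_behead; have := ed k; case: (size _).
by move=> p pe; apply: (e0 k); move: pe; rewrite /e' /=; case: (e k).2 => //= q r; right.
Qed.

(** Moving [star f] to the right vector yields the Gram sum of the components of [f] applied to the
    vacuum, with the kernel constantly 1. *)
Lemma fock_pos f : cpos (fock_map (f * star f)).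
Proof.
elim/nc_ind: f => t; rewrite [star (ncpi t)]ncstarE -ncpiM fock_mapE fval_mulr.
have -> : fvac = fstar fvac by rewrite /fstar /= star1.
rewrite lact_star big_map; set v := ract rho t (fstar fvac).
have vE : ract rho t fvac = v by rewrite /v /fstar /= star1.
rewrite vE /fval -/v exchange_big /=.
pose e k := nth fvac v k; rewrite (big_nth fvac) big_mkord.
under eq_bigr => k _ do rewrite (big_nth fvac) big_mkord.
have v0 k : fconst_free (e k).
  have [kv|vk] := ltnP k (size v); last by rewrite /e nth_default.
  apply: (@ract_const_free t fvac) => //; rewrite vE /e.
  by elim: (v) (k) kv => // x v' IHv [|m] /=; [left | move=> /IHv; right].
apply: (@fpair_pos (\max_(k < size v) size (e k).2) (size v) e (fun _ _ => 1)) => //.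
  split=> [_ _|c]; first by rewrite star1.
  under eq_bigr do under eq_bigr do rewrite mulr1.
  under eq_bigr do rewrite -mulr_sumr; rewrite -mulr_suml -star_sum.
  exact: cpos_starMr.
move=> k; have [kv|vk] := ltnP k (size v); last by rewrite /e nth_default.
exact: (leq_bigmax (Ordinal kv)).
Qed.

End Positivity.

End FockState.

(** * Freeness *)

Section Layers.
Variables (R : realType) (B : cstarAlgType R) (I : finType).
Variable rho : ncpoly B unit -> B.
Hypothesis rhoP : unital_bimod_map rho.
Local Notation C := (ncC unit).
Local Notation X := (ncX1 B).
Local Notation fstate := (fstate B I).
Local Notation Omega := (fvac B I).
Implicit Types (e x y st : fstate) (b c : B) (s t : ncterm B I).

(* [st (x) e], where the coefficient of [e] acts on [st]. *)
Definition fover st e : fstate := ((rmul st e.1).1, e.2 ++ (rmul st e.1).2).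

Lemma over_vac st : fover st Omega = st.
Proof. by rewrite /fover rmul1; case: st. Qed.

Lemma over_nil st b : fover st (b, [::]) = rmul st b.
Proof. by rewrite /fover /=; case: (rmul _ _). Qed.

Lemma rmul_rmul e b c : rmul (rmul e b) c = rmul e (b * c).
Proof. by case: e => d [|[i f] r]; rewrite /rmul /= -?mulrA ?rmorphM ?mulrA. Qed.

Lemma rmul_over st e c : rmul (fover st e) c = fover st (rmul e c).
Proof.
case: e => b [|[i f] r]; last by rewrite {1}/rmul /fover /=.
by rewrite over_nil rmul_rmul -over_nil.
Qed.

Lemma rpush_over st e i f (psi : fstate -> B) :
  \sum_(x <- rpush rho (fover st e) i f) psi x =
  \sum_(x <- rpush rho e i f) psi (fover st x).
Proof. by rewrite /rpush !big_cons !big_nil rmul_over. Qed.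

Lemma rvar_over st e i (psi : fstate -> B) :
  \sum_(x <- rvar rho i (fover st e)) psi x =
  \sum_(x <- rvar rho i e) psi (fover st x) +
  (if e.2 is [::] then \sum_(x <- rpop rho i (rmul st e.1)) psi x else 0).
Proof.
rewrite /rvar !big_cat /= rpush_over -addrA; congr (_ + _).
case: e => b [|[j f] r]; first by rewrite over_nil /rpop /= big_nil add0r.
rewrite addr0 /rpop /=; case: eqP => _; rewrite ?big_nil //.
exact: (rpush_over st (b, r)).
Qed.

Fixpoint trename (i : I) (t : ncterm B unit) : ncterm B I :=
  match t with
  | Cst b => Cst I b
  | Var _ => Var B i
  | Add s t => Add (trename i s) (trename i t)
  | Mul s t => Mul (trename i s) (trename i t)
  end.

Definition top_neq i st := if st.2 is (j, _) :: _ then j != i else true.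

(** The lower layer [st] can be reached only by popping its top block, which has another colour; the
    action thus takes place as if above the vacuum. *)
Lemma ract_over i (t : ncterm B unit) st e (psi : fstate -> B) : top_neq i st ->
  \sum_(x <- ract rho (trename i t) (fover st e)) psi x =
  \sum_(x <- ract rho (trename i t) e) psi (fover st x).
Proof.
move=> st_i; elim: t e psi => [c|[]|s IHs t IHt|s IHs t IHt] e psi.
- by rewrite /= !big_seq1 rmul_over.
- rewrite rvar_over [X in _ + X](_ : _ = 0) ?addr0 //; case: e.2 => //.
  case: st st_i => b [|[j f] r]; rewrite /top_neq /rpop /= ?big_nil //.
  by rewrite eq_sym => /negPf->; rewrite big_nil.
- by rewrite /= !big_cat /= IHs IHt.
- rewrite /= !big_flatten !big_map IHs; apply: eq_bigr => x _; exact: IHt.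
Qed.

Definition colored i e := all (fun p => p.1 == i) e.2.

Lemma ract_colored i (t : ncterm B unit) e : colored i e -> all (colored i) (ract rho (trename i t) e).
Proof.
have mulS c x : colored i x -> colored i (rmul x c) by case: x => d [|[j f] r].
have pushS f x : colored i x -> all (colored i) (rpush rho x i f).
  by move=> xi; apply/and3P; split=> //; [apply/andP | exact: mulS].
elim: t e => [c|[]|s IHs t IHt|s IHs t IHt] e ei.
- by rewrite /= mulS.
- rewrite /trename /ract /rvar all_cat pushS //=.
  case: e ei => d [|[j f] r] //=; rewrite /rpop /=; case: eqP => // _ /andP[_ ri].
  exact: pushS.
- by rewrite /= all_cat IHs ?IHt.
- rewrite /=; elim: (ract rho _ e) (IHs e ei) => //= x v IHv /andP[xi vi].
  by rewrite all_cat IHt // IHv.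
Qed.

Fixpoint tprod (l : seq (I * ncterm B unit)) : ncterm B I :=
  if l is (i, t) :: l then Mul (trename i t) (tprod l) else Cst I 1.

Lemma fval_rmul t st c : fval rho t (rmul st c) Omega =
  \sum_(y <- lact rho t Omega) fpair rho st y c.
Proof.
rewrite fval_adj; apply: eq_bigr => y _.
by rewrite fpair_rmul mulr1.
Qed.

(** A centred factor acting above [st] has total vacuum coefficient zero, so only states with a new
    top block of its colour survive. The next factor has another colour, and the argument repeats
    until a nonempty state meets the vacuum. *)
Lemma tprod_free l st :
  (st.2 != [::]) || (l != [::]) ->
  (if l is (i, _) :: _ then top_neq i st else true) ->
  sorted (fun p q => p.1 != q.1) l ->
  (forall p, List.In p l -> fval rho (trename p.1 p.2) Omega Omega = 0) ->
  fval rho (tprod l) st Omega = 0.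
Proof.
elim: l st => [|[i t] l IHl] st stl sti srt ctr.
  by rewrite /= fvalC fpair_vac mulr1 /vac_coef; case: st.2 stl.
have ctr_l p : List.In p l -> fval rho (trename p.1 p.2) Omega Omega = 0.
  by move=> pl; apply: ctr; right.
rewrite [tprod _]/= fval_mul -[st]over_vac ract_over //.
(* Additivity of [F] lets the vacuum coefficients be summed before evaluation; it is their sum, not
   each of them, that vanishes. *)
pose F c := fval rho (tprod l) (rmul st c) Omega.
have FD : {morph F : b c / b + c}.
  move=> b c; rewrite /F !fval_rmul -big_split; apply: eq_bigr => y _.
  exact: fpairD.
have F0 : F 0 = 0 by apply: (addrI (F 0)); rewrite -FD !addr0.
have := ctr (i, t) (or_introl erefl); rewrite /fval /= => ctr_t.
transitivity (F (\sum_(x <- ract rho (trename i t) Omega) fpair rho x Omega 1)).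
  rewrite (big_morph F FD F0).
  have /allP all_i := @ract_colored i t Omega isT.
  rewrite big_seq [RHS]big_seq; apply: eq_bigr => x xt; rewrite fpair_vac mulr1.
  have := all_i x xt.
  case: x xt => b [|[j f] r] _; first by rewrite over_nil.
  move=> /andP[/eqP ji _]; transitivity (F 0); last by [].
  rewrite F0; apply: IHl => //.
    by rewrite /top_neq; move: ji => /= ->; case: (l) srt => [|[k u] l'] //= /andP[].
  by case: (l) srt => [|p l'] //= /andP[].
by rewrite ctr_t.
Qed.

End Layers.

Lemma ncincl_trename (R : realType) (B : cstarAlgType R) N (i : 'I_N) t :
  ncincl i (ncpi t) = ncpi (trename i t) :> ncpoly B 'I_N.
Proof.
rewrite /ncincl ncsubstE; elim: t => [b|[]|s IHs t IHt|s IHs t IHt] //=.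
- by rewrite IHs IHt ncpiD.
- by rewrite IHs IHt ncpiM.
Qed.

Lemma fock_free (R : realType) (B : cstarAlgType R) N (rho : ncpoly B unit -> B) :
  unital_bimod_map rho -> vars_free (@fock_map R B 'I_N rho).
Proof.
move=> rhoP m eps A m0 AP epsP A0.
have /choice[tau tauP] : forall k, exists t, (k < m)%N -> A k = ncpi (trename (eps k) t).
  move=> k; have [km|//] := ltnP k m; last by exists (Cst unit 0).
  have [f _ <-] := AP k km; exists (repr f) => _.
  by rewrite -ncincl_trename ncreprK.
have -> : \prod_(0 <= k < m) A k = ncpi (tprod [seq (eps k, tau k) | k <- iota 0 m]).
  rewrite /index_iota subn0; have : {subset iota 0 m <= gtn m}.
    by move=> k; rewrite mem_iota.
  elim: (iota 0 m) => [|k l IHl] lm; first by rewrite big_nil -(rmorph1 (ncC _)).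
  rewrite big_cons tauP; last by apply: lm; rewrite inE eqxx.
  by rewrite IHl -?ncpiM // => j jl; apply: lm; rewrite inE jl orbT.
rewrite (fock_mapE rhoP) tprod_free //.
- by apply/orP; right; rewrite -size_eq0 size_map size_iota -lt0n m0.
- by case: (m) => //.
- rewrite sorted_map; apply/(sortedP 0%N) => k; rewrite size_iota => km.
  by rewrite /= !nth_iota ?(ltnW km) // add0n; apply: epsP.
- have : {subset iota 0 m <= gtn m} by move=> k; rewrite mem_iota.
  elim: (iota 0 m) => //= k l IHl lm p [<-|pl]; last first.
    by apply: IHl pl => j jl; apply: lm; rewrite inE jl orbT.
  have km : (k < m)%N by apply: (lm k); rewrite inE eqxx.
  by rewrite /= -(fock_mapE rhoP) -tauP // A0.
Qed.

(** * Cumulants of the vacuum moments *)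

Lemma big_tuple_cons (V : nmodType) (T : finType) n (P : pred (n.+1.-tuple T))
    (F : n.+1.-tuple T -> V) :
  \sum_(t | P t) F t =
  \sum_(x : T) \sum_(t : n.-tuple T | P [tuple of x :: t]) F [tuple of x :: t].
Proof.
rewrite pair_big_dep (reindex (fun p : T * n.-tuple T => [tuple of p.1 :: p.2])) //=.
exists (fun t => (thead t, [tuple of behead t])) => [[x t] _|t _] /=.
  by congr (_, _); apply: val_inj.
by rewrite [t in RHS]tuple_eta.
Qed.

Section CumulantsOfFock.
Variables (R : realType) (B : cstarAlgType R) (I : finType).
Variable rho : ncpoly B unit -> B.
Hypothesis rhoP : unital_bimod_map rho.
Local Notation C := (ncC unit).
Local Notation X := (ncX1 B).
Local Notation fstate := (fstate B I).
Local Notation Omega := (fvac B I).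
Implicit Types (e x y st : fstate) (c : B) (f : ncpoly B unit) (g : ncpoly B I).

Definition fvalp g e e' := fval rho (repr g) e e'.

Lemma fvalpE t e e' : fvalp (ncpi t) e e' = fval rho t e e'.
Proof. exact/(nceq_fval rhoP)/repr_ncpi. Qed.

Lemma fvalpD g h e e' : fvalp (g + h) e e' = fvalp g e e' + fvalp h e e'.
Proof.
by elim/nc_ind: g => s; elim/nc_ind: h => t; rewrite -ncpiD !fvalpE fvalD.
Qed.

Lemma fvalp0 e e' : fvalp 0 e e' = 0.
Proof. by apply: (addrI (fvalp 0 e e')); rewrite -fvalpD !addr0. Qed.

Lemma fvalp1 e e' : fvalp 1 e e' = fpair rho e e' 1.
Proof. by rewrite -(rmorph1 (ncC I)) fvalpE fvalC. Qed.

Lemma fvalp_C c g e e' : fvalp (ncC I c * g) e e' = fvalp g (rmul e c) e'.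
Proof. by elim/nc_ind: g => t; rewrite -(ncpiM (Cst I c)) !fvalpE fval_Cst_mul. Qed.

Lemma fvalp_X i g e e' :
  fvalp (ncX B i * g) e e' = \sum_(x <- rvar rho i e) fvalp g x e'.
Proof.
elim/nc_ind: g => t; rewrite -(ncpiM (Var B i)) fvalpE fval_mul.
by apply: eq_bigr => x _; rewrite fvalpE.
Qed.

Lemma fvalp_pair g e e' :
  fvalp g e e' = \sum_(y <- lact rho (repr g) e') fpair rho e y 1.
Proof. exact: fval_adj. Qed.

Lemma fvalp_rmul g st c e' : fvalp g (rmul st c) e' =
  \sum_(y <- lact rho (repr g) e') fpair rho st y c.
Proof.
rewrite fvalp_pair; apply: eq_bigr => y _.
by rewrite fpair_rmul mulr1.
Qed.

(* The block of the letters gathered in [f] is open, and either stays open or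
   is closed right away. *)
Definition open_val i f g := \sum_(x <- rpush rho Omega i f) fvalp g x Omega.

Lemma open_valD i g : {morph open_val i ^~ g : f h / f + h}.
Proof.
move=> f h; rewrite /open_val /rpush !big_cons !big_nil !addr0 addrACA; congr (_ + _).
  rewrite !fvalp_pair -big_split; apply: eq_bigr => -[b [|[j k] r]] _ /=.
    by rewrite /fpair /= addr0.
  rewrite /fpair /=; case: eqP => _; last by rewrite addr0.
  rewrite !mulrDl (bimodD rhoP).
  exact: (fpairD rhoP (1, [::]) (b, r)).
rewrite !fvalp_rmul -big_split; apply: eq_bigr => y _.
by rewrite (bimodD rhoP) (fpairD rhoP).
Qed.

Lemma open_val_C i f c g : open_val i f (ncC I c * g) = open_val i (f * C c) g.
Proof.
rewrite /open_val /rpush !big_cons !big_nil !addr0 !fvalp_C; congr (_ + _).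
by rewrite rmul_rmul (bimodr rhoP).
Qed.

Lemma fock_mapM c g : fvalp g (c, [::]) Omega = c * fock_map rho g.
Proof.
rewrite -[fock_map rho g]/(fvalp g Omega Omega) /fvalp.
by rewrite -(fval_scale rho c) /fscale mulr1.
Qed.

Variables (S : {set I}) (b : nat -> B).
(** A subset [S] covers both uses: [[set i]] gives the law of one variable, [[set: I]] that of the
    full sum. *)
Definition xsum : ncpoly B I := \sum_(i in S) ncX B i.
Definition fword m n := \prod_(m <= k < n) (xsum * ncC I (b k)).
Local Notation M m n := (fock_map rho (fword m n)).

Lemma fword_recl m n : (m < n)%N -> fword m n = xsum * (ncC I (b m) * fword m.+1 n).
Proof. by move=> mn; rewrite /fword big_ltn // mulrA. Qed.

Lemma fvalp_xsum g e e' :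
  fvalp (xsum * g) e e' = \sum_(i in S) \sum_(x <- rvar rho i e) fvalp g x e'.
Proof.
rewrite mulr_suml (big_morph (fun g => fvalp g e e') (id1 := 0) (op1 := +%R)).
- by apply: eq_bigr => i _; rewrite fvalp_X.
- by move=> ? ?; rewrite fvalpD.
- exact: fvalp0.
Qed.

(* The letters read before the first one that joins the open block [f] only
   contribute their moment. *)
Lemma fvalp_over i f e m n : i \in S -> (m <= n)%N ->
  fvalp (fword m n) (fover (1, [:: (i, f)]) e) Omega =
  \sum_(m <= r < n) open_val i (f * C (fvalp (fword m r) e Omega) * X)
                        (ncC I (b r) * fword r.+1 n).
Proof.
move=> iS; move: e; have [k] := ubnP (n - m); elim: k m => // k IHk m.
rewrite ltnS => nmk e; rewrite leq_eqVlt => /predU1P[->|mn].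
  rewrite big_geq // /fword big_geq // fvalp1 fpair_vac /vac_coef /fover /=.
  by case: e.2 => [|? ?]; rewrite mul0r.
pose F r c := open_val i (f * C c * X) (ncC I (b r) * fword r.+1 n).
have FD r : {morph F r : c d / c + d}.
  by move=> c d; rewrite /F rmorphD mulrDr mulrDl open_valD.
have F0 r : F r 0 = 0 by apply: (addrI (F r 0)); rewrite -FD !addr0.
rewrite fword_recl // fvalp_xsum.
under eq_bigr do rewrite rvar_over.
(* The first letter either joins the block [f], possible only when nothing lies above it (the term
   [r = m]), or acts on [e] (the terms [r > m]). *)
rewrite big_split /= addrC big_ltn //; congr (_ + _).
  have -> : fword m m = 1 by rewrite /fword big_geq.
  rewrite -/(F m _) fvalp1 fpair_vac mulr1 /vac_coef.
  case: e.2 => [|? ?]; last by rewrite big1 // F0.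
  rewrite (bigD1 i) //= [X in _ + X]big1 ?addr0 => [|j /andP[_ /negPf ji]].
    by rewrite /rpop /= eqxx.
  by rewrite /rpop /= ji big_nil.
transitivity (\sum_(m.+1 <= r < n) F r (\sum_(j in S) \sum_(x <- rvar rho j e)
    fvalp (ncC I (b m) * fword m.+1 r) x Omega)); last first.
  by apply: eq_big_nat => r /andP[mr _]; rewrite -/(F r _) (fword_recl mr) fvalp_xsum.
under [RHS]eq_bigr do rewrite (big_morph _ (FD _) (F0 _)).
rewrite exchange_big; apply: eq_bigr => j _ /=.
under [RHS]eq_bigr do rewrite (big_morph _ (FD _) (F0 _)).
rewrite exchange_big; apply: eq_bigr => x _ /=.
rewrite fvalp_C rmul_over IHk //; last by lia.
by apply: eq_bigr => r _; rewrite fvalp_C.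
Qed.

Lemma open_valE i f m n : i \in S -> (m <= n)%N ->
  open_val i f (fword m n) = rho f * M m n +
  \sum_(m <= r < n) open_val i (f * C (M m r) * X * C (b r)) (fword r.+1 n).
Proof.
move=> iS mn; rewrite {1}/open_val /rpush !big_cons big_nil addr0 addrC; congr (_ + _).
  by rewrite /rmul /= mul1r fock_mapM.
rewrite -[(_, _ :: _)]over_vac (fvalp_over _ _ iS mn).
by apply: eq_bigr => r _; rewrite open_val_C.
Qed.

Lemma moment_open m n : (m < n)%N ->
  M m n = \sum_(i in S) open_val i (X * C (b m)) (fword m.+1 n).
Proof.
move=> mn; rewrite fword_recl // -[LHS]/(fvalp _ Omega Omega) fvalp_xsum.
by apply: eq_bigr => i _; rewrite /rvar cats0 -open_val_C.
Qed.

(* [cut_prod j l] is the product of the [X Y_s] over the cuts [j :: l]. *)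
Definition cut_arg j k := b j.+1 * M j.+2 k.+1.
Fixpoint cut_prod j l : ncpoly B unit :=
  if l is k :: l' then X * C (cut_arg j k) * cut_prod k l' else 1.

(** The value once the block containing the first letter has absorbed [f], the word being consumed
    up to position [j]: at [j = n] the block closes, otherwise the next letter joins it. *)
Definition cut_val i n j f :=
  if j == n then rho f else open_val i (f * (X * C (b j.+1))) (fword j.+2 n.+1).

(** The next cut [k] is the position just before the next letter of the block; [k = n] means that
    there is none. *)
Lemma cut_valE i n j f : i \in S -> (j < n)%N ->
  cut_val i n j f =
  \sum_(k < n.+1 | (j < k)%N) cut_val i n k (f * (X * C (cut_arg j k))).
Proof.
move=> iS jn; rewrite {1}/cut_val (ltn_eqF jn) open_valE //.
rewrite -(big_mkord (fun k => j < k)%N (fun k => cut_val i n k (f * (X * C (cut_arg j k))))).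
rewrite -(big_nat_widenl j.+1 0 n.+1 predT _ (leq0n _)) [in RHS]big_nat_recr //=. rewrite addrC big_add1 /=.
congr (_ + _).
  by rewrite -(bimodr rhoP) /cut_val eqxx /cut_arg rmorphM !mulrA.
apply: eq_big_nat => k /andP[_ kn]; rewrite /cut_val (ltn_eqF kn).
by rewrite /cut_arg rmorphM !mulrA.
Qed.

(** Iterating [cut_valE] lists all increasing chains of cuts from [j] to [n]. [N] only bounds their
    length. *)
Lemma cut_val_sum i n j f N : i \in S -> (j <= n)%N -> (n - j <= N)%N ->
  cut_val i n j f = \sum_(p < N.+1)
    \sum_(t : p.-tuple 'I_n.+1 | path ltn j (map val t) && (last j (map val t) == n))
      rho (f * cut_prod j (map val t)).
Proof.
move=> iS; elim: N j f => [|N IHN] j f jn nj.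
  have jE : j = n by lia.
  rewrite big_ord_recl big_ord0 addr0 jE (big_pred1 [tuple]) => [|t].
    by rewrite /cut_val eqxx mulr1.
  by rewrite [t]tuple0 /= !eqxx.
have step p : \sum_(t : p.+1.-tuple 'I_n.+1 | path ltn j (map val t) && (last j (map val t) == n))
      rho (f * cut_prod j (map val t)) =
    \sum_(k < n.+1 | (j < k)%N)
      \sum_(t : p.-tuple 'I_n.+1 | path ltn k (map val t) && (last (val k) (map val t) == n))
      rho (f * (X * C (cut_arg j k)) * cut_prod k (map val t)).
  rewrite big_tuple_cons [RHS]big_mkcond; apply: eq_bigr => k _ /=.
  by case: ltnP => jk /=; [apply: eq_bigr => t _; rewrite !mulrA | rewrite big_pred0].
rewrite big_ord_recl [X in _ + X](_ : _ = \sum_(p < N.+1) \sum_(k < n.+1 | (j < k)%N)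
    \sum_(t : p.-tuple 'I_n.+1 | path ltn k (map val t) && (last (val k) (map val t) == n))
      rho (f * (X * C (cut_arg j k)) * cut_prod k (map val t))); last first.
  by apply: eq_bigr => p _; exact: step.
rewrite exchange_big /=.
have [jE|jn'] := eqVneq j n.
  rewrite jE [X in _ + X]big1 ?addr0 => [|k nk]; last by have := ltn_ord k; lia.
  rewrite (big_pred1 [tuple]) => [|t].
    by rewrite /cut_val eqxx mulr1.
  by rewrite [t]tuple0 /= !eqxx.
rewrite big1 ?add0r => [|t]; last by rewrite [t]tuple0 /= (negPf jn').
rewrite cut_valE //; last by lia.
by apply: eq_bigr => k jk; apply: IHN; have := ltn_ord k; lia.
Qed.

Lemma cut_prodE p j l : size l = p -> \prod_(c <- [seq b (nth 0%N (j :: l) s.-1).+1 *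
      M (nth 0%N (j :: l) s.-1).+2 (nth 0%N (j :: l) s).+1 | s <- iota 1 p]) (X * C c) =
  cut_prod j l.
Proof.
elim: p j l => [|p IHp] j [|k l] //= => [_|[lp]]; first by rewrite big_nil.
rewrite big_cons -(IHp _ _ lp); congr (_ * _).
rewrite (iotaDl 1 1) -map_comp !big_map big_seq [RHS]big_seq; apply: eq_bigr => s.
by rewrite mem_iota => /andP[s0 _]; case: s s0.
Qed.

(** The colour of the block opened by the first letter ranges over [S] and does not affect the
    value, whence the factor [#|S|]. *)
Lemma fock_cumulants_sum n : (0 < n)%N ->
  M 1 n.+1 = \sum_(1 <= p < n.+1) \sum_(t : p.+1.-tuple 'I_n.+1 | cut_points t)
    rho (\prod_(c <- [seq b (nth 0%N (map val t) s.-1).+1 *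
      M (nth 0%N (map val t) s.-1).+2 (nth 0%N (map val t) s).+1 | s <- iota 1 p])
         (X * C c)) *+ #|S|.
Proof.
move=> n0; rewrite moment_open //.
have cutv i : i \in S -> open_val i (X * C (b 1)) (fword 2 n.+1) = cut_val i n 0 1.
  by rewrite /cut_val eq_sym (gtn_eqF n0) mul1r.
rewrite (eq_bigr _ cutv); under eq_bigr do rewrite (@cut_val_sum _ _ _ _ n) ?subn0 //.
rewrite sumr_const; under [RHS]eq_bigr do rewrite sumrMnl.
rewrite sumrMnl; congr (_ *+ _).
rewrite big_ord_recl [X in X + _]big1 ?add0r => [|t]; last first.
  by rewrite [t]tuple0 /= eq_sym (gtn_eqF n0).
rewrite big_add1 big_mkord; apply: eq_bigr => p _.
rewrite [RHS]big_tuple_cons (bigD1 ord0) //= [X in _ + X]big1 ?addr0 => [|k k0]; last first.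
  rewrite big_pred0 // => t; rewrite /cut_points /=.
  by have := k0; rewrite -val_eqE /= => /negPf->; rewrite andbF.
apply: eq_big => [t|t _]; first by rewrite /cut_points /=.
by rewrite mul1r -(@cut_prodE p.+1) //= size_map size_tuple.
Qed.

End CumulantsOfFock.

(** * Uniqueness of moments and of free products *)

Lemma cut_bounds n p (j : p.+1.-tuple 'I_n.+1) s : cut_points j -> (0 < s <= p)%N ->
  (nth 0 (map val j) s.-1 < nth 0 (map val j) s <= n)%N.
Proof.
move=> cj /andP[s0 sp]; apply/andP; split.
  by apply: cut_ltn cj _ _ _; rewrite sp prednK ?leqnn.
by rewrite -[X in (_ <= X)%N](cutp cj) (cut_leq cj) // sp leqnn.
Qed.

Section MomentsAndCumulants.
Variables (R : realType) (B : cstarAlgType R).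
Implicit Types (mu nu rho : ncpoly B unit -> B) (b : nat -> B) (kappa : seq B -> B).
Local Notation C := (ncC unit).
Local Notation X := (ncX1 B).

Lemma xprod_shift b m k : xprod b m (m + k) = xprod (fun i => b (i + m).-1) 1 k.+1.
Proof.
rewrite /xprod -{1}[m]add0n big_addn addKn big_add1 /=.
by apply: eq_big_nat => i _.
Qed.

Lemma word_xprod (bs : seq B) :
  \prod_(c <- bs) (X * C c) = xprod (nth 0 (0 :: bs)) 1 (size bs).+1.
Proof. by rewrite (big_nth 0) /xprod big_add1. Qed.

Lemma bimod_ext mu nu : unital_bimod_map mu -> unital_bimod_map nu ->
  (forall b n, mu (xprod b 1 n.+1) = nu (xprod b 1 n.+1)) -> mu = nu.
Proof.
move=> muP nuP mn; apply/funext => f; have [ms ->] := ncspan f.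
rewrite (bimod_sum muP) (bimod_sum nuP); apply: eq_bigr => -[c bs] _ /=.
rewrite (bimodl muP) (bimodl nuP); congr (_ * _).
rewrite word_xprod; exact: mn.
Qed.

(** The moments inside the cumulant arguments belong to strictly shorter words, so the recursion
    determines them all. *)
Lemma moments_uniq mu nu kappa : unital_bimod_map mu -> unital_bimod_map nu ->
  free_cumulants mu kappa -> free_cumulants nu kappa -> mu = nu.
Proof.
move=> muP nuP muK nuK.
suff mn k b m : mu (xprod b m (m + k)) = nu (xprod b m (m + k)).
  by apply: bimod_ext => // b n; rewrite -add1n mn.
have [N] := ubnP k; elim: N k b m => // N IHN k b m; rewrite ltnS => kN.
have [->|k0] := posnP k; first by rewrite addn0 xprod_nil // (bimod1 muP) (bimod1 nuP).
rewrite xprod_shift muK // nuK //; apply: eq_bigr => p _; apply: eq_bigr => j cj.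
congr kappa; apply/eq_in_map => s; rewrite mem_iota add1n ltnS => /(cut_bounds cj).
move: (nth _ _ _) (nth _ _ s) => u v /andP[uv vk]; congr (_ * _).
by rewrite -(subnKC (_ : u.+2 <= v.+1)%N) //; apply: IHN; lia.
Qed.

Lemma eq_free_cumulants mu kappa kappa' :
  (forall bs, bs != [::] -> kappa bs = kappa' bs) ->
  free_cumulants mu kappa -> free_cumulants mu kappa'.
Proof.
move=> kk muK n b n0; rewrite muK //; apply: eq_big_nat => p /andP[p0 _].
apply: eq_bigr => j _; apply: kk.
by rewrite -size_eq0 size_map size_iota -lt0n.
Qed.

Lemma cumulant_map_word mu rho : is_cumulant_map mu rho ->
  free_cumulants mu (fun bs => rho (\prod_(c <- bs) (X * C c))).
Proof.
move=> [rhoP [kappa kP rK]]; apply: eq_free_cumulants kP => bs bs0.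
have sz : (0 < size bs)%N by rewrite lt0n size_eq0.
rewrite word_xprod rK //; congr kappa; rewrite -[1%N]addn0 iotaDl -map_comp.
by rewrite (map_nth_iota0 0 (leqnn _)) take_size.
Qed.

Lemma cumulant_map_of_word mu kappa n b : unital_bimod_map mu ->
  free_cumulants mu kappa -> (0 < n)%N ->
  cumulant_map mu (xprod b 1 n.+1) = kappa [seq b k | k <- iota 1 n].
Proof.
move=> muP muK n0; have [_ [ka kaP ->//]] := cumulant_mapP muP.
apply: (free_cumulants_uniq muP kaP muK).
by rewrite -size_eq0 size_map size_iota -lt0n.
Qed.

Lemma xprod_word b n : xprod b 1 n.+1 = \prod_(c <- [seq b k | k <- iota 1 n]) (X * C c).
Proof. by rewrite big_map /xprod /index_iota subSS subn0. Qed.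

Section FockCumulants.
Variables (I : finType) (rho : ncpoly B unit -> B).
Hypothesis rhoP : unital_bimod_map rho.

Definition fock_sum (S : {set I}) (f : ncpoly B unit) : B :=
  fock_map rho (ncsubst (fun=> xsum B S) f).

Lemma fock_sum_bimod S : unital_bimod_map (fock_sum S).
Proof.
have [p1 pD pB] := fock_bimod I rhoP; rewrite /fock_sum; split.
- by rewrite rmorph1.
- by move=> f g; rewrite ncsubstD pD.
- by move=> b c f; rewrite !rmorphM /= !ncsubstC pB.
Qed.

(** Additivity of free cumulants in the model: [#|S|] free copies multiply [rho] by [#|S|]. *)
Lemma fock_sum_cumulants S :
  free_cumulants (fock_sum S) (fun bs => rho (\prod_(c <- bs) (X * C c)) *+ #|S|).
Proof.
move=> n b n0.
have xE u v : fock_sum S (xprod b u v) = fock_map rho (fword S b u v).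
  rewrite /fock_sum /xprod /fword rmorph_prod; congr fock_map; apply: eq_bigr => k _.
  by rewrite rmorphM /= ncsubstX ncsubstC.
rewrite xE fock_cumulants_sum //; apply: eq_bigr => p _; apply: eq_bigr => j _.
congr (rho _ *+ _); apply: congr_big => //; apply/eq_map => s.
by rewrite xE.
Qed.

End FockCumulants.

End MomentsAndCumulants.

Section FreeUniqueness.
Variables (R : realType) (B : cstarAlgType R) (N : nat).
Variables Phi Psi : ncpoly B 'I_N -> B.
Hypotheses (PhiP : unital_bimod_map Phi) (PsiP : unital_bimod_map Psi).
Hypotheses (PhiF : vars_free Phi) (PsiF : vars_free Psi).
Hypothesis agree : forall i f, Phi (ncincl i f) = Psi (ncincl i f).
Implicit Types (L : seq ('I_N * ncpoly B unit)).

Definition lprod L := \prod_(p <- L) ncincl p.1 p.2.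

Definition alternating L := sorted (fun p q => p.1 != q.1) L.

Lemma lprod_nil : lprod [::] = 1.
Proof. by rewrite /lprod big_nil. Qed.

Lemma lprod_cat L L' : lprod (L ++ L') = lprod L * lprod L'.
Proof. by rewrite /lprod big_cat. Qed.

Lemma lprod_cons p L : lprod (p :: L) = ncincl p.1 p.2 * lprod L.
Proof. by rewrite /lprod big_cons. Qed.

Lemma free_centered (T : ncpoly B 'I_N -> B) L : vars_free T ->
  L != [::] -> alternating L -> (forall p, p \in L -> T (ncincl p.1 p.2) = 0) ->
  T (lprod L) = 0.
Proof.
case: L => // p0 L TF _ alt ctr; set L' := p0 :: L in alt ctr *.
rewrite /lprod (big_nth p0); apply: (TF _ (fun k => (nth p0 L' k).1)
  (fun k => ncincl (nth p0 L' k).1 (nth p0 L' k).2)) => //.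
- by move=> k km; have := sortedP p0 alt k km.
- by move=> k km; apply/ctr/mem_nth.
Qed.

Lemma not_alternating L : ~~ alternating L ->
  exists L1 i f g L2, L = L1 ++ (i, f) :: (i, g) :: L2.
Proof.
elim: L => // -[i f] [|[j g] L] //= IHL; rewrite /alternating /= negb_and negbK.
case/orP=> [/eqP <-|/IHL[L1 [k [f' [g' [L2 ->]]]]]]; first by exists [::], i, f, g, L.
by exists ((i, f) :: L1), k, f', g', L2.
Qed.

Lemma inclD i : {morph @ncincl R B N i : f g / f + g}.
Proof. exact: ncsubstD. Qed.
Lemma inclM i : {morph @ncincl R B N i : f g / f * g}.
Proof. by move=> f g; rewrite /ncincl rmorphM. Qed.
Lemma inclC i b : @ncincl R B N i (ncC unit b) = ncC _ b.
Proof. exact: ncsubstC. Qed.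

(** Induction on the number of factors. Neighbours of equal colour are merged; an alternating
    product is centred factor by factor, each correction being a shorter product. *)
Lemma free_agree_lprod L : Phi (lprod L) = Psi (lprod L).
Proof.
have [n] := ubnP (size L); elim: n L => // n IHn L; rewrite ltnS => Ln.
have [alt|/not_alternating[L1 [i [f [g [L2 LE]]]]]] := boolP (alternating L); last first.
  have -> : lprod L = lprod (L1 ++ (i, f * g) :: L2).
    by rewrite LE !lprod_cat !lprod_cons inclM !mulrA.
  by apply: IHn; move: Ln; rewrite LE !size_cat /=; lia.
have [->|L0] := eqVneq L [::].
  by rewrite lprod_nil (bimod1 PhiP) (bimod1 PsiP).
(* [L1] is the prefix already centred, [L2] the factors still to be treated. *)
suff ctr L2 L1 : (size (L1 ++ L2) <= n)%N -> alternating (L1 ++ L2) -> L1 ++ L2 != [::] ->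
    (forall p, p \in L1 -> Phi (ncincl p.1 p.2) = 0) ->
    Phi (lprod (L1 ++ L2)) = Psi (lprod (L1 ++ L2)).
  exact: (ctr L [::]).
elim: L2 L1 => [|[i f] L2 IHL2] L1.
  rewrite cats0 => _ L1a L10 L1c; rewrite !free_centered // => p /L1c.
  by rewrite agree.
move=> sz La _ L1c; pose c := Phi (ncincl i f); pose f0 := f - ncC unit c.
have fE : ncincl i f = ncincl i f0 + ncC _ c by rewrite -(inclC i) -inclD subrK.
have -> : lprod (L1 ++ (i, f) :: L2) =
    lprod (rcons L1 (i, f0) ++ L2) + lprod L1 * ncC _ c * lprod L2.
  rewrite -cats1 !lprod_cat !lprod_cons /= fE lprod_nil mulr1.
  by rewrite mulrDl mulrDr !mulrA.
rewrite (bimodD PhiP) (bimodD PsiP); congr (_ + _).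
  apply: IHL2; rewrite ?cat_rcons ?size_cat //; first by move: sz; rewrite size_cat.
  - move: La; rewrite /alternating; case: (L1) => [|q L1'] /=; last rewrite !cat_path /=;
      by case: (L2).
  - by case: (L1).
  - move=> p; rewrite mem_rcons inE => /predU1P[->|/L1c //] /=.
    have Cc : Phi (ncC _ c) = c by rewrite -[ncC _ c]mulr1 (bimodl PhiP) (bimod1 PhiP) mulr1.
    by apply: (addIr c); rewrite add0r -{1}Cc -(bimodD PhiP) -fE.
case: L2 sz {IHL2 La} => [|[j g] L2] sz.
  rewrite lprod_nil mulr1 (bimodr PhiP) (bimodr PsiP) IHn //.
  by move: sz; rewrite size_cat /=; lia.
have -> : lprod L1 * ncC _ c * lprod ((j, g) :: L2) = lprod (L1 ++ (j, ncC unit c * g) :: L2).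
  by rewrite lprod_cat !lprod_cons inclM inclC !mulrA.
by apply: IHn; move: sz; rewrite !size_cat /=; lia.
Qed.

(** The colour [i0] supplies a subalgebra in which constants can be placed, so that products of
    [ncincl] span everything. *)
Lemma free_agree (i0 : 'I_N) f : Phi f = Psi f.
Proof.
pose S (g : ncpoly B 'I_N) := exists Ls, g = \sum_(L <- Ls) lprod L.
have SD g h : S g -> S h -> S (g + h).
  by move=> [Ls ->] [Ls' ->]; exists (Ls ++ Ls'); rewrite big_cat.
have S0 : S 0 by exists [::]; rewrite big_nil.
have Smul t g : S g -> S (g * ncpi t).
  have one i h : (forall L, S (lprod L * ncincl i h)).
    by move=> L; exists [:: rcons L (i, h)]; rewrite big_seq1 -cats1 lprod_cat lprod_cons lprod_nil mulr1.
  elim: t g => [b|i|s IHs t IHt|s IHs t IHt] g Sg.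
  - have [Ls ->] := Sg; rewrite mulr_suml; elim/big_ind: _ => // L _.
    by rewrite -[ncpi _](inclC i0); apply: one.
  - have [Ls ->] := Sg; rewrite mulr_suml; elim/big_ind: _ => // L _.
    by have := one i (ncX1 B) L; rewrite /ncincl ncsubstX.
  - by rewrite ncpiD mulrDr; apply: SD; [apply: IHs|apply: IHt].
  - by rewrite ncpiM mulrA; apply/IHt/IHs.
have [Ls ->] : S f.
  rewrite -[f]ncreprK -[ncpi _]mul1r; apply: Smul.
  by exists [:: [::]]; rewrite big_seq1 lprod_nil.
rewrite (bimod_sum PhiP) (bimod_sum PsiP); apply: eq_bigr => L _.
exact: free_agree_lprod.
Qed.

End FreeUniqueness.

(** * Asymptotics of the moments of the roots *)

Section Asymptotics.
Variables (R : realType) (B : cstarAlgType R).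
Local Notation C := (ncC unit).
Local Notation X := (ncX1 B).

Definition invn (n : nat) : R[i] := (n.+1%:R^-1)%:C%C.

(** Stated for an arbitrary algebra because moments enter both as elements of B and inside
    polynomials to which [rho] is applied. *)
Definition poly_inv (A : algType R[i]) (F : nat -> A) : Prop :=
  exists p : {poly A}, forall n, F n = p.[(invn n)%:A].

Section PolyInv.
Variable A : algType R[i].
Implicit Types F G : nat -> A.

Lemma poly_inv_cst (a : A) : poly_inv (fun=> a).
Proof. by exists a%:P => n; rewrite hornerC. Qed.

Lemma poly_invD F G : poly_inv F -> poly_inv G -> poly_inv (fun n => F n + G n).
Proof. by move=> [p Fp] [q Gq]; exists (p + q) => n; rewrite hornerD Fp Gq. Qed.

Lemma poly_invM F G : poly_inv F -> poly_inv G -> poly_inv (fun n => F n * G n).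
Proof.
move=> [p Fp] [q Gq]; exists (p * q) => n; rewrite Fp Gq hornerM_comm //.
by rewrite /comm_poly mulr_algl mulr_algr.
Qed.

Lemma poly_invZ F : poly_inv F -> poly_inv (fun n => invn n *: F n).
Proof.
move=> [p Fp]; exists ('X * p) => n; rewrite hornerM_comm ?hornerX ?mulr_algl ?Fp //.
by rewrite /comm_poly mulr_algl mulr_algr.
Qed.

Lemma poly_inv_sum (T : Type) (r : seq T) (P : pred T) (F : T -> nat -> A) :
  (forall i, P i -> poly_inv (F i)) -> poly_inv (fun n => \sum_(i <- r | P i) F i n).
Proof.
move=> FP; elim: r => [|i r IHr].
  have [p pE] := poly_inv_cst 0; exists p => n; rewrite big_nil; exact: pE.
have [p pE] := IHr; case Pi: (P i); last by exists p => n; rewrite big_cons Pi.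
have [q qE] := FP i Pi; exists (q + p) => n; by rewrite big_cons Pi hornerD -pE -qE.
Qed.

Lemma poly_inv_prod (T : Type) (r : seq T) (F : T -> nat -> A) :
  (forall i, poly_inv (F i)) -> poly_inv (fun n => \prod_(i <- r) F i n).
Proof.
move=> FP; elim: r => [|i r IHr].
  have [p pE] := poly_inv_cst 1; exists p => n; rewrite big_nil; exact: pE.
have [p pE] := poly_invM (FP i) IHr; exists p => n; by rewrite big_cons -pE.
Qed.

End PolyInv.

(** An algebraic form of being of order [1/n]; boundedness in norm is extracted only at the end, by
    [poly_inv_bounded]. *)
Definition small_inv (A : algType R[i]) (F : nat -> A) : Prop :=
  exists2 G, poly_inv G & forall n, F n = invn n *: G n.

Lemma eq_poly_inv (A : algType R[i]) (F G : nat -> A) : F =1 G -> poly_inv F -> poly_inv G.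
Proof. by move=> FG [p Fp]; exists p => n; rewrite -FG. Qed.

Lemma poly_inv_comp (A A' : algType R[i]) (h : A -> A') (F : nat -> A) :
  {morph h : x y / x + y} -> (forall (a : R[i]) x, h (a *: x) = a *: h x) ->
  poly_inv F -> poly_inv (fun n => h (F n)).
Proof.
move=> hD hZ [p Fp]; exists (\poly_(i < size p) h p`_i) => n.
have h0 : h 0 = 0 by rewrite -(scale0r (0 : A)) hZ scale0r.
rewrite Fp horner_coef horner_poly (big_morph h hD h0); apply: eq_bigr => i _.
by rewrite exprZn expr1n mulr_algr hZ exprZn expr1n mulr_algr.
Qed.

Lemma small_inv_poly (A : algType R[i]) (F : nat -> A) : small_inv F -> poly_inv F.
Proof. by move=> [G Gp GE]; apply: eq_poly_inv (poly_invZ Gp) => n; rewrite GE. Qed.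

Lemma small_inv_sum (A : algType R[i]) (T : Type) (r : seq T) (P : pred T)
    (F : T -> nat -> A) :
  (forall i, P i -> small_inv (F i)) -> small_inv (fun n => \sum_(i <- r | P i) F i n).
Proof.
move=> FP; elim: r => [|i r [G Gp GE]].
  by exists (fun=> 0) => [|n]; [exact: poly_inv_cst | rewrite big_nil scaler0].
case Pi: (P i); last by exists G => // n; rewrite big_cons Pi.
have [H Hp HE] := FP i Pi; exists (fun n => H n + G n); first exact: poly_invD.
by move=> n; rewrite big_cons Pi scalerDr -HE -GE.
Qed.

Lemma small_inv_prod (A : algType R[i]) (T : eqType) (r : seq T) (i0 : T)
    (F : T -> nat -> A) : (forall i, poly_inv (F i)) -> i0 \in r ->
  small_inv (F i0) -> small_inv (fun n => \prod_(i <- r) F i n).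
Proof.
move=> FP + [G Gp GE]; elim: r => // i r IHr; rewrite inE => /predU1P[<-|/IHr[H Hp HE]].
  exists (fun n => G n * \prod_(i <- r) F i n); first exact/poly_invM/poly_inv_prod.
  by move=> n; rewrite big_cons GE scalerAl.
exists (fun n => F i n * H n); first exact: poly_invM.
by move=> n; rewrite big_cons HE scalerAr.
Qed.

Lemma small_inv_comp (A A' : algType R[i]) (h : A -> A') (F : nat -> A) :
  {morph h : x y / x + y} -> (forall (a : R[i]) x, h (a *: x) = a *: h x) ->
  small_inv F -> small_inv (fun n => h (F n)).
Proof.
move=> hD hZ [G Gp GE]; exists (fun n => h (G n)); first exact: poly_inv_comp.
by move=> n; rewrite GE hZ.
Qed.

Lemma poly_inv_bounded (F : nat -> B) : poly_inv F ->
  exists2 M : R, 0 <= M & forall n, cnorm (F n) <= M.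
Proof.
move=> [p Fp]; exists (\sum_(i < size p) cnorm p`_i); first by apply: sumr_ge0 => i _; exact: cnorm_ge0.
move=> n; rewrite Fp horner_coef.
apply: (@le_trans _ _ (\sum_(i < size p) cnorm (p`_i * (invn n)%:A ^+ i))).
  elim/big_ind2: _ => [|x a y b xa yb|//]; first by rewrite cnorm0.
  by rewrite (le_trans (cnormD _ _)) // lerD.
apply: ler_sum => i _; rewrite exprZn expr1n mulr_algr cnormZ.
rewrite -[leRHS]mul1r ler_wpM2r ?cnorm_ge0 //.
rewrite -rmorphXn normc_real ger0_norm ?exprn_ge0 ?invr_ge0 //.
by rewrite exprn_ile1 ?invr_ge0 // invf_le1 ?ler1n ?ltr0n.
Qed.

Variables (rho : ncpoly B unit -> B) (mus : nat -> ncpoly B unit -> B).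
Hypothesis rhoP : unital_bimod_map rho.
Hypothesis musP : forall n, unital_bimod_map (mus n).
Hypothesis musK : forall n,
  free_cumulants (mus n) (fun bs => invn n *: rho (\prod_(c <- bs) (X * C c))).

(** Every cumulant carries a factor [invn n]; what remains is [rho] of products of shorter moments,
    polynomial by induction. *)
Lemma moment_order k b m : (0 < k)%N ->
  small_inv (fun n => mus n (xprod b m (m + k))).
Proof.
have [N] := ubnP k; elim: N k b m => // N IHN k b m; rewrite ltnS => kN k0.
rewrite xprod_shift; set d := fun i => b (i + m).-1.
exists (fun n => \sum_(1 <= p < k.+1) \sum_(j : p.+1.-tuple 'I_k.+1 | cut_points j)
   rho (\prod_(c <- cumulant_args (mus n) d p (map val j)) (X * C c))).
  apply: poly_inv_sum => p _; apply: poly_inv_sum => j cj.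
  apply: poly_inv_comp; [exact: (bimodD rhoP) | exact: (bimodZ rhoP) |].
  (* The default 0 outside [1..p] is there because [poly_inv_prod] requires every factor to be
     polynomial, whatever [s]. *)
  apply: (eq_poly_inv (F := fun n => \prod_(s <- iota 1 p) (X * C (if (0 < s <= p)%N then
      d (nth 0 (map val j) s.-1).+1 *
      mus n (xprod d (nth 0 (map val j) s.-1).+2 (nth 0 (map val j) s).+1) else 0)))) => [n|].
    rewrite big_map big_seq [RHS]big_seq; apply: eq_bigr => s; rewrite mem_iota add1n ltnS.
    by move=> ->.
  apply: poly_inv_prod => s; apply: poly_invM; first exact: poly_inv_cst.
  apply: poly_inv_comp; [exact: rmorphD | |].
    by move=> a x; rewrite -mulr_algl rmorphM /= ncCA mulr_algl.
  case sp: (0 < s <= p)%N; last exact: poly_inv_cst.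
  apply: poly_invM; first exact: poly_inv_cst.
  have := cut_bounds cj sp; move: (nth _ _ _) (nth _ _ s) => u v /andP[uv vk].
  rewrite -(subnKC (_ : u.+2 <= v.+1)%N) //.
  have [l0|l0] := posnP (v.+1 - u.+2)%N.
    apply: (eq_poly_inv (F := fun=> 1)) => [n|]; last exact: poly_inv_cst.
    by rewrite l0 addn0 xprod_nil // (bimod1 (musP n)).
  by apply/small_inv_poly/IHN => //; lia.
move=> n; rewrite musK // scaler_sumr; apply: eq_bigr => p _.
by rewrite scaler_sumr.
Qed.

Lemma moment_small b m k : (m < k)%N -> small_inv (fun n => mus n (xprod b m k)).
Proof. by move=> mk; rewrite -(subnKC (ltnW mk)); apply: moment_order; lia. Qed.

Lemma moment_poly b m k : poly_inv (fun n => mus n (xprod b m k)).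
Proof.
have [km|mk] := leqP k m; last exact/small_inv_poly/moment_small.
apply: (eq_poly_inv (F := fun=> 1)) => [n|]; last exact: poly_inv_cst.
by rewrite xprod_nil // (bimod1 (musP n)).
Qed.

(** If all gaps were 1, the cuts would satisfy [j_s <= s] and could not reach [k] in [p < k] steps.
    A gap of at least 2 encloses a nonempty word. *)
Lemma cut_long_block k p (j : p.+1.-tuple 'I_k.+1) : cut_points j -> (p < k)%N ->
  exists2 s, (0 < s <= p)%N & ((nth 0 (map val j) s.-1).+2 <= nth 0 (map val j) s)%N.
Proof.
move=> cj pk; apply: contrapT => nex.
have le s : (s <= p)%N -> (nth 0 (map val j) s <= s)%N.
  elim: s => [|s IHs] sp; first by rewrite (cut0 cj).
  rewrite leqNgt; apply/negP => lt; apply: nex; exists s.+1; first by rewrite sp.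
  by rewrite (leq_trans _ lt) // !ltnS IHs // ltnW.
by have := le p (leqnn p); rewrite (cutp cj) leqNgt pk.
Qed.

Lemma cX_additive : {morph (fun c => X * C c) : c d / c + d}.
Proof. by move=> c d; rewrite rmorphD mulrDr. Qed.

Lemma cX_scalable (a : R[i]) c : X * C (a *: c) = a *: (X * C c).
Proof. by rewrite -mulr_algl rmorphM /= ncCA mulr_algl -scalerAr. Qed.

(** The finest cut [p = k] contributes [rho] of the word itself. For [p < k] some gap encloses a
    nonempty moment, which supplies a second factor [invn n]. *)
Lemma moment_asymptotics_word b k : (0 < k)%N -> exists2 H, small_inv H &
  forall n, mus n (xprod b 1 k.+1) = invn n *: (rho (xprod b 1 k.+1) + H n).
Proof.
move=> k0; exists (fun n => \sum_(1 <= p < k) \sum_(j : p.+1.-tuple 'I_k.+1 | cut_points j)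
   rho (\prod_(c <- cumulant_args (mus n) b p (map val j)) (X * C c))).
  have E n : \sum_(1 <= p < k) \sum_(j : p.+1.-tuple 'I_k.+1 | cut_points j)
     rho (\prod_(c <- cumulant_args (mus n) b p (map val j)) (X * C c)) =
     \sum_(p <- index_iota 1 k | (p < k)%N) \sum_(j : p.+1.-tuple 'I_k.+1 | cut_points j)
     rho (\prod_(c <- cumulant_args (mus n) b p (map val j)) (X * C c)).
    by rewrite big_seq [RHS]big_seq_cond; apply: eq_bigl => p;
       rewrite mem_index_iota; case: (p < k)%N; rewrite ?andbT ?andbF.
  have [G Gp GE] : small_inv (fun n => \sum_(p <- index_iota 1 k | (p < k)%N)
     \sum_(j : p.+1.-tuple 'I_k.+1 | cut_points j)
     rho (\prod_(c <- cumulant_args (mus n) b p (map val j)) (X * C c))).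
    apply: small_inv_sum => p pk; apply: small_inv_sum => j cj.
    apply: small_inv_comp; [exact: (bimodD rhoP) | exact: (bimodZ rhoP) |].
    have [s0 s0p lt] := cut_long_block cj pk.
    have [G Gp GE] : small_inv (fun n => \prod_(s <- iota 1 p) (X * C (
        b (nth 0 (map val j) s.-1).+1 *
        mus n (xprod b (nth 0 (map val j) s.-1).+2 (nth 0 (map val j) s).+1)))).
      apply: (@small_inv_prod _ _ _ s0) => [s||].
      - apply: (poly_inv_comp (h := fun c => X * C c)); [exact: cX_additive | exact: cX_scalable |].
        by apply: poly_invM; [exact: poly_inv_cst | exact: moment_poly].
      - by rewrite mem_iota add1n ltnS.
      - apply: (small_inv_comp (h := fun c => X * C c)); [exact: cX_additive | exact: cX_scalable |].
        apply: (small_inv_comp (h := *%R (b (nth 0 (map val j) s0.-1).+1))); [exact: mulrDr | by move=> a x; rewrite scalerAr |].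
        exact: moment_small.
    by exists G => // n; rewrite -GE big_map.
  by exists G => // n; rewrite E GE.
move=> n; rewrite musK // big_nat_recr //= -[X in _ + X]/(cut_sum (mus n)
  (fun bs => invn n *: rho (\prod_(c <- bs) (X * C c))) k b k) (cut_sum_top (musP n)).
rewrite scalerDr addrC -xprod_word; congr (_ + _).
rewrite scaler_sumr; apply: eq_bigr => p _.
by rewrite scaler_sumr.
Qed.

Lemma moment_asymptotics f : no_free_term f -> exists2 H, small_inv H &
  forall n, mus n f = invn n *: (rho f + H n).
Proof.
move=> [ms + ->]; elim: ms => [_|[c bs] ms IHms /= /andP[bs0 /IHms[H Hs HE]]].
  exists (fun=> 0); last by move=> n; rewrite big_nil (bimod0 rhoP) addr0 (bimod0 (musP n)) scaler0.
  by exists (fun=> 0) => [|n]; [exact: poly_inv_cst | rewrite scaler0].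
have sz : (0 < size bs)%N by rewrite lt0n size_eq0.
have [H' [G Gp GE] HE'] := moment_asymptotics_word (nth 0 (0 :: bs)) sz.
have [G' Gp' GE'] := Hs.
exists (fun n => c * H' n + H n).
  exists (fun n => c * G n + G' n) => [|n]; last by rewrite GE GE' scalerDr scalerAr.
  by apply: poly_invD => //; apply: poly_invM => //; exact: poly_inv_cst.
move=> n; rewrite big_cons (bimodD rhoP) (bimodD (musP n)) HE (bimodl rhoP) (bimodl (musP n)).
by rewrite word_xprod HE' -scalerAr -scalerDr mulrDr addrACA.
Qed.

Lemma cumulant_pos_of_moments f : no_free_term f ->
  (forall n, cpos (mus n f)) -> cpos (rho f).
Proof.
move=> f0 fp; have [H [G Gp GE] HE] := moment_asymptotics f0.
have [M M0 GM] := poly_inv_bounded Gp.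
apply: (@cpos_lim _ _ (fun n => rho f + H n)) => [e e0|n]; last first.
  have -> : rho f + H n = (n.+1%:R)%:C%C *: mus n f.
    by rewrite HE scalerA -rmorphM divff ?pnatr_eq0 // rmorph1 scale1r.
  exact: cposZ.
exists (Num.bound (M / e)) => n Nn; rewrite addrC addKr GE cnormZr ?invr_ge0 //.
rewrite mulrC ltr_pdivrMr ?ltr0n // (le_lt_trans (GM n)) // mulrC -ltr_pdivrMr //.
rewrite (lt_le_trans (archi_boundP _)) ?divr_ge0 ?(ltW e0) //.
by rewrite ler_nat ltnW.
Qed.

End Asymptotics.

(** * Infinite divisibility *)

Section Hermitian.
Variables (R : realType) (B : cstarAlgType R).
Implicit Types (mu phi rho : ncpoly B unit -> B) (f g : ncpoly B unit).
Local Notation C := (ncC unit).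
Local Notation X := (ncX1 B).

(** Self-adjointness at [f + g] gives one half of the identity, at [f + 'i *: g] the other. [S]
    stands for the whole algebra or for the ideal without constant terms. *)
Lemma polarization phi (S : ncpoly B unit -> Prop) : unital_bimod_map phi ->
  (forall f g, S f -> S g -> S (f + g)) -> (forall (a : R[i]) f, S f -> S (a *: f)) ->
  (forall f, S f -> star (phi (star f * f)) = phi (star f * f)) ->
  forall f g, S f -> S g -> star (phi (star f * g)) = phi (star g * f).
Proof.
move=> phiP SD SZ sa f g Sf Sg.
have e1 : star (phi (star f * g)) + star (phi (star g * f)) =
    phi (star f * g) + phi (star g * f).
  have := sa (f + g) (SD _ _ Sf Sg); rewrite starD mulrDl !mulrDr !(bimodD phiP) !starD.
  rewrite !sa //; set A := phi (star f * g); set D := phi (star g * f).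
  move=> h; apply: (addrI (phi (star f * f))); apply: (addIr (phi (star g * g))).
  rewrite !addrA in h *; exact: h.
have e2 : star (phi (star f * g)) - star (phi (star g * f)) =
    phi (star g * f) - phi (star f * g).
  have := sa (f + 'i *: g) (SD _ _ Sf (SZ _ _ Sg)).
  rewrite starD starZ conjCi mulrDl !mulrDr -!scalerAl -!scalerAr !(bimodD phiP) !(bimodZ phiP).
  rewrite !starD !starZ conjCi rmorphN /= conjCi opprK !sa //.
  set A := phi (star f * g); set D := phi (star g * f).
  rewrite !scalerA mulNr mulrN -expr2 sqrCi opprK scale1r => h.
  have h' : - 'i *: (star A - star D) = - 'i *: (D - A).
    apply: (addrI (phi (star f * f))); apply: (addIr (phi (star g * g))).
    transitivity (phi (star f * f) + - 'i *: star A + ('i *: star D + phi (star g * g))).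
      by rewrite scalerBr !scaleNr; zmod.
    by rewrite h scalerBr !scaleNr; zmod.
  have i0 : - 'i != 0 :> R[i] by rewrite oppr_eq0 neq0Ci.
  exact: scalerI h'.
set A := phi (star f * g) in e1 e2 *; set D := phi (star g * f) in e1 e2 *.
have h : 2 *: (star A - D) = 0 :> B.
  rewrite scaler_nat mulr2n; transitivity ((star A + star D) + (star A - star D) - D - D).
    by zmod.
  by rewrite e1 e2; zmod.
apply/eqP; rewrite -subr_eq0; apply/eqP; apply: (scalerI (a := 2 : R[i])).
  by rewrite pnatr_eq0.
by rewrite h scaler0.
Qed.

Lemma sigma_star mu f : Sigma mu -> mu (star f) = star (mu f).
Proof.
move=> [muP mu_pos].
have sa g : star (mu (star g * g)) = mu (star g * g).
  by apply: cpos_sa; apply/cposP/mu_pos.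
have := @polarization mu (fun=> True) muP (fun _ _ _ _ => I) (fun _ _ _ => I) (fun g _ => sa g) 1 f I I.
by rewrite star1 mul1r mulr1 => ->.
Qed.

Lemma cumulant_map_X mu : unital_bimod_map mu -> cumulant_map mu X = mu X.
Proof.
move=> muP; have rP := cumulant_mapP muP.
have X1 : X = xprod (fun=> 1) 1 2 by rewrite /xprod big_nat1 rmorph1 mulr1.
have /(_ 1%N (fun=> 1) isT) := cumulant_map_word rP.
rewrite big_nat1.
rewrite -[RHS]/(cut_sum mu (fun bs => cumulant_map mu (\prod_(c <- bs) (X * C c))) 1 (fun=> 1) 1).
by rewrite (cut_sum_top muP) -xprod_word -X1 => ->.
Qed.

(** A word with at least two letters splits as a product of two polynomials without constant term,
    to which polarization applies. A single letter does not split: there the first cumulant equals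
    the mean of [mu], which is hermitian. *)
Lemma cumulant_map_star mu f : Sigma mu ->
  (forall f, const_free f -> cpos (cumulant_map mu (star f * f))) ->
  cumulant_map mu (star f) = star (cumulant_map mu f).
Proof.
move=> muS r_pos; have [muP _] := muS; have [rP _] := cumulant_mapP muP.
set rho := cumulant_map mu in rP r_pos *.
have [ms ->] := ncspan f; rewrite star_sum !(bimod_sum rP) star_sum; apply: eq_bigr.
move=> -[b [|c bs]] _ /=.
  rewrite big_nil mulr1 [star (C b)]ncstarC -(mulr1 (C (star b))) -(mulr1 (C b)).
  by rewrite !(bimodl rP) (bimod1 rP) !mulr1.
rewrite big_cons; case: bs => [|d bs].
  rewrite big_nil mulr1 !starM [star (C b)]ncstarC [star (C c)]ncstarC [star X]ncstarX.
  have [_ _ rB] := rP; rewrite !mulrA !rB !starM mulrA.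
  by rewrite /rho (cumulant_map_X muP) -sigma_star // [star X]ncstarX.
set h := \prod_(_ <- _) _; have h0 : const_free h.
  by rewrite /h big_cons; apply/const_freeMr/const_freeMr/const_freeX.
pose g := star (C b * (X * C c)).
have g0 : const_free g.
  by apply/const_free_star/const_freeMl/const_freeMr/const_freeX.
rewrite [C b * _]mulrA -[C b * _]starK -/g; rewrite starM starK.
symmetry; refine (@polarization rho (@const_free _ B unit) rP _ _ _ g h g0 h0).
- exact: const_freeD.
- by move=> a k; rewrite -mulr_algl; apply: const_freeMl.
- by move=> k k0; apply/cpos_sa/r_pos.
Qed.

End Hermitian.

Section Main.
Variables (R : realType) (B : cstarAlgType R).
Implicit Types (mu rho : ncpoly B unit -> B) (f g : ncpoly B unit).
Local Notation C := (ncC unit).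
Local Notation X := (ncX1 B).

Lemma xsum1 N (i : 'I_N) : xsum B [set i] = ncX B i.
Proof. by rewrite /xsum big_set1. Qed.

Lemma xsumT N : xsum B [set: 'I_N] = \sum_(i < N) ncX B i.
Proof. by apply: eq_bigl => i; rewrite inE. Qed.

Lemma fock_incl N (i : 'I_N) rho nu : unital_bimod_map rho -> unital_bimod_map nu ->
  free_cumulants nu (fun bs => rho (\prod_(c <- bs) (X * C c))) ->
  forall f, fock_map rho (ncincl i f) = nu f.
Proof.
move=> rhoP nuP nuK f; have -> : nu = fock_sum rho [set i].
  apply: (moments_uniq nuP (fock_sum_bimod rhoP [set i])) nuK _.
  by move=> n b n0; rewrite (fock_sum_cumulants rhoP) // cards1.
by rewrite /fock_sum xsum1.
Qed.

(** The Fock model over the cumulants of [muN] is free with the same marginals, so it is the given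
    [Phi]; its sum variable has [N.+1] times these cumulants. *)
Lemma divisible_cumulants mu muN N : unital_bimod_map mu -> unital_bimod_map muN ->
  is_free_convolution (fun _ : 'I_N.+1 => muN) mu ->
  free_cumulants muN (fun bs => invn R N *: cumulant_map mu (\prod_(c <- bs) (X * C c))).
Proof.
move=> muP nuP [Phi [PhiP agr PhiF muE]].
have rK := cumulant_mapP nuP; have [rP _] := rK; have rW := cumulant_map_word rK.
set rho := cumulant_map muN in rK rP rW.
have fE (g : ncpoly B (ordinal N.+1)) : Phi g = fock_map rho g.
  apply: (free_agree PhiP (fock_bimod _ rP) PhiF (fock_free rP) _ ord0) => i f.
  by rewrite agr (fock_incl _ rP nuP rW).
have muF : mu = fock_sum rho [set: 'I_N.+1].
  by apply/funext => f; rewrite muE fE /fock_sum xsumT.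
have muK := fock_sum_cumulants rP [set: 'I_N.+1]; rewrite -muF in muK.
apply: eq_free_cumulants rW => bs bs0.
have sz : (0 < size bs)%N by rewrite lt0n size_eq0.
rewrite word_xprod (cumulant_map_of_word _ muP muK sz) -xprod_word cardsT card_ord.
rewrite -scaler_nat scalerA /invn.
have -> : (N.+1%:R : R[i]) = (N.+1%:R)%:C%C by rewrite rmorph_nat.
by rewrite -rmorphM mulVf ?pnatr_eq0 // rmorph1 scale1r.
Qed.

(** Scales by [t] on polynomials without constant term and keeps the value on constants, so that the
    map stays unital. *)
Definition scaled_cumulants rho (t : R) f : B :=
  (t%:C%C : R[i]) *: rho f + ((1 - t)%:C%C : R[i]) *: rho (ncsubst (fun=> 0) f).

Lemma scaled_cumulants_bimod rho t : unital_bimod_map rho ->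
  unital_bimod_map (scaled_cumulants rho t).
Proof.
move=> rP; have [r1 rD rB] := rP; rewrite /scaled_cumulants; split.
- by rewrite rmorph1 r1 -scalerDl -rmorphD addrC subrK rmorph1 scale1r.
- by move=> f g; rewrite ncsubstD !rD !scalerDr addrACA.
- move=> b c f; rewrite !rmorphM /= !ncsubstC !rB mulrDr mulrDl.
  by rewrite -!scalerAr -!scalerAl.
Qed.

Lemma scaled_cumulants_cf rho t f : unital_bimod_map rho -> const_free f ->
  scaled_cumulants rho t f = (t%:C%C : R[i]) *: rho f.
Proof. by move=> rP f0; rewrite /scaled_cumulants f0 (bimod0 rP) scaler0 addr0. Qed.

Lemma positive_divisible mu : Sigma mu ->
  (forall f, const_free f -> cpos (cumulant_map mu (star f * f))) ->
  freely_infinitely_divisible mu.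
Proof.
move=> muS r_pos [|N] // _; have [muP _] := muS.
have rK := cumulant_mapP muP; have [rP _] := rK; have rW := cumulant_map_word rK.
have rS f := cumulant_map_star f muS r_pos.
set rho := cumulant_map mu in rK rP rW r_pos rS.
pose rhoN := scaled_cumulants rho N.+1%:R^-1.
have rNP : unital_bimod_map rhoN by exact: scaled_cumulants_bimod.
pose Phi : ncpoly B 'I_N.+1 -> B := fock_map rhoN.
have PhiP : unital_bimod_map Phi by exact: fock_bimod.
pose muN f := Phi (ncincl ord0 f).
have muNE : muN = fock_sum rhoN [set ord0 : 'I_N.+1].
  by apply/funext => f; rewrite /fock_sum xsum1.
have muNP : unital_bimod_map muN by rewrite muNE; exact: fock_sum_bimod.
exists muN.
  split=> // f; apply/cposP; rewrite /muN /ncincl rmorphM /= ncsubst_star => [|_]; last exact: ncstarX.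
  (* [fock_pos] treats [f * star f], whereas [Sigma] asks for [star f * f]; the former is used at
     [star f]. *)
  rewrite -{2}[ncsubst _ f]starK; apply: (fock_pos rNP) => [g|g g0].
    rewrite /rhoN /scaled_cumulants ncsubst_star => [|_]; last exact: star0.
    by rewrite !rS starD !starZr.
  rewrite /rhoN scaled_cumulants_cf //; last exact: const_freeMr.
  apply: cposZ; first by rewrite invr_ge0.
  by rewrite -{1}[g]starK; apply/r_pos/const_free_star.
exists Phi; split=> //; last 2 first.
- exact: fock_free.
- move=> f; rewrite -xsumT -[RHS]/(fock_sum rhoN _ f); congr (_ f).
  apply: (moments_uniq muP (fock_sum_bimod rNP _) rW).
  apply: eq_free_cumulants (fock_sum_cumulants rNP _) => bs bs0.
  rewrite cardsT card_ord /rhoN scaled_cumulants_cf //; last first.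
    by case: bs bs0 => // c bs _; rewrite big_cons; apply/const_freeMr/const_freeMr/const_freeX.
  rewrite -scaler_nat scalerA.
  have -> : (N.+1%:R : R[i]) = (N.+1%:R)%:C%C by rewrite rmorph_nat.
  by rewrite -rmorphM mulfV ?pnatr_eq0 // rmorph1 scale1r.
- move=> i f; apply: (fock_incl _ rNP muNP).
  by move=> n b n0; rewrite muNE (fock_sum_cumulants rNP) // cards1.
Qed.

End Main.

Theorem theorem3p8 (R : realType) (B : cstarAlgType R)
    (mu : ncpoly B unit -> B) (hmu : Sigma mu) :
  freely_infinitely_divisible mu <->
  (forall f : ncpoly B unit,
     no_free_term f -> cstar_pos (cumulant_map mu (star f * f))).
Proof.
have [muP _] := hmu; split=> [div f /no_free_termP f0|r_pos]; last first.
  by apply: positive_divisible => // f /no_free_termP/r_pos/cposP.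
have /choice[mus musP] : forall n : nat, exists muN, Sigma muN /\
    is_free_convolution (fun _ : 'I_n.+1 => muN) mu.
  by move=> n; have [muN] := div n.+1 isT; exists muN.
apply/cposP; apply: (@cumulant_pos_of_moments _ _ (cumulant_map mu) mus).
- by case: (cumulant_mapP muP).
- by move=> n; have [[]] := musP n.
- by move=> n; have [[nuP _] conv] := musP n; apply: divisible_cumulants conv.
- exact/no_free_termP/const_freeMl.
- by move=> n; have [[_ pos] _] := musP n; apply/cposP/pos.
Qed.
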